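(* Let $N=\mathbb{Z}^{n+1}$ with canonical basis $e_1,\dots,e_{n+1}$, let $1<d_1\le d_2<n+1$, and let $q_1,\dots,q_{d_1},q_{d_2+1},\dots,q_{n+1}$ be coprime positive integers. Set $v=(-q_1,\dots,-q_{d_1},0,\dots,0,q_{d_2+1},\dots,q_{n+1})\in N$ and $\delta=\langle e_1,\dots,e_{n+1}\rangle$. Let $\Lambda_+$, $\Lambda_-$ be the fans (of the toric varieties $E_+$, $E_-$) with maximal cones $\langle\delta_i,-v\rangle$, $i=d_2+1,\dots,n+1$, respectively $\langle\delta_i,v\rangle$, $i=1,\dots,d_1$, and consider the fan $$\tilde\Sigma=\Lambda_+\cup\Sigma(\delta)\cup\Lambda_-$$ in $N_{\mathbb{R}}$. Then the corresponding toric variety $X_{\tilde\Sigma}$ admits a $\mathbb{C}^*$-action associated to the one-parameter subgroup $v$. Moreover, the fixed locus of this action is given by $X_-$ and $X_+$, which are respectively the sink and the source, and by an inner component isomorphic to $\mathbb{C}^{d_2-d_1}$.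
   Context: $\langle\cdot\rangle$ denotes the convex cone generated in $N_{\mathbb{R}}$; $\delta_i=\langle e_1,\dots,\hat e_i,\dots,e_{n+1}\rangle$ is the facet of $\delta$ opposite to $e_i$ and $\langle\delta_i,\pm v\rangle$ is the cone generated by $\delta_i$ and $\pm v$. $\Sigma(\delta)$ is the fan of all faces of $\delta$; its toric variety is $\mathbb{C}^{n+1}$. The one-parameter subgroup $v$ acts faithfully on $\mathbb{C}^{n+1}$ by $$t\cdot p=(t^{-q_1}p_1,\dots,t^{-q_{d_1}}p_{d_1},p_{d_1+1},\dots,p_{d_2},t^{q_{d_2+1}}p_{d_2+1},\dots,t^{q_{n+1}}p_{n+1}).$$ Write $p=(p_-,p_0,p_+)$ according to negative, zero, positive weights. Put $B_+=\{p_+\ne0\}$, $B_-=\{p_-\neq0\}\subset\mathbb{C}^{n+1}$ and $X_-=B_+/\mathbb{C}^*$, $X_+=B_-/\mathbb{C}^*$ (geometric quotients, which are toric varieties for the lattice $N/\mathbb{Z}v$). The toric variety $E_\pm$ of $\Lambda_\pm$ is $B_\pm\times^{\mathbb{C}^*}\mathbb{C}=(B_\pm\times\mathbb{C})/\!\sim$, where $(e,\lambda)\sim(e',\lambda')$ iff there is $t\in\mathbb{C}^*$ with $e'=te$ and $\lambda'=t\lambda$ for $E_+$ (for $E_-$ the action on $\mathbb{C}$ is taken so that the fan is $\Lambda_-$, i.e. $\lambda'=t^{-1}\lambda$ in the convention where $v$ generates the action); it has a projection to $X_\mp$ with a zero section. $X_-$ and $X_+$ are viewed in $X_{\tilde\Sigma}$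 as the zero sections of $E_+$ and $E_-$. The sink (source) is the fixed component containing the limits of general orbits for $t\to\infty$ (for $t\to0$); other fixed components are inner. *)

(* Defs.v *)
From HB Require Import structures.
From mathcomp Require Import all_boot all_order all_algebra.
From mathcomp Require Import all_classical all_reals all_analysis.
From mathcomp Require Import generic_quotient complex.
From Stdlib Require Import Relation_Operators.

Set Implicit Arguments.
Unset Strict Implicit.
Unset Printing Implicit Defensive.

Import Order.TTheory GRing.Theory Num.Theory.

Local Open Scope classical_set_scope.
Local Open Scope quotient_scope.
Local Open Scope ring_scope.

(* Varieties are handled classically, as spaces with functions: a topological
   space together with, for every open set U, the set of k-valued functions
   that are regular on U.  Functions are total; whether f is regular on U
   depends only on the restriction of f to U in all the constructions below. *)
Record kspace (k : fieldType) := KSpace {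
  kpt :> topologicalType;
  regular : set kpt -> set (kpt -> k) }.

Section Spaces.
Variable k : fieldType.

Definition morphism (X Y : kspace k) (f : X -> Y) : Prop :=
  continuous f /\
  forall (U : set Y) (g : Y -> k),
    open U -> regular U g -> regular (f @^-1` U) (g \o f).

Definition isomorphism (X Y : kspace k) (f : X -> Y) : Prop :=
  morphism f /\ exists g : Y -> X, [/\ morphism g, cancel f g & cancel g f].

Definition isomorphic (X Y : kspace k) : Prop :=
  exists f : X -> Y, isomorphism f.

Inductive subalgebra (T : Type) (G : set (T -> k)) : (T -> k) -> Prop :=
| subalgebra_gen g : G g -> subalgebra G g
| subalgebra_cst c : subalgebra G (fun=> c)
| subalgebra_add f g :
    subalgebra G f -> subalgebra G g -> subalgebra G (fun x => f x + g x)
| subalgebra_mul f g :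
    subalgebra G f -> subalgebra G g -> subalgebra G (fun x => f x * g x).

Definition generated_topology (T : choiceType) (B : set (set T)) : Type := T.

HB.instance Definition _ (T : choiceType) (B : set (set T)) :=
  Choice.copy (generated_topology B) T.
HB.instance Definition _ (T : choiceType) (B : set (set T)) :=
  isSubBaseTopological.Build (generated_topology B) B id.

(* Each chart is a pair of a subset D of T and of a set of functions generating
   a k-algebra A of functions on D; the topology is generated by the sets of
   points of D where some h in A does not vanish, and the regular functions are
   those that are locally fractions of elements of A. *)
Definition fraction_space (T : choiceType)
    (charts : set (set T * set (T -> k))) : kspace k :=
  @KSpace k
    (generated_topology [set S : set T | exists c, charts c /\
       exists2 h, subalgebra c.2 h & S = c.1 `&` [set x | h x != 0]])
    (fun W f => forall p : T, W p -> exists c g h,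
       [/\ charts c, c.1 p & h p != 0] /\
       [/\ subalgebra c.2 g, subalgebra c.2 h &
           forall x : T, W x -> c.1 x -> h x != 0 -> f x = g x / h x]).

Definition affine_model (T : choiceType) (G : set (T -> k)) : kspace k :=
  fraction_space [set (setT, G)].

Definition affine_space (m : nat) : kspace k :=
  @affine_model 'rV[k]_m [set f | exists j, f = fun x : 'rV[k]_m => x 0 j].

Definition affine_line : kspace k := @affine_model k [set id].

Definition subvariety (X : kspace k) (Y : set X) : kspace k :=
  @KSpace k (set_type Y)
    (fun W f => forall p, W p -> exists U g,
       [/\ open U, regular U g, U (val p) &
           forall x, W x -> U (val x) -> f x = g (val x)]).

Definition product (X Y : kspace k) : kspace k :=
  @fraction_space (X * Y)%type
    [set c | exists (U : set X) (V : set Y), [/\ open U, open V &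
       c = (U `*` V,
            [set f | exists2 g, regular U g & f = g \o fst] `|`
            [set f | exists2 g, regular V g & f = g \o snd])]].

Definition disjoint_union (I : choiceType) (X : I -> kspace k) : kspace k :=
  @KSpace k {i & X i}
    (fun W f => forall i,
       regular (existT (fun i => X i) i @^-1` W) (fun x => f (existT _ i x))).

Section Quotient.
Variables (X : kspace k) (r : X -> X -> Prop).

Let rbool : rel X := fun x y => `[< clos_refl_sym_trans X r x y >].

Lemma rbool_equiv : equiv_class_of rbool.
Proof.
split.
- by move=> x; apply/asboolP; exact: rst_refl.
- by move=> x y; apply/asboolP/asboolP => ?; exact: rst_sym.
- by move=> y x z /asboolP xy /asboolP yz; apply/asboolP; exact: rst_trans yz.
Qed.

Definition generated_equiv : equiv_rel X := EquivRelPack rbool_equiv.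

Definition quotient : kspace k :=
  @KSpace k (quotient_topology {eq_quot generated_equiv})
    (fun W f => regular (\pi_(quotient_topology {eq_quot generated_equiv}) @^-1` W)
       (f \o \pi_(quotient_topology {eq_quot generated_equiv}))).

Definition quotient_map (x : X) : quotient :=
  \pi_(quotient_topology {eq_quot generated_equiv}) x.

End Quotient.

Definition isomorphism_onto (X Y : kspace k) (f : X -> Y) (S : set Y) : Prop :=
  exists2 g : X -> subvariety S, isomorphism g & forall x, f x = val (g x).

Definition Gm : kspace k := @subvariety affine_line [set t : k | t != 0].

Definition gm_val (t : Gm) : k := val t.

Lemma gm_neq0 (t : Gm) : gm_val t != 0.
Proof. by have /set_mem := valP t. Qed.

Definition gm (t : k) (t0 : t != 0) : Gm :=
  exist _ t (mem_set (t0 : [set t : k | t != 0] t)).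

Definition gm_one : Gm := gm (oner_neq0 k).

Definition gm_mul (s t : Gm) : Gm := gm (mulf_neq0 (gm_neq0 s) (gm_neq0 t)).

Section GmActions.
Variables (X : kspace k) (a : Gm -> X -> X).

Definition algebraic_action : Prop :=
  [/\ morphism (fun z : product Gm X => a z.1 z.2),
      forall x, a gm_one x = x &
      forall s t x, a (gm_mul s t) x = a s (a t x)].

Definition fixed_locus : set X := [set x | forall t, a t x = x].

Definition fixed_component (Y : set X) : Prop :=
  exists2 y, fixed_locus y & Y = connected_component fixed_locus y.

Definition limit_at_zero (x y : X) : Prop :=
  exists phi : affine_line -> X,
    [/\ morphism phi, forall t : Gm, phi (gm_val t) = a t x & phi (0 : k) = y].

Definition limit_at_infinity (x y : X) : Prop :=
  exists phi : affine_line -> X,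
    [/\ morphism phi, forall t : Gm, phi (gm_val t)^-1 = a t x
      & phi (0 : k) = y].

Definition is_source (Y : set X) : Prop :=
  fixed_component Y /\
  exists U : set X, [/\ open U, dense U &
    forall x, U x -> exists2 y, Y y & limit_at_zero x y].

Definition is_sink (Y : set X) : Prop :=
  fixed_component Y /\
  exists U : set X, [/\ open U, dense U &
    forall x, U x -> exists2 y, Y y & limit_at_infinity x y].

Definition is_inner (Y : set X) : Prop :=
  [/\ fixed_component Y, ~ is_sink Y & ~ is_source Y].

End GmActions.

End Spaces.

Section Fans.
Variables (R : realType) (r : nat).

Definition pairing (u x : 'rV[R]_r) : R := \sum_j u 0 j * x 0 j.

Definition lat (m : 'rV[int]_r) : 'rV[R]_r := map_mx intr m.

Definition cone (s : seq 'rV[int]_r) : set 'rV[R]_r :=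
  [set x | exists2 c : 'I_(size s) -> R,
     forall i, 0 <= c i & x = \sum_i c i *: lat s`_i].

Definition dual_cone (sigma : set 'rV[R]_r) : set 'rV[R]_r :=
  [set u | forall x, sigma x -> 0 <= pairing u x].

Definition is_face (tau sigma : set 'rV[R]_r) : Prop :=
  exists2 u, dual_cone sigma u & tau = sigma `&` [set x | pairing u x = 0].

Definition faces (Gamma : set (set 'rV[R]_r)) : set (set 'rV[R]_r) :=
  [set tau | exists2 sigma, Gamma sigma & is_face tau sigma].

Definition is_fan (Sigma : set (set 'rV[R]_r)) : Prop :=
  [/\ finite_set Sigma,
      forall sigma, Sigma sigma ->
        (exists s, sigma = cone s) /\
        (forall x, sigma x -> sigma (- x) -> x = 0),
      forall sigma tau, Sigma sigma -> is_face tau sigma -> Sigma tau &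
      forall sigma tau, Sigma sigma -> Sigma tau ->
        is_face (sigma `&` tau) sigma /\ is_face (sigma `&` tau) tau].

End Fans.

Section ToricVarieties.
Variables (R : realType) (r : nat).
Implicit Type sigma : set 'rV[R]_r.

Definition semigroup sigma : set 'rV[int]_r :=
  [set m | dual_cone sigma (lat R m)].

(* The closed points of Spec C[S_sigma] are the monoid morphisms from S_sigma to
   the multiplicative monoid C, extended here by 0 outside S_sigma. *)
Definition monoid_morphisms sigma : set ('rV[int]_r -> R[i]) :=
  [set x | [/\ x 0 = 1,
    forall m m', semigroup sigma m -> semigroup sigma m' ->
      x (m + m') = x m * x m' &
    forall m, ~ semigroup sigma m -> x m = 0]].

Definition affine_toric sigma : kspace R[i] :=
  @affine_model R[i] (monoid_morphisms sigma)
    [set f | exists2 m, semigroup sigma m & f = fun x => val x m].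

Definition character_value sigma (x : affine_toric sigma) (m : 'rV[int]_r) :
  R[i] := val x m.

Variable Sigma : set (set 'rV[R]_r).

Definition charts_union : kspace R[i] :=
  disjoint_union (fun sigma : Sigma => affine_toric (val sigma)).

Definition glued (p q : charts_union) : Prop :=
  exists z : affine_toric (val (projT1 p) `&` val (projT1 q)),
    (forall m, semigroup (val (projT1 p)) m ->
       character_value z m = character_value (projT2 p) m) /\
    (forall m, semigroup (val (projT1 q)) m ->
       character_value z m = character_value (projT2 q) m).

Definition toric_variety : kspace R[i] := quotient glued.

Definition chart (sigma : Sigma) (x : affine_toric (val sigma)) :
  toric_variety := quotient_map glued (existT _ sigma x : charts_union).

Definition open_subvariety_of_subfan (Lambda : set (set 'rV[R]_r)) :
  set toric_variety :=
  [set y | exists (sigma : Sigma) (x : affine_toric (val sigma)),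
     Lambda (val sigma) /\ y = chart x].

Definition int_pairing (m v : 'rV[int]_r) : int := \sum_j m 0 j * v 0 j.

Lemma one_parameter_subproof (v : 'rV[int]_r) (t : Gm R[i]) sigma
    (x : affine_toric sigma) :
  monoid_morphisms sigma
    (fun m => gm_val t ^ int_pairing m v * character_value x m).
Proof.
have /set_mem[x0 xD xN] := valP x; split.
- rewrite [character_value _ _]x0 mulr1 /int_pairing big1 ?expr0z// => j _.
  by rewrite mxE mul0r.
- move=> m m' Sm Sm'; rewrite /character_value xD// mulrACA -exprzDr; last first.
    by rewrite unitfE gm_neq0.
  congr (_ ^ _ * _); rewrite /int_pairing -big_split; apply: eq_bigr => j _.
  by rewrite mxE mulrDl.
- by move=> m Sm; rewrite /character_value xN// mulr0.
Qed.

Definition one_parameter_act (v : 'rV[int]_r) (t : Gm R[i]) sigma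
    (x : affine_toric sigma) : affine_toric sigma :=
  exist (fun y => y \in monoid_morphisms sigma) _
    (mem_set (one_parameter_subproof v t x)).

Definition associated_to (v : 'rV[int]_r)
    (a : Gm R[i] -> toric_variety -> toric_variety) : Prop :=
  forall (t : Gm R[i]) (sigma : Sigma) (x : affine_toric (val sigma)),
    a t (chart x) = chart (one_parameter_act v t x).

End ToricVarieties.

(* Indices are 0-based: the negative weights sit at the indices i < d1, the zero
   ones at d1 <= i < d2 and the positive ones at d2 <= i. *)
Section WeightedAction.
Variables (R : realType) (n d1 d2 : nat) (q : 'I_n.+1 -> nat).

Definition weighted (i : 'I_n.+1) : bool := (i < d1)%N || (d2 <= i)%N.

Definition weight_vector : 'rV[int]_n.+1 :=
  \row_i (if (i < d1)%N then - (q i)%:Z else if (i < d2)%N then 0 else (q i)%:Z).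

Local Notation v := weight_vector.

Definition std_basis (j : 'I_n.+1) : 'rV[int]_n.+1 := delta_mx 0 j.

Definition delta : set 'rV[R]_n.+1 := cone [seq std_basis j | j <- enum 'I_n.+1].

Definition facet_and (i : 'I_n.+1) (w : 'rV[int]_n.+1) : set 'rV[R]_n.+1 :=
  cone (w :: [seq std_basis j | j <- enum 'I_n.+1 & j != i]).

Definition Lambda_plus : set (set 'rV[R]_n.+1) :=
  faces [set facet_and i (- v) | i in [set i : 'I_n.+1 | (d2 <= i)%N]].

Definition Lambda_minus : set (set 'rV[R]_n.+1) :=
  faces [set facet_and i v | i in [set i : 'I_n.+1 | (i < d1)%N]].

Definition Sigma_tilde : set (set 'rV[R]_n.+1) :=
  Lambda_plus `|` faces [set delta] `|` Lambda_minus.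

Definition X_tilde : kspace R[i] := toric_variety Sigma_tilde.

Definition weighted_act (t : R[i]) (p : 'rV[R[i]]_n.+1) : 'rV[R[i]]_n.+1 :=
  \row_j (t ^ v 0 j * p 0 j).

Definition B_plus : set (affine_space R[i] n.+1) :=
  [set p : 'rV[R[i]]_n.+1 | exists2 i : 'I_n.+1, (d2 <= i)%N & p 0 i != 0].

Definition B_minus : set (affine_space R[i] n.+1) :=
  [set p : 'rV[R[i]]_n.+1 | exists2 i : 'I_n.+1, (i < d1)%N & p 0 i != 0].

Section Orbits.
Variable B : set (affine_space R[i] n.+1).

Definition orbit_rel (e e' : subvariety B) : Prop :=
  exists2 t : R[i], t != 0 & val e' = weighted_act t (val e).

Definition orbit_space : kspace R[i] := quotient orbit_rel.

Definition twisted_rel (w : int)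
    (e e' : product (subvariety B) (affine_line R[i])) : Prop :=
  exists2 t : R[i], t != 0 &
    val e'.1 = weighted_act t (val e.1) /\ (e'.2 : R[i]) = t ^ w * (e.2 : R[i]).

Definition line_bundle (w : int) : kspace R[i] := quotient (@twisted_rel w).

Definition bundle_point (w : int) (e : subvariety B) (l : R[i]) :
  line_bundle w := quotient_map (@twisted_rel w) (e, l : affine_line R[i]).

End Orbits.

Definition X_minus : kspace R[i] := orbit_space B_plus.
Definition X_plus : kspace R[i] := orbit_space B_minus.
Definition E_plus : kspace R[i] := line_bundle B_plus 1.
Definition E_minus : kspace R[i] := line_bundle B_minus (-1).

Definition coordinates (sigma : set 'rV[R]_n.+1) (x : affine_toric sigma) :
  'rV[R[i]]_n.+1 := \row_j character_value x (std_basis j).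

(* The identification of B x^{C^*} C with the toric variety of Lambda, the
   latter being an open subset of X_tilde: it is the one that restricts, on the
   classes [e, 1], to the inclusion of B into C^{n+1} = U_delta. *)
Definition bundle_identification (B : set (affine_space R[i] n.+1)) (w : int)
    (Lambda : set (set 'rV[R]_n.+1)) (j : line_bundle B w -> X_tilde) : Prop :=
  isomorphism_onto j (@open_subvariety_of_subfan R n.+1 Sigma_tilde Lambda) /\
  forall (d : Sigma_tilde) (x : affine_toric (val d)) (e : subvariety B),
    val d = delta -> val e = coordinates x ->
    j (bundle_point w e 1) = chart x.

Definition zero_section_of (B : set (affine_space R[i] n.+1)) (w : int)
    (j : line_bundle B w -> X_tilde) (s : orbit_space B -> X_tilde) : Prop :=
  forall e : subvariety B, s (quotient_map (@orbit_rel B) e) = j (bundle_point w e 0).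

End WeightedAction.

Arguments Lambda_plus R {n} d1 d2 q.
Arguments Lambda_minus R {n} d1 d2 q.
Arguments Sigma_tilde R {n} d1 d2 q.

(* Main.v *)
(* Every cone of the fan is simplicial, spanned by an allowed set of the rays
   e_1, ..., e_{n+1}, v, -v, and any two of them are separated by an integral
   character that is positive on the rays of the first not in the second,
   negative on the rays of the second not in the first and zero on the common
   ones. This gives the fan axioms and shows that the charts are glued along
   principal open subsets.

   All points are described by Cox coordinates (p, l, m) attached to the rays
   e_j, v, -v. The class [p, l] of a line bundle goes to the point with
   coordinates (p, 1, l) or (p, l, 1). That the inverse of this map is a morphism
   amounts to the description of the invariant functions near an orbit: a regular
   invariant function is a quotient of two polynomials of the same weight, and
   multiplying both by a power of a nonvanishing coordinate p_i makes them
   invariant, i.e. combinations of characters of the chart.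

   The one-parameter subgroup scales p_j by t^{v_j}, and (t p, l, 1) and
   (t p, 1, l) are also (p, t l, 1) and (p, 1, t^{-1} l), whence the fixed points,
   those with l = 0 or with p_j = 0 for all j such that v_j <> 0, and the limits
   of the general orbits. *)

Require Import Defs.
From HB Require Import structures.
From mathcomp Require Import all_boot all_order all_algebra.
From mathcomp Require Import all_classical all_reals all_analysis.
From mathcomp Require Import generic_quotient complex.
From mathcomp Require Import finmap ring zify.
From Stdlib Require Import Relation_Operators.

Set Implicit Arguments.
Unset Strict Implicit.
Unset Printing Implicit Defensive.

Import Order.TTheory GRing.Theory Num.Theory.

Local Open Scope classical_set_scope.
Local Open Scope quotient_scope.
Local Open Scope ring_scope.

(** * Spaces with functions *)

Section SpacesOfFunctions.
Variable k : fieldType.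
Implicit Types X Y Z : kspace k.

(** A [kspace] carries no axioms, so locality, algebra and inversion are collected in [sheaf] and
    proved for each construction. Separating characters come from a missing ray: a cone containing
    [v] or [-v] misses some e_i whose v_i has the opposite sign, and subtracting a large multiple of
    the i-th basis character raises the value on that ray without spoiling the other signs. Two
    obstacles shape the rest. Cox coordinates of a point must be extracted by integral linear
    algebra: Bezout yields characters spanning those orthogonal to the vanishing rays, and over the
    zero section, where stabilisers may be nontrivial, the scalar relating two representatives is a
    root of a complex number. A regular function is only a local fraction, while invariance concerns
    whole orbits: fractions are rewritten as f h = g on a whole invariant open set, which along an
    orbit becomes a Laurent identity in t. A sign [b] treats both ends at once: [true] stands for
    [v], [Lambda_minus] and the source, [false] for [-v], [Lambda_plus] and the sink; the twist is
    [- sg b]. *)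

Record sheaf X : Prop := Sheaf {
  sheaf_eq : forall (W : set X) f g, (forall x, W x -> f x = g x) ->
    regular W f -> regular W g;
  sheaf_sub : forall (V W : set X) f, W `<=` V -> regular V f -> regular W f;
  sheaf_loc : forall (W : set X) f,
    (forall p, W p -> exists U, [/\ open U, U p & regular (W `&` U) f]) ->
    regular W f;
  sheaf_cst : forall (W : set X) c, regular W (fun=> c);
  sheaf_add : forall (W : set X) f g, regular W f -> regular W g ->
    regular W (fun x => f x + g x);
  sheaf_mul : forall (W : set X) f g, regular W f -> regular W g ->
    regular W (fun x => f x * g x);
  sheaf_open : forall (W : set X) f, open W -> regular W f ->
    open (W `&` [set x | f x != 0]);
  sheaf_inv : forall (W : set X) f, open W -> regular W f ->
    regular (W `&` [set x | f x != 0]) (fun x => (f x)^-1) }.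

(** Phrased inside [X], without the subspace on [D], so that local pieces glue in [morphism_local]
    with no change of type. Taking for [U] the whole space shows that [D] is open. *)
Definition morphism_on X Y (D : set X) (f : X -> Y) : Prop :=
  (forall U, open U -> open (D `&` f @^-1` U)) /\
  forall U g, open U -> regular U g -> regular (D `&` f @^-1` U) (g \o f).

Lemma open_locally (T : topologicalType) (W : set T) :
  (forall p, W p -> exists U, [/\ open U, U p & U `<=` W]) -> open W.
Proof.
move=> H; rewrite openE => p /H[U [oU Up UW]].
by apply: (filterS UW); exact: open_nbhs_nbhs.
Qed.

Lemma morphismT X Y (f : X -> Y) : morphism f <-> morphism_on setT f.
Proof.
split=> -[cf rf]; split.
- by move=> U oU; rewrite setTI; move/continuousP: cf; apply.
- by move=> U g oU /rf; rewrite setTI; apply.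
- by apply/continuousP => U oU; rewrite -[_ @^-1` _]setTI; exact: cf.
- by move=> U g oU rg; rewrite -[_ @^-1` _]setTI; exact: rf.
Qed.

Lemma morphism_local X Y (f : X -> Y) : sheaf X ->
  (forall x, exists D, [/\ open D, D x & morphism_on D f]) -> morphism f.
Proof.
move=> sX H; split.
  apply/continuousP => U oU; apply: open_locally => x Ufx.
  have [D [oO Ox [cf _]]] := H x.
  by exists (D `&` f @^-1` U); split; [exact: cf| |exact: subIsetr].
move=> U g oU rg; apply: sheaf_loc => // x Ufx.
have [D [oO Ox [_ rf]]] := H x; exists D; split=> //.
by rewrite setIC; exact: rf.
Qed.

Lemma morphism_on_comp X Y Z (D : set X) (f : X -> Y) (g : Y -> Z) :
  morphism_on D f -> morphism g -> morphism_on D (g \o f).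
Proof.
move=> [cf rf] [/continuousP cg rg]; split=> [U oU|U h oU rh].
  exact: (cf _ (cg _ oU)).
exact: (rf _ _ (cg _ oU) (rg _ _ oU rh)).
Qed.

Lemma morphism_comp X Y Z (f : X -> Y) (g : Y -> Z) :
  morphism f -> morphism g -> morphism (g \o f).
Proof.
by move=> /morphismT mf mg; apply/morphismT; exact: morphism_on_comp.
Qed.

Lemma eq_morphism_on X Y (D : set X) (f g : X -> Y) : sheaf X ->
  (forall x, D x -> f x = g x) -> morphism_on D f -> morphism_on D g.
Proof.
move=> sX fg [cf rf].
have E U : D `&` g @^-1` U = D `&` f @^-1` U.
  apply/seteqP; split=> x /= [Ox]; first by rewrite fg.
  by rewrite fg.
split=> [U oU|U h oU rh]; rewrite E; first exact: cf.
by apply: (sheaf_eq sX _ (rf _ _ oU rh)) => x [Ox _] /=; rewrite fg.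
Qed.

Lemma sheaf_exp X (sX : sheaf X) (W : set X) f (e : nat) :
  regular W f -> regular W (fun x => f x ^+ e).
Proof.
move=> rf; elim: e => [|e IH]; first exact: sheaf_cst.
apply: (sheaf_eq sX _ (sheaf_mul sX rf IH)) => x _.
by rewrite exprS.
Qed.

Lemma sheaf_prod X (sX : sheaf X) (I : Type) (r : seq I) (W : set X) f :
  (forall i, regular W (f i)) -> regular W (fun x => \prod_(i <- r) f i x).
Proof.
move=> rf; elim: r => [|i r IH].
  by apply: (sheaf_eq sX _ (sheaf_cst sX W 1)) => x _; rewrite big_nil.
by apply: (sheaf_eq sX _ (sheaf_mul sX (rf i) IH)) => x _; rewrite big_cons.
Qed.

Lemma sheaf_inv_on X (sX : sheaf X) (W : set X) f : open W -> regular W f ->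
  (forall x, W x -> f x != 0) -> regular W (fun x => (f x)^-1).
Proof.
move=> oW rf f0; apply: (sheaf_sub sX _ (sheaf_inv sX oW rf)).
by move=> x Wx; split=> //; exact: f0.
Qed.

Lemma sheaf_exprz X (sX : sheaf X) (W : set X) f (e : int) : open W ->
  regular W f -> (0 <= e \/ forall x, W x -> f x != 0) ->
  regular W (fun x => f x ^ e).
Proof.
move=> oW rf; case: e => e He; first exact: sheaf_exp.
case: He => // He.
apply: (sheaf_eq sX _ (sheaf_exp sX e.+1 (sheaf_inv_on sX oW rf He))).
by move=> x _; rewrite exprVn.
Qed.

Lemma regular_subalgebra X (sX : sheaf X) (W : set X) (T : Type)
    (G : set (T -> k)) (phi : X -> T) h : (forall g, G g -> regular W (g \o phi)) ->
  subalgebra G h -> regular W (h \o phi).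
Proof.
move=> rG; elim=> [g Gg|c|f g _ rf _ rg|f g _ rf _ rg].
- exact: rG.
- exact: sheaf_cst.
- exact: (sheaf_add sX rf rg).
- exact: (sheaf_mul sX rf rg).
Qed.

Lemma subalgebra_sub (T : Type) (G G' : set (T -> k)) :
  (forall g, G g -> subalgebra G' g) ->
  forall h, subalgebra G h -> subalgebra G' h.
Proof.
move=> GG' h; elim=> [g /GG'//|c|f g _ rf _ rg|f g _ rf _ rg].
- exact: subalgebra_cst.
- exact: subalgebra_add.
- exact: subalgebra_mul.
Qed.

Lemma subalgebra_sum (T : Type) (G : set (T -> k)) (I : Type) (r : seq I)
    (P : pred I) f :
  (forall i, P i -> subalgebra G (f i)) ->
  subalgebra G (fun x => \sum_(i <- r | P i) f i x).
Proof.
move=> H; elim: r => [|i r IH].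
  have -> : (fun x => \sum_(i <- [::] | P i) f i x) = (fun=> 0).
    by apply/funext => x; rewrite big_nil.
  exact: subalgebra_cst.
have -> : (fun x => \sum_(j <- i :: r | P j) f j x) =
  (fun x => (if P i then f i x else 0) + \sum_(j <- r | P j) f j x).
  by apply/funext => x; rewrite big_cons; case: ifP; rewrite ?add0r.
apply: subalgebra_add => //; case Pi: (P i); first exact: H.
exact: subalgebra_cst.
Qed.

Lemma subalgebra_exp (T : Type) (G : set (T -> k)) f e :
  subalgebra G f -> subalgebra G (fun x => f x ^+ e).
Proof.
move=> Gf; elim: e => [|e IH]; first exact: subalgebra_cst.
have -> : (fun x => f x ^+ e.+1) = (fun x => f x * f x ^+ e).
  by apply/funext => x; rewrite exprS.
exact: subalgebra_mul.
Qed.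

(** * Spaces of local fractions *)

Section FractionSpace.
Variables (T : choiceType) (charts : set (set T * set (T -> k))).
Hypothesis charts_cover : forall p, exists2 c, charts c & c.1 p.
Hypothesis charts_refine : forall c c', charts c -> charts c' ->
  exists c'', [/\ charts c'', c''.1 = c.1 `&` c'.1,
    (forall g, c.2 g -> c''.2 g) & (forall g, c'.2 g -> c''.2 g)].
Local Notation FS := (fraction_space charts).

(** The topology is given by a subbase only. Charts being stable under intersection, a finite
    intersection of subbasic sets is again subbasic: intersect the charts and multiply the
    functions. *)
Lemma fraction_base (W : set FS) (p : T) : open W -> W p ->
  exists c h, [/\ charts c, c.1 p, subalgebra c.2 h, h p != 0 &
    forall x, c.1 x -> h x != 0 -> W x].
Proof.
move=> [F HF <-] [A FA Ap].
have [D' sD AE] := HF _ FA; rewrite -AE in Ap.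
suff [c [h [Cc cp Gh hp Hc]]] : exists c h, [/\ charts c, c.1 p,
    subalgebra c.2 h, h p != 0 &
    forall x, c.1 x -> h x != 0 -> forall B, B \in enum_fset D' -> B x].
  exists c, h; split=> // x cx hx; exists A => //; rewrite -AE.
  by move=> B BD; exact: (Hc x cx hx B).
have {Ap}Ap : forall B, B \in enum_fset D' -> B p by move=> B BD; exact: Ap.
have {}sD B : B \in enum_fset D' -> exists c, charts c /\
       exists2 h, subalgebra c.2 h & B = c.1 `&` [set x | h x != 0].
  by move=> /sD /set_mem.
elim: (enum_fset D') Ap sD => [|B s IH] Ap sD.
  have [c Cc cp] := charts_cover p; exists c, (fun=> 1); split=> //.
  - exact: subalgebra_cst.
  - exact: oner_neq0.
have [|//|c [h [Cc cp Gh hp Hc]]] := IH.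
- by move=> B' sB'; apply: Ap; rewrite inE sB' orbT.
- by move=> B' sB'; apply: sD; rewrite inE sB' orbT.
have [c' [Cc' [h' Gh' BE]]] := sD B (mem_head _ _).
have := Ap B (mem_head _ _); rewrite BE => -[c'p h'p].
have [c'' [Cc'' E s1 s2]] := charts_refine Cc Cc'.
exists c'', (fun x => h x * h' x); split=> //.
- by rewrite E.
- apply: subalgebra_mul.
    by apply: subalgebra_sub Gh => g Hg; apply: subalgebra_gen; exact: s1.
  by apply: subalgebra_sub Gh' => g Hg; apply: subalgebra_gen; exact: s2.
- by rewrite mulf_neq0.
move=> x; rewrite E mulf_eq0 negb_or => -[cx c'x] /andP[hx h'x] B'.
rewrite inE => /orP[/eqP->|]; first by [].
exact: Hc.
Qed.

Lemma fraction_basic_open c h : charts c -> subalgebra c.2 h ->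
  open (c.1 `&` [set x | h x != 0] : set FS).
Proof.
move=> Cc Gh; set B := c.1 `&` _; exists [set B]; last by rewrite bigcup_set1.
move=> _ ->; exists [fset B]%fset.
  by move=> _ /fset1P->; apply/mem_set; exists c; split=> //; exists h.
apply/seteqP; split=> x /=; last by move=> Bx C /= /fset1P->.
by apply; exact/fset1P.
Qed.

(** Shrinks a local fraction into a prescribed basic open set: numerator and denominator are both
    multiplied by [h'], so the new denominator vanishes wherever [h'] does. *)
Lemma regular_restrict (W : set FS) f p : regular W f -> W p ->
  forall c', charts c' -> c'.1 p -> forall h', subalgebra c'.2 h' -> h' p != 0 ->
  exists c g h, [/\ charts c, c.1 p, c.1 `<=` c'.1 & h p != 0] /\
       [/\ subalgebra c.2 g, subalgebra c.2 h, forall x, h x != 0 -> h' x != 0 &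
           forall x : T, W x -> c.1 x -> h x != 0 -> f x = g x / h x].
Proof.
move=> rf Wp c' Cc' c'p h' Gh' h'p.
have [c [g [h [[Cc cp hp] [Gg Gh E]]]]] := rf p Wp.
have [c'' [Cc'' Ec s1 s2]] := charts_refine Cc Cc'.
have S1 u : subalgebra c.2 u -> subalgebra c''.2 u.
  by apply: subalgebra_sub => ? ?; apply: subalgebra_gen; exact: s1.
have S2 u : subalgebra c'.2 u -> subalgebra c''.2 u.
  by apply: subalgebra_sub => ? ?; apply: subalgebra_gen; exact: s2.
exists c'', (fun x => g x * h' x), (fun x => h x * h' x); split; split=> //.
- by rewrite Ec.
- by rewrite Ec => x [].
- by rewrite mulf_neq0.
- by apply: subalgebra_mul; auto.
- by apply: subalgebra_mul; auto.
- by move=> x; rewrite mulf_eq0 negb_or => /andP[].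
move=> x Wx; rewrite Ec mulf_eq0 negb_or => -[cx c'x] /andP[hx h'x].
by rewrite E//; field; rewrite hx h'x.
Qed.

Lemma sheaf_fraction : sheaf FS.
Proof.
have S1 : forall c c'' : set T * set (T -> k), (forall g, c.2 g -> c''.2 g) ->
    forall u, subalgebra c.2 u -> subalgebra c''.2 u.
  by move=> c c'' s1 u; apply: subalgebra_sub => ? ?; apply: subalgebra_gen; exact: s1.
have opn (W : set FS) f : open W -> regular W f ->
    open (W `&` [set x | f x != 0]).
  move=> oW rf; apply: open_locally => p [Wp fp].
  have [c [h [Cc cp Gh hp HW]]] := fraction_base oW Wp.
  have [c' [g' [h' [[Cc' c'p sc h'p] [Gg' Gh' hh' E]]]]] :=
    regular_restrict rf Wp Cc cp Gh hp.
  exists (c'.1 `&` [set x | g' x * h' x != 0]); split=> //.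
  - by apply: fraction_basic_open => //; exact: subalgebra_mul.
  - split=> //=; rewrite mulf_neq0//; move: fp; rewrite /= (E p)//.
    by rewrite mulf_eq0 negb_or => /andP[].
  - move=> x [c'x] /=; rewrite mulf_eq0 negb_or => /andP[gx hx].
    have Wx : W x by apply: HW; [exact: sc|exact: hh'].
    by split=> //=; rewrite E// mulf_neq0// invr_eq0.
split.
- move=> W f g fg rf p Wp; have [c [u [h [? [? ? E]]]]] := rf p Wp.
  by exists c, u, h; split=> //; split=> // x Wx cx hx; rewrite -fg//; exact: E.
- move=> V W f WV rf p Wp; have [c [u [h [? [? ? E]]]]] := rf p (WV _ Wp).
  by exists c, u, h; split=> //; split=> // x Wx cx hx; apply: E => //; exact: WV.
- move=> W f H p Wp; have [U [oU Up rf]] := H p Wp.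
  have [c [h [Cc cp Gh hp HU]]] := fraction_base oU Up.
  have [c' [g' [h' [[Cc' c'p sc h'p] [Gg' Gh' hh' E]]]]] :=
    regular_restrict rf (conj Wp Up) Cc cp Gh hp.
  exists c', g', h'; split=> //; split=> // x Wx c'x h'x.
  by apply: E => //; split=> //; apply: HU; [exact: sc|exact: hh'].
- move=> W a p Wp; have [c Cc cp] := charts_cover p.
  exists c, (fun=> a), (fun=> 1); split; split=> //; rewrite ?oner_neq0//.
  + exact: subalgebra_cst.
  + exact: subalgebra_cst.
  + by move=> x _ _ _; rewrite divr1.
- move=> W f f' rf rf' p Wp.
  have [c [g [h [[Cc cp hp] [Gg Gh E]]]]] := rf p Wp.
  have [c' [g' [h' [[Cc' c'p h'p] [Gg' Gh' E']]]]] := rf' p Wp.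
  have [c'' [Cc'' Ec /S1 s1 /S1 s2]] := charts_refine Cc Cc'.
  exists c'', (fun x => g x * h' x + g' x * h x), (fun x => h x * h' x).
  split; split=> //; first by rewrite Ec.
  + by rewrite mulf_neq0.
  + by apply: subalgebra_add; apply: subalgebra_mul; auto.
  + by apply: subalgebra_mul; auto.
  + move=> x Wx; rewrite Ec mulf_eq0 negb_or => -[cx c'x] /andP[hx h'x].
    by rewrite E// E'//; field; rewrite hx h'x.
- move=> W f f' rf rf' p Wp.
  have [c [g [h [[Cc cp hp] [Gg Gh E]]]]] := rf p Wp.
  have [c' [g' [h' [[Cc' c'p h'p] [Gg' Gh' E']]]]] := rf' p Wp.
  have [c'' [Cc'' Ec /S1 s1 /S1 s2]] := charts_refine Cc Cc'.
  exists c'', (fun x => g x * g' x), (fun x => h x * h' x).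
  split; split=> //; first by rewrite Ec.
  + by rewrite mulf_neq0.
  + by apply: subalgebra_mul; auto.
  + by apply: subalgebra_mul; auto.
  + move=> x Wx; rewrite Ec mulf_eq0 negb_or => -[cx c'x] /andP[hx h'x].
    by rewrite E// E'//; field; rewrite hx h'x.
- exact: opn.
- move=> W f oW rf p [Wp fp].
  have [c [g [h [[Cc cp hp] [Gg Gh E]]]]] := rf p Wp.
  have gp : g p != 0.
    by move: fp; rewrite /= E// mulf_eq0 negb_or => /andP[].
  (* The inverse of g / h is written h^2 / (g h) and not h / g: a nonzero denominator must imply h x
     != 0, where f = g / h is known. *)
  exists c, (fun x => h x * h x), (fun x => g x * h x); split; split=> //.
  + by rewrite mulf_neq0.
  + exact: subalgebra_mul.
  + exact: subalgebra_mul.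
  + move=> x [Wx fx] cx; rewrite mulf_eq0 negb_or => /andP[gx hx].
    by rewrite E//; field; rewrite hx gx.
Qed.

End FractionSpace.

Lemma sheaf_affine (T : choiceType) (G : set (T -> k)) : sheaf (affine_model G).
Proof.
apply: sheaf_fraction => [p|c c' -> ->]; exists (setT, G) => //.
by rewrite setIT.
Qed.

(** * Products *)

Section Product.
Variables X Y : kspace k.

Definition product_chart (U : set X) (V : set Y) : set (X * Y) * set (X * Y -> k) :=
  (U `*` V, [set f | exists2 g, regular U g & f = g \o fst] `|`
            [set f | exists2 g, regular V g & f = g \o snd]).

Definition product_charts : set (set (X * Y) * set (X * Y -> k)) :=
  [set c | exists (U : set X) (V : set Y), [/\ open U, open V & c = product_chart U V]].

Lemma product_charts_cover p : exists2 c, product_charts c & c.1 p.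
Proof.
exists (product_chart setT setT) => //.
by exists setT, setT; split=> //; exact: openT.
Qed.

Lemma product_charts_refine (sX : sheaf X) (sY : sheaf Y) c c' :
  product_charts c -> product_charts c' ->
  exists c'', [/\ product_charts c'', c''.1 = c.1 `&` c'.1,
    (forall g, c.2 g -> c''.2 g) & (forall g, c'.2 g -> c''.2 g)].
Proof.
move=> [U [V [oU oV ->]]] [U' [V' [oU' oV' ->]]].
exists (product_chart (U `&` U') (V `&` V')); split=> /=.
- by exists (U `&` U'), (V `&` V'); split=> //; exact: openI.
- by rewrite setXI.
- move=> g [|] [h rh ->]; [left|right]; exists h => //.
    by apply: (sheaf_sub sX _ rh); exact: subIsetl.
  by apply: (sheaf_sub sY _ rh); exact: subIsetl.
- move=> g [|] [h rh ->]; [left|right]; exists h => //.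
    by apply: (sheaf_sub sX _ rh); exact: subIsetr.
  by apply: (sheaf_sub sY _ rh); exact: subIsetr.
Qed.

Lemma sheaf_product : sheaf X -> sheaf Y -> sheaf (product X Y).
Proof.
move=> sX sY; apply: (sheaf_fraction product_charts_cover).
exact: product_charts_refine.
Qed.

Lemma regular_product_chart (U : set X) (V : set Y) f : open U -> open V ->
  (product_chart U V).2 f -> @regular k (product X Y) (U `*` V) f.
Proof.
move=> oU oV cf p UVp; exists (product_chart U V), f, (fun=> 1); split; split=> //.
- by exists U, V.
- exact: oner_neq0.
- exact: subalgebra_gen.
- exact: subalgebra_cst.
- by move=> x _ _ _; rewrite divr1.
Qed.

Lemma regular_fst (U : set X) g : open U -> regular U g ->
  @regular k (product X Y) (U `*` setT) (g \o fst).
Proof.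
by move=> oU rg; apply: regular_product_chart => //; [exact: openT|left; exists g].
Qed.

Lemma regular_snd (V : set Y) g : open V -> regular V g ->
  @regular k (product X Y) (setT `*` V) (g \o snd).
Proof.
by move=> oV rg; apply: regular_product_chart => //; [exact: openT|right; exists g].
Qed.

Lemma open_setX (U : set X) (V : set Y) : open U -> open V ->
  open (U `*` V : set (product X Y)).
Proof.
move=> oU oV; have Cc : product_charts (product_chart U V) by exists U, V.
have := fraction_basic_open Cc (subalgebra_cst _ 1).
rewrite /= (_ : [set x : X * Y | (1 : k) != 0] = setT) ?setIT//.
by apply/seteqP; split=> x //= _; exact: oner_neq0.
Qed.

Lemma morphism_fst : morphism (fst : product X Y -> X).
Proof.
have E (U : set X) : (fst : product X Y -> X) @^-1` U = U `*` setT.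
  by apply/seteqP; split=> x //= [].
split; first by apply/continuousP => U oU; rewrite E; exact: open_setX openT.
by move=> U g oU rg; rewrite E; exact: regular_fst.
Qed.

Lemma morphism_snd : morphism (snd : product X Y -> Y).
Proof.
have E (U : set Y) : (snd : product X Y -> Y) @^-1` U = setT `*` U.
  by apply/seteqP; split=> x //= [].
split; first by apply/continuousP => U oU; rewrite E; exact: open_setX openT oU.
by move=> U g oU rg; rewrite E; exact: regular_snd.
Qed.

End Product.

(** * Subvarieties, disjoint unions and quotients *)

Lemma open_subvariety X (S : set X) (U : set (subvariety S)) :
  open U <-> exists2 V : set X, open V & U = val @^-1` V.
Proof. by split=> -[V oV]; exists V. Qed.

Lemma sheaf_subvariety X (S : set X) : sheaf X -> sheaf (subvariety S).
Proof.
move=> sX; split.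
- move=> W f g fg rf p Wp; have [U [h [oU rh Up E]]] := rf p Wp.
  by exists U, h; split=> // x Wx Ux; rewrite -fg//; exact: E.
- move=> V W f WV rf p Wp; have [U [h [oU rh Up E]]] := rf p (WV _ Wp).
  by exists U, h; split=> // x Wx Ux; apply: E => //; exact: WV.
- move=> W f H p Wp; have [U [/open_subvariety[U' oU' ->] Up rf]] := H p Wp.
  have [V [h [oV rh Vp E]]] := rf p (conj Wp Up).
  exists (V `&` U'), h; split=> //; first exact: openI.
  - by apply: (sheaf_sub sX _ rh); exact: subIsetl.
  - by move=> x Wx [Vx U'x]; exact: E.
- move=> W a p Wp; exists setT, (fun=> a); split=> //; first exact: openT.
  exact: sheaf_cst.
- move=> W f f' rf rf' p Wp.
  have [U [h [oU rh Up E]]] := rf p Wp.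
  have [U' [h' [oU' rh' U'p E']]] := rf' p Wp.
  exists (U `&` U'), (fun x => h x + h' x); split=> //; first exact: openI.
    apply: sheaf_add => //; [apply: (sheaf_sub sX _ rh)|apply: (sheaf_sub sX _ rh')].
      exact: subIsetl.
    exact: subIsetr.
  by move=> x Wx [Ux U'x]; rewrite E// E'.
- move=> W f f' rf rf' p Wp.
  have [U [h [oU rh Up E]]] := rf p Wp.
  have [U' [h' [oU' rh' U'p E']]] := rf' p Wp.
  exists (U `&` U'), (fun x => h x * h' x); split=> //; first exact: openI.
    apply: sheaf_mul => //; [apply: (sheaf_sub sX _ rh)|apply: (sheaf_sub sX _ rh')].
      exact: subIsetl.
    exact: subIsetr.
  by move=> x Wx [Ux U'x]; rewrite E// E'.
- move=> W f oW rf; apply: open_locally => p [Wp fp].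
  have [U [h [oU rh Up E]]] := rf p Wp.
  exists (W `&` val @^-1` (U `&` [set x | h x != 0])); split=> //.
  + apply: openI => //; apply/open_subvariety.
    by exists (U `&` [set x | h x != 0]) => //; exact: sheaf_open.
  + by do 2!split=> //=; rewrite -E.
  + by move=> x [Wx [Ux hx]]; split=> //=; rewrite E.
- move=> W f oW rf p [Wp fp].
  have [U [h [oU rh Up E]]] := rf p Wp.
  exists (U `&` [set x | h x != 0]), (fun x => (h x)^-1); split=> //.
  + exact: sheaf_open.
  + exact: sheaf_inv.
  + by split=> //=; rewrite -E.
  + by move=> x [Wx fx] [Ux hx]; rewrite E.
Qed.

Lemma sheaf_disjoint_union (I : choiceType) (X : I -> kspace k) :
  (forall i, sheaf (X i)) -> sheaf (disjoint_union X).
Proof.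
move=> sX; split.
- by move=> W f g fg rf i; apply: (sheaf_eq (sX i) _ (rf i)) => x Wx; exact: fg.
- by move=> V W f WV rf i; apply: (sheaf_sub (sX i) _ (rf i)) => x Wx; exact: WV.
- move=> W f H i; apply: (sheaf_loc (sX i)) => p Wp.
  have [U [/sigT_openP oU Up rf]] := H _ Wp.
  by exists (existT (fun i => X i) i @^-1` U); split=> //; exact: oU.
- by move=> W c i; exact: sheaf_cst.
- by move=> W f g rf rg i; exact: (sheaf_add (sX i)).
- by move=> W f g rf rg i; exact: (sheaf_mul (sX i)).
- move=> W f /sigT_openP oW rf; apply/sigT_openP => i.
  exact: (sheaf_open (sX i) (oW i) (rf i)).
- move=> W f /sigT_openP oW rf i.
  exact: (sheaf_inv (sX i) (oW i) (rf i)).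
Qed.

Lemma sheaf_quotient X (r : X -> X -> Prop) : sheaf X -> sheaf (quotient r).
Proof.
move=> sX; split.
- by move=> W f g fg rf; apply: (sheaf_eq sX _ rf) => x Wx; exact: fg.
- by move=> V W f WV rf; apply: (sheaf_sub sX _ rf) => x Wx; exact: WV.
- move=> W f H; apply: (sheaf_loc sX) => p Wp.
  have [U [oU Up rf]] := H _ Wp.
  by exists (quotient_map r @^-1` U); split.
- by move=> W c; exact: (sheaf_cst sX).
- by move=> W f g rf rg; exact: (sheaf_add sX).
- by move=> W f g rf rg; exact: (sheaf_mul sX).
- by move=> W f oW rf; exact: (sheaf_open sX oW rf).
- by move=> W f oW rf; exact: (sheaf_inv sX oW rf).
Qed.

Lemma morphism_quotient_map X (r : X -> X -> Prop) : morphism (quotient_map r).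
Proof. by split; [apply/continuousP|]. Qed.

Lemma morphism_from_quotient X Y (r : X -> X -> Prop) (f : quotient r -> Y) :
  morphism (f \o quotient_map r) -> morphism f.
Proof.
move=> [/continuousP cf rf]; split; last by move=> U g oU rg; exact: rf.
by apply/continuousP => U oU; exact: (cf U oU).
Qed.

Lemma quotient_mapP X (r : X -> X -> Prop) (y : quotient r) :
  exists x, quotient_map r x = y.
Proof. by exists (repr y); exact: reprK. Qed.

Lemma quotient_map_eq X (r : X -> X -> Prop) x y :
  quotient_map r x = quotient_map r y <-> clos_refl_sym_trans X r x y.
Proof.
rewrite /quotient_map; split=> [|H].
  by move/eqquotP => /asboolP.
by apply/eqquotP; apply/asboolP.
Qed.

Lemma morphism_inclusion X (S : set X) : morphism (val : subvariety S -> X).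
Proof.
split; first exact: initial_continuous.
by move=> U g oU rg p Up; exists U, g; split.
Qed.

Lemma morphism_on_corestrict X Y (S : set Y) (D : set X) (f : X -> subvariety S) :
  sheaf X -> sheaf Y ->
  morphism_on D (val \o f : X -> Y) -> morphism_on D f.
Proof.
move=> sX sY [cf rf]; split.
  by move=> U /open_subvariety[V oV ->]; exact: (cf V oV).
move=> U g oU rg; apply: (sheaf_loc sX) => x [Ox Ufx].
have [V [h [oV rh Vp E]]] := rg _ Ufx.
exists (D `&` (val \o f) @^-1` V); split=> //; first exact: cf.
apply: (sheaf_eq sX _ (sheaf_sub sX _ (rf V h oV rh))).
  by move=> y [[Oy Uy] [_ Vy]] /=; rewrite E.
by move=> y [].
Qed.

Lemma morphism_corestrict X Y (S : set Y) (f : X -> subvariety S) :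
  sheaf X -> sheaf Y -> morphism (val \o f : X -> Y) -> morphism f.
Proof.
by move=> sX sY /morphismT mf; apply/morphismT; exact: morphism_on_corestrict.
Qed.

(** * Affine models and global fractions *)

Lemma affine_base (T : choiceType) (G : set (T -> k)) (W : set (affine_model G)) p :
  open W -> W p ->
  exists h, [/\ subalgebra G h, h p != 0 & forall x, h x != 0 -> W x].
Proof.
move=> oW Wp.
have [||c [h [-> _ Gh hp H]]] := @fraction_base T [set (setT, G)] _ _ W p oW Wp.
- by move=> ?; exists (setT, G).
- by move=> c c' -> ->; exists (setT, G); rewrite setIT.
by exists h; split=> // x; exact: H.
Qed.

Lemma affine_basic_open (T : choiceType) (G : set (T -> k)) h : subalgebra G h ->
  open ([set x | h x != 0] : set (affine_model G)).
Proof.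
move=> Gh.
have := @fraction_basic_open T [set (setT, G)] (setT, G) h erefl Gh.
by rewrite setTI.
Qed.

(** Multiplying numerator and denominator by the denominator makes the equation hold on all of [W]:
    where the denominator vanishes it reads 0 = 0. *)
Lemma affine_regular (T : choiceType) (G : set (T -> k)) (W : set (affine_model G))
    f p : regular W f -> W p ->
  exists g h, [/\ subalgebra G g, subalgebra G h, h p != 0 &
    forall x, W x -> f x * h x = g x].
Proof.
move=> rf Wp; have [c [g [h [[-> _ hp] [Gg Gh E]]]]] := rf p Wp.
exists (fun x => g x * h x), (fun x => h x * h x); split.
- exact: subalgebra_mul.
- exact: subalgebra_mul.
- by rewrite mulf_neq0.
move=> x Wx; have [->|hx] := eqVneq (h x) 0; first by rewrite !mulr0.
by rewrite E//; field.
Qed.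

Lemma regular_affine (T : choiceType) (G : set (T -> k)) (W : set (affine_model G)) h :
  subalgebra G h -> regular W h.
Proof.
move=> Gh p Wp; exists (setT, G), h, (fun=> 1); split; split=> //.
- exact: oner_neq0.
- exact: subalgebra_cst.
- by move=> x _ _ _; rewrite divr1.
Qed.

(** Generators suffice because the regular functions on [D] form an algebra and are invertible off
    their zeros; this covers both the basic open sets and the fractions of the model. *)
Lemma morphism_on_affine X (sX : sheaf X) (D : set X) (T : choiceType)
    (G : set (T -> k)) (phi : X -> affine_model G) : open D ->
  (forall g, G g -> regular D (g \o phi)) -> morphism_on D phi.
Proof.
move=> oO rG.
have rG' h : subalgebra G h -> regular D (h \o phi).
  by move=> Gh; exact: (regular_subalgebra sX (phi := phi : X -> T) rG Gh).
split=> [U oU|U f oU rf].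
  apply: open_locally => x [Ox Ux].
  have [h [Gh hp HU]] := affine_base oU Ux.
  exists (D `&` [set x | h (phi x) != 0]); split=> //.
    exact: (sheaf_open sX oO (rG' _ Gh)).
  by move=> y [Oy hy]; split=> //; exact: HU.
apply: (sheaf_loc sX) => x [Ox Ux].
have [g [h [Gg Gh hp E]]] := affine_regular rf Ux.
exists (D `&` [set x | h (phi x) != 0]); split=> //.
  exact: (sheaf_open sX oO (rG' _ Gh)).
have Rg := sheaf_sub sX (@subIsetl _ D [set x | h (phi x) != 0]) (rG' _ Gg).
have Rh := sheaf_inv sX oO (rG' _ Gh).
have R := sheaf_mul sX Rg Rh.
apply: (sheaf_eq sX _ (sheaf_sub sX _ R)); last by move=> y [_].
move=> y [[Oy Uy] [_ hy]] /=; rewrite -E//; field.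
by [].
Qed.

(** The part of affineness that survives on the product of [B] with the line, which need not be
    affine. The equation is required on all of [W], not only near [p], because it will be evaluated
    along whole orbits. *)
Record quasi_affine X (G : set (X -> k)) : Prop := QuasiAffine {
  quasi_affine_base : forall (W : set X) p, open W -> W p ->
    exists h, [/\ subalgebra G h, h p != 0 & forall x, h x != 0 -> W x];
  quasi_affine_regular : forall (W : set X) f p, open W -> regular W f -> W p ->
    exists g h, [/\ subalgebra G g, subalgebra G h, h p != 0 &
      forall x, W x -> f x * h x = g x] }.

Lemma quasi_affine_model (T : choiceType) (G : set (T -> k)) :
  @quasi_affine (affine_model G) G.
Proof.
split=> [W p|W f p oW]; [exact: affine_base|exact: affine_regular].
Qed.

Lemma subalgebra_comp (S T : Type) (phi : S -> T) (G : set (T -> k)) (G' : set (S -> k)) :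
  (forall g, G g -> G' (g \o phi)) ->
  forall h, subalgebra G h -> subalgebra G' (h \o phi).
Proof.
move=> GG' h; elim=> [g /GG'/subalgebra_gen//|c|f g _ rf _ rg|f g _ rf _ rg].
- exact: subalgebra_cst.
- exact: subalgebra_add.
- exact: subalgebra_mul.
Qed.

Lemma quasi_affine_subvariety X (S : set X) (G : set (X -> k)) : quasi_affine G ->
  @quasi_affine (subvariety S) [set f | exists2 g, G g & f = g \o val].
Proof.
move=> [bX rX].
have al h : subalgebra G h -> subalgebra
    [set f : subvariety S -> k | exists2 g, G g & f = g \o val] (h \o val).
  by apply: subalgebra_comp => g Gg; exists g.
split.
  move=> W p /open_subvariety[V oV ->] Vp.
  have [h [Gh hp HV]] := bX V _ oV Vp.
  by exists (h \o val); split=> // [|x hx]; [exact: al|exact: HV].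
move=> W f p oW rf Wp; have [U [r [oU rr Up E]]] := rf p Wp.
have [g [h [Gg Gh hp E']]] := rX U r _ oU rr Up.
(* A cutoff: [l] vanishes outside [U], so multiplying both sides by it extends the equation from [U]
   to all of [W]. *)
have [l [Gl lp HU]] := bX U _ oU Up.
exists ((fun x => g x * l x) \o val), ((fun x => h x * l x) \o val); split.
- by apply: al; exact: subalgebra_mul.
- by apply: al; exact: subalgebra_mul.
- by rewrite /= mulf_neq0.
move=> x Wx /=; have [->|lx] := eqVneq (l (val x)) 0; first by rewrite !mulr0.
by have Ux := HU _ lx; rewrite E// mulrA E'.
Qed.

Lemma quasi_affine_product X Y (G : set (X -> k)) (G' : set (Y -> k)) :
  sheaf X -> sheaf Y ->
  quasi_affine G -> quasi_affine G' ->
  @quasi_affine (product X Y) ([set f | exists2 g, G g & f = g \o fst] `|`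
     [set f | exists2 g, G' g & f = g \o snd]).
Proof.
move=> sX sY [bX rX] [bY rY].
set GG := (X in quasi_affine X).
have al h : subalgebra G h -> subalgebra GG (h \o fst).
  by apply: subalgebra_comp => g Gg; left; exists g.
have al' h : subalgebra G' h -> subalgebra GG (h \o snd).
  by apply: subalgebra_comp => g Gg; right; exists g.
have bas (U : set X) (V : set Y) p : open U -> open V -> (U `*` V) p ->
  exists h, [/\ subalgebra GG h, h p != 0 & forall x, h x != 0 -> (U `*` V) x].
  move=> oU oV [Up Vp].
  have [h [Gh hp HU]] := bX U _ oU Up; have [h' [Gh' h'p HV]] := bY V _ oV Vp.
  exists (fun x => (h \o fst) x * (h' \o snd) x); split.
  - by apply: subalgebra_mul; auto.
  - by rewrite mulf_neq0.
  - by move=> x; rewrite mulf_eq0 negb_or => /andP[/HU Ux /HV Vx].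
(* A function of a product chart is a polynomial in regular functions of the two factors. Each of
   these is a global fraction, and induction puts sums and products over a common denominator. *)
have frac (U : set X) (V : set Y) p h : open U -> open V -> (U `*` V) p ->
    subalgebra (product_chart U V).2 h ->
    exists a b, [/\ subalgebra GG a, subalgebra GG b, b p != 0 &
      forall x, (U `*` V) x -> h x * b x = a x].
  move=> oU oV [Up Vp]; elim.
  - move=> f [|] [g rg ->].
      have [a [b [Ga Gb bp E]]] := rX U g _ oU rg Up.
      exists (a \o fst), (b \o fst); split; auto.
      by move=> x [Ux Vx] /=; rewrite E.
    have [a [b [Ga Gb bp E]]] := rY V g _ oV rg Vp.
    exists (a \o snd), (b \o snd); split; auto.
    by move=> x [Ux Vx] /=; rewrite E.
  - move=> c; exists (fun=> c), (fun=> 1); split.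
    + exact: subalgebra_cst.
    + exact: subalgebra_cst.
    + exact: oner_neq0.
    + by move=> x _; rewrite mulr1.
  - move=> f g _ [a [b [Ga Gb bp E]]] _ [a' [b' [Ga' Gb' b'p E']]].
    exists (fun x => a x * b' x + a' x * b x), (fun x => b x * b' x); split.
    + by apply: subalgebra_add; apply: subalgebra_mul.
    + exact: subalgebra_mul.
    + by rewrite mulf_neq0.
    + by move=> x Ux; rewrite -E// -E'//; ring.
  - move=> f g _ [a [b [Ga Gb bp E]]] _ [a' [b' [Ga' Gb' b'p E']]].
    exists (fun x => a x * a' x), (fun x => b x * b' x); split.
    + exact: subalgebra_mul.
    + exact: subalgebra_mul.
    + by rewrite mulf_neq0.
    + by move=> x Ux; rewrite -E// -E'//; ring.
split.
  move=> W p oW Wp.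
  have [c [h [[U [V [oU oV ->]]] /= Up Gh hp HW]]] := fraction_base
    (@product_charts_cover X Y) (product_charts_refine sX sY) oW Wp.
  have [a [b [Ga Gb bp E]]] := frac U V p h oU oV Up Gh.
  have [l [Gl lp Hl]] := bas U V p oU oV Up.
  exists (fun x => a x * l x); split.
  - exact: subalgebra_mul.
  - by rewrite mulf_neq0// -E// mulf_neq0.
  - move=> x; rewrite mulf_eq0 negb_or => /andP[ax lx].
    have Ux := Hl _ lx; apply: HW => //.
    by move: ax; rewrite -E// mulf_eq0 negb_or => /andP[].
move=> W f p oW rf Wp.
have [c [g [h [[[U [V [oU oV ->]]] /= Up hp] [/= Gg Gh E]]]]] := rf p Wp.
have [a [b [Ga Gb bp Eg]]] := frac U V p g oU oV Up Gg.
have [a' [b' [Ga' Gb' b'p Eh]]] := frac U V p h oU oV Up Gh.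
have [l [Gl lp Hl]] := bas U V p oU oV Up.
(* From f = g / h, g b = a and h b' = a' one gets f a' b = a b'. The extra factor a' makes both
   sides vanish where h does, and l makes them vanish off the chart. *)
exists (fun x => (a x * a' x) * (b' x * l x)), (fun x => (a' x * a' x) * (b x * l x)).
split.
- by do !apply: subalgebra_mul.
- by do !apply: subalgebra_mul.
- by rewrite !mulf_neq0// -Eh// mulf_neq0.
move=> x Wx; have [->|lx] := eqVneq (l x) 0; first by rewrite !mulr0.
have Ux := Hl _ lx; rewrite -Eg// -Eh//.
have [->|hx] := eqVneq (h x) 0; first by rewrite !(mul0r, mulr0).
by rewrite E//; field.
Qed.

End SpacesOfFunctions.

(** * Rays and cones *)

Section Rays.
Variables (n : nat) (v : 'rV[int]_n.+1).

(* The rays of the fan: e_j is [inl j], v is [inr true], -v is [inr false]. *)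
Definition ray : Type := ('I_n.+1 + bool)%type.
HB.instance Definition _ := Finite.on ray.

Definition ray_vec (r : ray) : 'rV[int]_n.+1 :=
  match r with
  | inl j => std_basis j
  | inr true => v
  | inr false => - v
  end.

Definition ev (m : 'rV[int]_n.+1) (r : ray) : int := int_pairing m (ray_vec r).

(** Makes [v] and [-v] a single case: the ray [inr b] is [sg b] times [v]. *)
Definition sg (b : bool) : int := if b then 1 else -1.

Lemma int_pairingD m m' (w : 'rV[int]_n.+1) :
  int_pairing (m + m') w = int_pairing m w + int_pairing m' w.
Proof.
by rewrite /int_pairing -big_split; apply: eq_bigr => j _; rewrite mxE mulrDl.
Qed.

Lemma int_pairingZ c m (w : 'rV[int]_n.+1) :
  int_pairing (c *: m) w = c * int_pairing m w.
Proof.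
by rewrite /int_pairing big_distrr; apply: eq_bigr => j _ /=; rewrite mxE mulrA.
Qed.

Lemma int_pairingNr m (w : 'rV[int]_n.+1) :
  int_pairing m (- w) = - int_pairing m w.
Proof.
by rewrite /int_pairing -sumrN; apply: eq_bigr => j _; rewrite mxE mulrN.
Qed.

Lemma evD m m' r : ev (m + m') r = ev m r + ev m' r.
Proof. exact: int_pairingD. Qed.

Lemma evZ c m r : ev (c *: m) r = c * ev m r.
Proof. exact: int_pairingZ. Qed.

Lemma evN m r : ev (- m) r = - ev m r.
Proof. by rewrite -scaleN1r evZ mulN1r. Qed.

Lemma evB m m' r : ev (m - m') r = ev m r - ev m' r.
Proof. by rewrite evD evN. Qed.

Lemma ev0 r : ev 0 r = 0.
Proof. by rewrite -(scale0r 0) evZ mul0r. Qed.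

Lemma evMn m k r : ev (m *+ k) r = ev m r *+ k.
Proof. by elim: k => [|k IH]; rewrite ?mulr0n ?ev0// !mulrS evD IH. Qed.

Lemma ev_inl m j : ev m (inl j) = m 0 j.
Proof.
rewrite /ev /int_pairing (bigD1 j)//= big1 ?addr0.
  by rewrite mxE !eqxx mulr1.
by move=> i ij; rewrite mxE eqxx (negbTE ij) mulr0.
Qed.

Lemma int_pairing_basis j (w : 'rV[int]_n.+1) : int_pairing (std_basis j) w = w 0 j.
Proof.
rewrite /int_pairing (bigD1 j)//= big1 ?addr0; first by rewrite mxE !eqxx mul1r.
by move=> i ij; rewrite mxE eqxx (negbTE ij) mul0r.
Qed.

Lemma ev_inr m b : ev m (inr b) = sg b * int_pairing m v.
Proof. by case: b; rewrite /ev /sg ?mul1r// int_pairingNr mulN1r. Qed.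

Lemma ev_negb m b : ev m (inr (~~ b)) = - ev m (inr b).
Proof. by rewrite !ev_inr; case: b; rewrite /sg ?mulN1r ?mul1r ?opprK. Qed.

(* The index sets of the cones of the fan: a cone containing v must miss some
   e_i with v_i < 0, a cone containing -v must miss some e_i with v_i > 0. *)
Definition allowed (A : {set ray}) : Prop := forall b, inr b \in A ->
  inr (~~ b) \notin A /\ exists i, inl i \notin A /\ sg b * v 0 i < 0.

Lemma allowed_sub (A B : {set ray}) : B \subset A -> allowed A -> allowed B.
Proof.
move=> /fintype.subsetP BA aA b bB; have [nb [i [iA vi]]] := aA b (BA _ bB).
by split; [apply: contra nb; exact: BA|exists i; split=> //; apply: contra iA; exact: BA].
Qed.

Lemma allowed_inl (A : {set ray}) : (forall b, inr b \notin A) -> allowed A.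
Proof. by move=> H b; rewrite (negbTE (H b)). Qed.

Definition separates (A B : {set ray}) (u : 'rV[int]_n.+1) r : Prop :=
  [/\ r \in A -> r \notin B -> 0 < ev u r,
      r \notin A -> r \in B -> ev u r < 0
    & r \in A -> r \in B -> ev u r = 0].

Lemma separatesN A B u r : separates A B u r -> separates B A (- u) r.
Proof.
case=> H1 H2 H3; split=> h1 h2; rewrite evN.
- by rewrite oppr_gt0 H2.
- by rewrite oppr_lt0 H1.
- by rewrite H3// oppr0.
Qed.

Lemma separatesD A B u u' r (c c' : int) : 0 < c -> 0 < c' ->
  separates A B u r -> separates A B u' r -> separates A B (c *: u + c' *: u') r.
Proof.
move=> c0 c'0 [H1 H2 H3] [H1' H2' H3']; split=> h1 h2; rewrite evD !evZ.
- by rewrite addr_gt0// mulr_gt0//; auto.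
- have := H2 h1 h2; have := H2' h1 h2; nia.
- by rewrite H3// H3'// !mulr0 addr0.
Qed.

Lemma separate_basis A B :
  exists u, forall j, separates A B u (inl j).
Proof.
exists (\row_j (((inl j \in A) && (inl j \notin B))%:Z
              - ((inl j \in B) && (inl j \notin A))%:Z)) => j.
by split; rewrite ev_inl mxE; case: (inl j \in A); case: (inl j \in B).
Qed.

(** As e_i is not a ray of [A], lowering the i-th entry of a character can only help the separation
    of the basis rays, while it increases the value on [inr b] since [sg b * v 0 i] is negative. *)
Lemma separate_push (A B : {set ray}) b i : inl i \notin A -> sg b * v 0 i < 0 ->
  exists u, (forall j, separates A B u (inl j)) /\ 0 < ev u (inr b).
Proof.
move=> iA vi; have [u0 H0] := separate_basis A B.
(* Enough because [- (sg b * v 0 i)] is at least 1. *)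
pose L : int := `|ev u0 (inr b)| + 1.
have L0 : 0 < L by rewrite /L; lia.
exists (u0 - L *: std_basis i); split.
  move=> j; have [H1 H2 H3] := H0 j.
  have E : ev (u0 - L *: std_basis i) (inl j) = ev u0 (inl j) - L * (i == j)%:Z.
    rewrite evB evZ; congr (_ - _ * _); rewrite ev_inl mxE eqxx eq_sym.
    by case: (i == j).
  have [ij|ij] := eqVneq i j.
    subst j; rewrite eqxx in E; split=> h1 h2; [|have := H2 h1 h2|].
    + by rewrite h1 in iA.
    + by rewrite E; lia.
    + by rewrite h1 in iA.
  by split=> h1 h2; rewrite E (negbTE ij) mulr0 subr0; auto.
rewrite evB evZ (ev_inr (std_basis i)) int_pairing_basis /L; move: (ev u0 (inr b)) vi; nia.
Qed.

(** If one set contains a ray [inr b] that the other lacks, pushing along it suffices: the opposite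
    ray then has the opposite value, and it is not in the first set. Otherwise both contain the same
    rays among [v] and [-v], and a common one must be given the value 0. *)
Lemma separation A B : allowed A -> allowed B ->
  exists u, forall r, separates A B u r.
Proof.
move=> aA aB.
have push (A' B' : {set ray}) b : allowed A' -> inr b \in A' -> inr b \notin B' ->
    exists u, forall r, separates A' B' u r.
  move=> aA' bA bB; have [nb [i [iA vi]]] := aA' b bA.
  have [u [Hu u0]] := separate_push B' iA vi.
  exists u => -[j|c]; first exact: Hu.
  have [->|] := eqVneq c b; first by split=> //; rewrite ?bA ?(negbTE bB).
  move=> cb; have -> : c = ~~ b by move: cb; case: (b); case: (c).
  by split; rewrite ?(negbTE nb)// => _ _; rewrite ev_negb oppr_lt0.
have [[b /andP[bA bB]]|nAB] := pselect (exists b, (inr b \in A) && (inr b \notin B)).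
  exact: push bA bB.
have [[b /andP[bB bA]]|nBA] := pselect (exists b, (inr b \in B) && (inr b \notin A)).
  by have [u Hu] := push B A b aB bB bA; exists (- u) => r; exact: separatesN.
have AB b : (inr b \in A) = (inr b \in B).
  apply/idP/idP => h; apply/negPn/negP => h'.
    by apply: nAB; exists b; rewrite h.
  by apply: nBA; exists b; rewrite h.
have [[b bA]|nA] := pselect (exists b, inr b \in A); last first.
  have [u Hu] := separate_basis A B; exists u => -[//|b].
  have bA : inr b \notin A by apply/negP => h; apply: nA; exists b.
  by split; rewrite -?AB ?(negbTE bA).
have [nb [i [iA vi]]] := aA b bA.
have [_ [i' [iB vi']]] := aB b (etrans (esym (AB b)) bA).
have [u [Hu u0]] := separate_push B iA vi.
have [u' [Hu' u'0]] := separate_push A iB vi'.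
(* [u] separates [A] from [B], [u'] separates [B] from [A], and both are positive on [inr b]. This
   positive combination of [u] and [- u'] still separates the basis rays and cancels on [inr b]. *)
exists (ev u' (inr b) *: u + ev u (inr b) *: (- u')) => -[j|c].
  by apply: separatesD => //; exact: separatesN.
have E : ev (ev u' (inr b) *: u + ev u (inr b) *: - u') (inr b) = 0.
  by rewrite evD !evZ evN; ring.
have [->|] := eqVneq c b; first by split; rewrite -?AB ?bA.
move=> cb; have -> : c = ~~ b by move: cb; case: (b); case: (c).
by split; rewrite -?AB ?(negbTE nb).
Qed.

Section Cones.
Variable R : realType.

Definition cone_of (A : {set ray}) : set 'rV[R]_n.+1 :=
  [set x | exists2 c : ray -> R, (forall r, 0 <= c r) &
     x = \sum_(r in A) c r *: lat R (ray_vec r)].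

Lemma pairing_sum (I : Type) (s : seq I) (P : pred I) u (c : I -> R)
    (x : I -> 'rV[R]_n.+1) :
  pairing u (\sum_(i <- s | P i) c i *: x i) = \sum_(i <- s | P i) c i * pairing u (x i) :> R.
Proof.
elim/big_rec2: _ => [|i y1 y2 _ <-].
  by rewrite /pairing big1// => j _; rewrite mxE mulr0.
rewrite /pairing big_distrr -big_split; apply: eq_bigr => j _ /=.
by rewrite !mxE; ring.
Qed.

Lemma pairing_lat (m w : 'rV[int]_n.+1) : pairing (lat R m) (lat R w) = (int_pairing m w)%:~R.
Proof.
rewrite /pairing /int_pairing rmorph_sum; apply: eq_bigr => j _.
by rewrite !mxE -intrM.
Qed.

Lemma cone_of_ray (A : {set ray}) r : r \in A -> cone_of A (lat R (ray_vec r)).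
Proof.
move=> rA; exists (fun s => (s == r)%:R) => [s|]; first exact: ler0n.
rewrite (bigD1 r)//= eqxx scale1r big1 ?addr0// => s /andP[_ /negbTE->].
by rewrite scale0r.
Qed.

Lemma dual_cone_of A u : dual_cone (cone_of A) u <->
  forall r, r \in A -> 0 <= pairing u (lat R (ray_vec r)).
Proof.
split=> [H r rA|H x [c c0 ->]]; first by apply: H; exact: cone_of_ray.
by rewrite pairing_sum sumr_ge0// => r rA; rewrite mulr_ge0//; exact: H.
Qed.

Lemma semigroup_cone_of A m :
  semigroup (cone_of A) m <-> forall r, r \in A -> 0 <= ev m r.
Proof.
rewrite /semigroup /= dual_cone_of; split=> H r rA; have := H r rA;
by rewrite pairing_lat ler0z.
Qed.

Lemma cone_of_sub (A B : {set ray}) : B \subset A -> cone_of B `<=` cone_of A.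
Proof.
move=> /fintype.subsetP BA x [c c0 ->].
exists (fun r => if r \in B then c r else 0) => [r|]; first by case: ifP.
rewrite [RHS](bigID (mem B)) /= [X in _ = _ + X]big1 ?addr0; last first.
  by move=> r /andP[_ /negbTE->]; rewrite scale0r.
apply: eq_big => [r|r ->//]; apply/idP/idP => [rB|/andP[]//].
by rewrite rB BA.
Qed.

(** A sum of nonnegative terms vanishes only if every term does, so rays on which [u] is positive
    have coefficient 0. *)
Lemma cone_of_face A u : dual_cone (cone_of A) u ->
  cone_of A `&` [set x | pairing u x = 0] =
  cone_of [set r in A | pairing u (lat R (ray_vec r)) == 0].
Proof.
move=> /dual_cone_of H; apply/seteqP; split=> x.
  move=> [[c c0 ->]] /=; rewrite pairing_sum => /eqP.
  rewrite psumr_eq0 => [/allP H0|r rA]; last by rewrite mulr_ge0// H.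
  exists c => //; rewrite (bigID (mem [set r in A | pairing u (lat R (ray_vec r)) == 0])) /=.
  rewrite [X in _ + X]big1 ?addr0; last first.
    move=> r /andP[rA]; rewrite inE rA /= => ur.
    have := H0 r (mem_index_enum _); rewrite rA /= mulf_eq0 (negbTE ur) orbF.
    by move/eqP->; rewrite scale0r.
  by apply: eq_bigl => r; rewrite !inE andbA andbb.
move=> [c c0 ->]; split.
  apply: cone_of_sub; last by exists c.
  by apply/fintype.subsetP => r; rewrite inE => /andP[].
rewrite /= pairing_sum big1// => r; rewrite inE => /andP[_ /eqP->].
by rewrite mulr0.
Qed.

(** Separating [A] from its subset [B] gives a character that is positive on the rays of [A] outside
    [B] and zero on [B]: it supports the face spanned by [B]. *)
Lemma faces_cone_of A tau : allowed A ->
  is_face tau (cone_of A) <-> exists2 B : {set ray}, B \subset A & tau = cone_of B.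
Proof.
move=> aA; split=> [[u Hu ->]|[B BA ->]].
  exists [set r in A | pairing u (lat R (ray_vec r)) == 0]; last exact: cone_of_face.
  by apply/fintype.subsetP => r; rewrite inE => /andP[].
have [u Hu] := separation aA (allowed_sub BA aA).
have Hd : dual_cone (cone_of A) (lat R u).
  apply/dual_cone_of => r rA; rewrite pairing_lat ler0z.
  have [H1 _ H3] := Hu r; case rB: (r \in B); first by have := H3 rA rB; rewrite /ev => ->.
  by apply: ltW; apply: H1 => //; rewrite rB.
exists (lat R u) => //; rewrite cone_of_face//; congr cone_of.
apply/setP => r; rewrite inE pairing_lat intr_eq0.
have [H1 _ H3] := Hu r; case rB: (r \in B).
  have rA := fintype.subsetP BA r rB; rewrite rA; symmetry; apply/eqP; exact: H3.
case rA: (r \in A) => //=; symmetry; apply/negbTE; apply: lt0r_neq0; apply: H1 => //.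
by rewrite rB.
Qed.

(** A separating character is nonnegative on one cone and nonpositive on the other, hence zero on
    the intersection; and the rays of [A] on which it vanishes lie in [B]. *)
Lemma cone_ofI A B : allowed A -> allowed B ->
  cone_of A `&` cone_of B = cone_of (A :&: B).
Proof.
move=> aA aB; apply/seteqP; split; last first.
  move=> x xAB; split; move: xAB; apply: cone_of_sub.
    exact: finset.subsetIl.
  exact: finset.subsetIr.
have [u Hu] := separation aA aB.
move=> x [[c c0 E] [c' c'0 E']].
have le (m : 'rV[int]_n.+1) (C : {set ray}) (d : ray -> R) : (forall r, 0 <= d r) ->
    (forall r, r \in C -> 0 <= ev m r) ->
    0 <= pairing (lat R m) (\sum_(r in C) d r *: lat R (ray_vec r)).
  move=> d0 H; rewrite pairing_sum sumr_ge0// => r rC; rewrite mulr_ge0//.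
  by rewrite pairing_lat ler0z; exact: H.
have HA r : r \in A -> 0 <= ev u r.
  move=> rA; have [H1 _ H3] := Hu r; case rB: (r \in B); first by rewrite H3.
  by apply: ltW; apply: H1; rewrite ?rB.
have HB r : r \in B -> 0 <= ev (- u) r.
  move=> rB; have [_ H2 H3] := Hu r; rewrite evN oppr_ge0.
  case rA: (r \in A); first by rewrite H3.
  by apply: ltW; apply: H2; rewrite ?rA.
have uN y : pairing (lat R (- u)) y = - pairing (lat R u) y.
  rewrite /pairing -sumrN; apply: eq_bigr => j _.
  by rewrite !mxE intrN mulNr.
have ux : pairing (lat R u) x = 0.
  apply/eqP; rewrite eq_le -oppr_ge0 -uN; apply/andP; split.
    by rewrite E'; exact: le.
  by rewrite E; exact: le.
have : (cone_of A `&` [set x | pairing (lat R u) x = 0]) x.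
  by split=> //; exists c.
rewrite cone_of_face; last first.
  by apply/dual_cone_of => r rA; rewrite pairing_lat ler0z; exact: HA.
apply: cone_of_sub; apply/fintype.subsetP => r; rewrite !inE => /andP[rA].
rewrite pairing_lat intr_eq0 rA /= => /eqP ur.
have [H1 _ _] := Hu r; apply/negPn/negP => rB.
by have := H1 rA rB; rewrite /ev ur ltxx.
Qed.

(** Separation from the empty set provides a character positive on every ray of [A]. *)
Lemma cone_of_strict A x : allowed A -> cone_of A x -> cone_of A (- x) -> x = 0.
Proof.
move=> aA Ax Anx.
have a0 : allowed finset.set0 by move=> b; rewrite inE.
have [u Hu] := separation aA a0.
have Hd : dual_cone (cone_of A) (lat R u).
  apply/dual_cone_of => r rA; rewrite pairing_lat ler0z ltW//.
  by have [H1 _ _] := Hu r; apply: H1 => //; rewrite inE.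
have ux : pairing (lat R u) x = 0.
  apply/eqP; rewrite eq_le Hd// andbT -oppr_ge0.
  have -> : - pairing (lat R u) x = pairing (lat R u) (- x).
    by rewrite /pairing -sumrN; apply: eq_bigr => j _; rewrite [(- x) 0 j]mxE mulrN.
  exact: Hd.
have : (cone_of A `&` [set x | pairing (lat R u) x = 0]) x by split.
rewrite cone_of_face// => -[c _ ->]; rewrite big1// => r; rewrite inE.
rewrite pairing_lat intr_eq0 => /andP[rA /eqP ur].
by have [H1 _ _] := Hu r; have := H1 rA; rewrite inE /ev ur ltxx => /(_ isT).
Qed.

Lemma cone_map (s : seq ray) : uniq s ->
  cone [seq ray_vec r | r <- s] = cone_of [set r in s] .
Proof.
move=> us; pose r0 : ray := inr true; pose s' := [seq ray_vec r | r <- s].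
have conv (d : nat -> R) : \sum_(i < size s') d i *: lat R s'`_i =
    \sum_(r in [set r in s]) d (index r s) *: lat R (ray_vec r).
  transitivity (\sum_(r <- s) d (index r s) *: lat R (ray_vec r)); last first.
    by rewrite big_uniq//; apply: eq_bigl => r; rewrite inE.
  rewrite -(big_mkord xpredT (fun i => d i *: lat R s'`_i)) size_map (big_nth r0).
  rewrite [LHS]big_nat [RHS]big_nat; apply: eq_bigr => i /andP[_ si].
  by rewrite index_uniq// (nth_map r0).
apply/seteqP; split=> x.
  move=> [c c0 ->].
  pose d k := if insub k is Some i then c i else 0.
  exists (fun r => d (index r s)) => [r|]; first by rewrite /d; case: insubP.
  by rewrite -conv; apply: eq_bigr => i _; rewrite /d valK.
move=> [c c0 ->].
exists (fun i : 'I_(size s') => c (nth r0 s i)) => [i|]; first exact: c0.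
rewrite (conv (fun k => c (nth r0 s k))); apply: eq_bigr => r; rewrite inE => rs.
by rewrite nth_index.
Qed.

Lemma fan_cone_of (F : set {set ray}) : (forall A, F A -> allowed A) ->
  (forall A B : {set ray}, B \subset A -> F A -> F B) ->
  is_fan [set cone_of A | A in F].
Proof.
move=> aF sF; split.
- apply: finite_image; exact: finite_finset.
- move=> _ [A FA <-]; split; last by move=> x; apply: cone_of_strict; exact: aF.
  exists [seq ray_vec r | r <- enum A].
  by rewrite cone_map ?enum_uniq//; congr cone_of; apply/setP => r; rewrite inE mem_enum.
- move=> _ tau [A FA <-] /(faces_cone_of _ (aF _ FA))[B BA ->].
  by exists B => //; exact: sF FA.
- move=> _ _ [A FA <-] [B FB <-]; rewrite cone_ofI; [|exact: aF|exact: aF].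
  split; apply/faces_cone_of; try exact: aF.
    by exists (A :&: B) => //; exact: finset.subsetIl.
  by exists (A :&: B) => //; exact: finset.subsetIr.
Qed.

End Cones.
End Rays.
Arguments cone_of {n} v R A _.

(** * The fan and its two end subfans *)

Section FanOfCones.
Variables (R : realType) (n : nat) (v : 'rV[int]_n.+1).

Definition maximal (b : bool) (i : 'I_n.+1) : {set ray n} :=
  inr b |: [set inl j | j : 'I_n.+1 & j != i].

Lemma inl_maximal b i j : (inl j \in maximal b i) = (j != i).
Proof.
rewrite !inE /=; apply/imsetP/idP => [[j' j'i [->]]|ji]; first by rewrite inE in j'i.
by exists j => //; rewrite inE.
Qed.

Lemma inr_maximal b i c : (inr c \in maximal b i) = (c == b).
Proof.
rewrite !inE; have -> : (inr c \in [set inl j | j : 'I_n.+1 & j != i]) = false.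
  by apply/negP => /imsetP[].
by rewrite orbF; apply/eqP/eqP => [[]|->].
Qed.

Lemma allowed_maximal b i : sg b * v 0 i < 0 -> allowed v (maximal b i).
Proof.
move=> vi c; rewrite inr_maximal => /eqP->; rewrite inr_maximal; split.
  by case: (b).
by exists i; rewrite inl_maximal eqxx.
Qed.

Lemma facet_and_maximal b i :
  @facet_and R n i (ray_vec v (inr b)) = cone_of v R (maximal b i).
Proof.
have -> : @facet_and R n i (ray_vec v (inr b)) =
    cone [seq ray_vec v r | r <- inr b :: [seq inl j | j <- enum 'I_n.+1 & j != i]].
  by rewrite /facet_and /= -map_comp.
rewrite cone_map; last first.
  rewrite /= map_inj_uniq; last by move=> ? ? [].
  by rewrite filter_uniq -?enumT ?enum_uniq// andbT; apply/mapP => -[].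
congr cone_of; apply/setP => -[j|c].
  rewrite inl_maximal inE in_cons /=; apply/mapP/idP => [[j']|ji].
    by rewrite mem_filter => /andP[j'i _] [->].
  by exists j => //; rewrite mem_filter ji mem_enum.
rewrite inr_maximal inE in_cons /=;
have -> : ((inr c : ray n) \in [seq inl j | j <- enum 'I_n.+1 & j != i]) = false.
  by apply/negP => /mapP[].
by rewrite orbF; apply/eqP/eqP => [[]|->].
Qed.

Lemma deltaE : @delta R n = cone_of v R [set inl j | j : 'I_n.+1].
Proof.
have -> : @delta R n =
    cone [seq ray_vec v r | r <- [seq inl j | j <- enum 'I_n.+1]].
  by rewrite /delta -[in RHS]map_comp.
rewrite cone_map; last by rewrite map_inj_uniq ?enum_uniq// => ? ? [].
congr cone_of; apply/setP => r; rewrite inE.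
apply/mapP/imsetP => -[j _ ->]; exists j => //; by rewrite mem_enum.
Qed.

Definition Lambda (b : bool) : set (set 'rV[R]_n.+1) :=
  faces [set facet_and i (ray_vec v (inr b)) | i in [set i | sg b * v 0 i < 0]].

Lemma LambdaE b : Lambda b = [set cone_of v R A | A in
  [set A : {set ray n} | exists2 i, sg b * v 0 i < 0 & A \subset maximal b i]].
Proof.
apply/seteqP; split=> [tau [_ [i vi <-]]|_ [A [i vi Ai] <-]].
  rewrite facet_and_maximal => /(faces_cone_of _ (allowed_maximal vi))[A Ai ->].
  by exists A => //; exists i.
exists (facet_and i (ray_vec v (inr b))); first by exists i.
rewrite facet_and_maximal; apply/(faces_cone_of _ (allowed_maximal vi)).
by exists A.
Qed.

Lemma faces_deltaE : faces [set @delta R n] =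
  [set cone_of v R A | A in [set A : {set ray n} | forall b, inr b \notin A]].
Proof.
have aE : allowed v [set inl j | j : 'I_n.+1].
  by apply: allowed_inl => b; apply/imsetP => -[].
apply/seteqP; split=> [tau [_ -> ]|_ [A nA <-]].
  rewrite deltaE => /(faces_cone_of _ aE)[A /fintype.subsetP AE ->].
  exists A => //= b; apply/negP => /AE /imsetP[]//.
exists (@delta R n) => //; rewrite deltaE; apply/(faces_cone_of _ aE).
exists A => //; apply/fintype.subsetP => -[j _|b]; first by apply/imsetP; exists j.
by rewrite (negbTE (nA b)).
Qed.

Lemma allowed_cases (A : {set ray n}) : allowed v A <->
  (forall b, inr b \notin A) \/
  exists b i, sg b * v 0 i < 0 /\ A \subset maximal b i.
Proof.
split=> [aA|[nA|[b [i [vi Ai]]]]]; last first.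
- exact: allowed_sub Ai (allowed_maximal vi).
- exact: allowed_inl.
have [[b bA]|nA] := pselect (exists b, inr b \in A); last first.
  by left=> b; apply/negP => bA; apply: nA; exists b.
right; have [nb [i [iA vi]]] := aA b bA; exists b, i; split=> //.
apply/fintype.subsetP => -[j jA|c cA].
  by rewrite inl_maximal; apply: contraNneq iA => <-.
by rewrite inr_maximal; move: nb cA; case: (b); case: (c) => //= /negbTE->.
Qed.

(** The three pieces of the fan merge into one condition on index sets, the very hypothesis of
    [separation]. *)
Definition Sigma_all : set (set 'rV[R]_n.+1) :=
  [set cone_of v R A | A in [set A | allowed v A]].

Lemma Sigma_allE : Sigma_all =
  Lambda false `|` faces [set @delta R n] `|` Lambda true.
Proof.
rewrite !LambdaE faces_deltaE -!image_setU; congr image.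
apply/seteqP; split=> A /=.
  move=> /allowed_cases[|[[] [i [vi Ai]]]]; first by left; right.
  - by right; exists i.
  - by left; left; exists i.
move=> [[[i vi Ai]|nA]|[i vi Ai]]; apply/allowed_cases; last 2 first.
- by left.
- by right; exists true, i.
- by right; exists false, i.
Qed.

Lemma fan_Sigma_all : is_fan Sigma_all.
Proof. by apply: fan_cone_of => // A B; exact: allowed_sub. Qed.

Lemma fan_Lambda b : is_fan (Lambda b).
Proof.
rewrite LambdaE; apply: fan_cone_of.
  by move=> A [i vi Ai]; exact: allowed_sub Ai (allowed_maximal vi).
by move=> A B BA [i vi Ai]; exists i => //; exact: fintype.subset_trans BA Ai.
Qed.

End FanOfCones.
Arguments Sigma_all R {n} v _.
Arguments Lambda R {n} v b _.

(** * Gluing of the charts *)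

Section Gluing.
Variables (R : realType) (n : nat).
Implicit Types (s t : set 'rV[R]_n.+1) (m : 'rV[int]_n.+1).
Local Notation C := R[i].

Lemma semigroup0 s : semigroup s 0.
Proof.
move=> x _; rewrite /pairing sumr_ge0// => j _.
by rewrite !mxE mul0r.
Qed.

Lemma semigroupD s m m' : semigroup s m -> semigroup s m' -> semigroup s (m + m').
Proof.
move=> Hm Hm' x sx; have := addr_ge0 (Hm x sx) (Hm' x sx).
rewrite /pairing -big_split /=; congr (0 <= _); apply: eq_bigr => j _.
by rewrite !mxE intrD mulrDl.
Qed.

Lemma semigroupMn s m K : semigroup s m -> semigroup s (m *+ K).
Proof.
move=> Hm; elim: K => [|K IH]; first exact: semigroup0.
by rewrite mulrS; exact: semigroupD.
Qed.

Lemma semigroup_sub s t m : t `<=` s -> semigroup s m -> semigroup t m.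
Proof. by move=> ts Hm x tx; apply: Hm; exact: ts. Qed.

Lemma character_value0 s (x : affine_toric s) : character_value x 0 = 1.
Proof. by have /set_mem[] := valP x. Qed.

Lemma character_valueD s (x : affine_toric s) m m' : semigroup s m ->
  semigroup s m' ->
  character_value x (m + m') = character_value x m * character_value x m'.
Proof. by have /set_mem[_ H _] := valP x; exact: H. Qed.

Lemma character_value_out s (x : affine_toric s) m : ~ semigroup s m ->
  character_value x m = 0.
Proof. by have /set_mem[_ _ H] := valP x; exact: H. Qed.

Lemma character_valueMn s (x : affine_toric s) m K : semigroup s m ->
  character_value x (m *+ K) = character_value x m ^+ K.
Proof.
move=> Hm; elim: K => [|K IH]; first by rewrite mulr0n expr0 character_value0.
rewrite mulrS exprS character_valueD ?IH//; exact: semigroupMn.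
Qed.

Lemma affine_toric_eq s (x y : affine_toric s) :
  (forall m, semigroup s m -> character_value x m = character_value y m) -> x = y.
Proof.
move=> H; apply: val_inj; apply/funext => m.
have [Sm|Sm] := pselect (semigroup s m); first exact: H.
have := character_value_out x Sm; rewrite /character_value => ->.
by have := character_value_out y Sm; rewrite /character_value => ->.
Qed.

(* The extension of x to the largest subset of M on which it is determined;
   two points of two charts are glued exactly when these extensions agree. *)
Definition germ s (x : affine_toric s) m (c : C) : Prop :=
  exists a b, [/\ semigroup s a, semigroup s b, character_value x b != 0,
    m = a - b & c = character_value x a / character_value x b].

Lemma germ_fun s (x : affine_toric s) m c c' : germ x m c -> germ x m c' -> c = c'.
Proof.
move=> [a [b [Sa Sb b0 -> ->]]] [a' [b' [Sa' Sb' b'0 /eqP E ->]]].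
apply/eqP; rewrite eqr_div//; apply/eqP; rewrite -!character_valueD//.
by congr character_value; move: E; rewrite subr_eq -addrA [- b' + _]addrC addrA
  eq_sym subr_eq => /eqP->.
Qed.

Lemma germM s (x : affine_toric s) m c m' c' : germ x m c -> germ x m' c' ->
  germ x (m + m') (c * c').
Proof.
move=> [a [b [Sa Sb b0 -> ->]]] [a' [b' [Sa' Sb' b'0 -> ->]]].
exists (a + a'), (b + b'); rewrite !character_valueD//; split; try exact: semigroupD.
- by rewrite mulf_neq0.
- by rewrite opprD addrACA.
- by rewrite invfM mulrACA.
Qed.

Lemma germ_character s (x : affine_toric s) m : semigroup s m ->
  germ x m (character_value x m).
Proof.
move=> Sm; exists m, 0; rewrite character_value0 subr0 divr1; split=> //.
  exact: semigroup0.
Qed.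

Lemma germV s (x : affine_toric s) m c : germ x m c -> c != 0 -> germ x (- m) c^-1.
Proof.
move=> [a [b [Sa Sb b0 -> ->]]] c0; exists b, a; split=> //.
- by move: c0; rewrite mulf_eq0 negb_or => /andP[].
- by rewrite opprB.
- by rewrite invf_div.
Qed.

Lemma germMn s (x : affine_toric s) m c K : germ x m c -> germ x (m *+ K) (c ^+ K).
Proof.
move=> g; elim: K => [|K IH].
  by rewrite mulr0n expr0 -(character_value0 x); exact/germ_character/semigroup0.
by rewrite mulrS exprS; exact: germM.
Qed.

(** Each character of [t] enters the semigroup of [s] after adding a multiple of [u], and [u] is
    invertible at [x]; so fractions of values of [y] can be rewritten as fractions of values of
    [x]. *)
Lemma germ_agree s t (x : affine_toric s) (y : affine_toric t) u :
  (forall m, semigroup s m -> germ y m (character_value x m)) ->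
  semigroup s u -> character_value x u != 0 ->
  (forall m, semigroup t m -> exists K, semigroup s (m + u *+ K)) ->
  germ x = germ y.
Proof.
move=> xy Su u0 Hu; apply/funext => m; apply/funext => c; apply/propext; split.
  move=> [a [b [Sa Sb b0 -> ->]]].
  by apply: germM; [exact: xy|apply: germV => //; exact: xy].
move=> [a [b [Sa Sb b0 -> ->]]].
have [K1 S1] := Hu _ Sa; have [K2 S2] := Hu _ Sb.
have ext a' K K' : semigroup s (a' + u *+ K) -> semigroup s (a' + u *+ (K + K')).
  by move=> ?; rewrite mulrnDr addrA; apply: semigroupD => //; exact: semigroupMn.
have E a' : semigroup t a' -> semigroup s (a' + u *+ (K1 + K2)) ->
  character_value x (a' + u *+ (K1 + K2)) =
  character_value y a' * character_value x u ^+ (K1 + K2).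
  move=> ta' sa'; apply: germ_fun (xy _ sa') _.
  by apply: germM; [exact: germ_character|apply: germMn; exact: xy].
have S1' := ext _ _ K2 S1; have S2' := ext _ _ K1 S2; rewrite addnC in S2'.
exists (a + u *+ (K1 + K2)), (b + u *+ (K1 + K2)).
rewrite !E//; split=> //.
- by rewrite mulf_neq0// expf_neq0.
- by rewrite opprD addrACA subrr addr0.
- by rewrite -mulf_div divff ?mulr1// expf_neq0.
Qed.

(** Once the germ of [y] is defined on the semigroup of [s], uniqueness of germ values makes the
    chosen values multiplicative. The zero is the convention for characters outside the
    semigroup. *)
Lemma extend_by_zero s t (y : affine_toric t) :
  (forall m, semigroup s m -> exists c, germ y m c) ->
  exists x : affine_toric s, forall m, semigroup s m -> germ y m (character_value x m).
Proof.
move=> H.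
pose f m : C := if pselect (semigroup s m) is left e then projT1 (cid (H m e)) else 0.
have fP m : semigroup s m -> germ y m (f m).
  by rewrite /f => Sm; case: pselect => // e; case: cid.
have fM : monoid_morphisms s f.
  split.
  - have g1 : germ y 0 1 by rewrite -(character_value0 y); exact/germ_character/semigroup0.
    exact: (germ_fun (fP _ (@semigroup0 s)) g1).
  - move=> m m' Sm Sm'; apply: (germ_fun (fP _ (semigroupD Sm Sm'))).
    by apply: germM; exact: fP.
  - by move=> m Sm; rewrite /f; case: pselect.
exists (exist (fun y => y \in monoid_morphisms s) f (mem_set fM) : affine_toric s).
by move=> m /fP.
Qed.

Variables (v : 'rV[int]_n.+1) (Sigma : set (set 'rV[R]_n.+1)).
Hypothesis SigmaE : Sigma = Sigma_all R v.
Local Notation X := (toric_variety Sigma).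

Lemma cone_of_index s : Sigma s -> exists2 A, allowed v A & s = cone_of v R A.
Proof. by rewrite SigmaE => -[A aA <-]; exists A. Qed.

(** The semigroup of the intersection is a localisation of each of the two semigroups, at [u] and at
    [- u]. *)
Lemma separate_cones s t : Sigma s -> Sigma t -> exists u,
  [/\ semigroup s u, semigroup t (- u),
     forall m, semigroup (s `&` t) m -> exists K, semigroup s (m + u *+ K) &
     forall m, semigroup (s `&` t) m -> exists K, semigroup t (m + (- u) *+ K)].
Proof.
have push (A B : {set ray n}) u m : (forall r, separates v A B u r) ->
    semigroup (cone_of v R (A :&: B)) m ->
    exists K, semigroup (cone_of v R A) (m + u *+ K).
  (* [u] is at least 1 on the rays of [A] outside [B], so this multiple absorbs every negative value
     of [m] there; on common rays [u] is 0 and [m] is already nonnegative. *)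
  move=> Hu /semigroup_cone_of Hm; exists (\sum_r `|ev v m r|)%N.
  apply/semigroup_cone_of => r rA; rewrite evD evMn.
  have [H1 _ H3] := Hu r; case rB: (r \in B).
    by rewrite H3// mul0rn addr0; apply: Hm; rewrite inE rA.
  have u0 : 0 < ev v u r by apply: H1; rewrite ?rB.
  have : (`|ev v m r| <= \sum_r `|ev v m r|)%N by rewrite (bigD1 r)//= leq_addr.
  move: (\sum_r `|ev v m r|)%N (ev v m r) (ev v u r) u0 => K a b b0 aK.
  by rewrite pmulrn mulrzz; nia.
have nneg (A B : {set ray n}) u : (forall r, separates v A B u r) ->
    semigroup (cone_of v R A) u.
  move=> Hu; apply/semigroup_cone_of => r rA.
  have [H1 _ H3] := Hu r; case rB: (r \in B); first by rewrite H3.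
  by apply: ltW; apply: H1; rewrite ?rB.
move=> /cone_of_index[A aA ->] /cone_of_index[B aB ->].
have [u Hu] := separation aA aB.
have HuN r : separates v B A (- u) r by exact: separatesN.
exists u; rewrite cone_ofI//; split.
- exact: nneg Hu.
- exact: nneg HuN.
- by move=> m; exact: push.
- by rewrite finset.setIC => m; exact: push.
Qed.

(** At a point of the overlap [u] and [- u] are mutually inverse, so neither chart loses information
    in passing to it. Conversely, equal germs give x(u) y(-u) = 1, so [u] is invertible at [x] and
    [x] extends to the intersection cone. *)
Lemma glued_germ (p q : charts_union Sigma) :
  glued p q <-> germ (projT2 p) = germ (projT2 q).
Proof.
case: p q => [[s Ss] x] [[t St] y]; rewrite /glued /=.
have [u [Su Tu Hs Ht]] := separate_cones (set_mem Ss) (set_mem St).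
have sub1 m : semigroup s m -> semigroup (s `&` t) m.
  by apply: semigroup_sub; exact: subIsetl.
have sub2 m : semigroup t m -> semigroup (s `&` t) m.
  by apply: semigroup_sub; exact: subIsetr.
split=> [[z [zx zy]]|xy].
  have : character_value z u * character_value z (- u) = 1.
    by rewrite -character_valueD ?subrr ?character_value0//; [exact: sub1|exact: sub2].
  move=> E; have zu : character_value z u != 0.
    by apply: contraPneq E => ->; rewrite mul0r => /eqP; rewrite eq_sym oner_eq0.
  have zNu : character_value z (- u) != 0.
    by apply: contraPneq E => ->; rewrite mulr0 => /eqP; rewrite eq_sym oner_eq0.
  rewrite (@germ_agree _ _ x z u)//; last 2 first.
  - by move=> m Sm; rewrite -zx//; apply: germ_character; exact: sub1.
  - by rewrite -zx.
  rewrite (@germ_agree _ _ y z (- u))//.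
  - by move=> m Sm; rewrite -zy//; apply: germ_character; exact: sub2.
  - by rewrite -zy.
have xu : character_value x u * character_value y (- u) = 1.
  have g1 : germ x u (character_value x u) by exact: germ_character.
  have g2 : germ x (- u) (character_value y (- u)) by rewrite xy; exact: germ_character.
  apply: germ_fun (germM g1 g2) _; rewrite subrr -(character_value0 x).
  exact/germ_character/semigroup0.
have xu0 : character_value x u != 0.
  by apply: contraPneq xu => ->; rewrite mul0r => /eqP; rewrite eq_sym oner_eq0.
have [m Sm|z Hz] := @extend_by_zero (s `&` t) s x.
  have [K SK] := Hs m Sm.
  exists (character_value x (m + u *+ K) / character_value x (u *+ K)).
  exists (m + u *+ K), (u *+ K); split=> //; first exact: semigroupMn.
    by rewrite character_valueMn// expf_neq0.
  by rewrite addrK.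
exists z; split=> m Sm.
  by apply: germ_fun (Hz _ (sub1 _ Sm)) _; exact: germ_character.
by apply: germ_fun (Hz _ (sub2 _ Sm)) _; rewrite xy; exact: germ_character.
Qed.

(** Being equality of germs, [glued] is already an equivalence relation, and the generated one adds
    nothing. *)
Lemma chart_eq (s t : Sigma) (x : affine_toric (val s)) (y : affine_toric (val t)) :
  chart x = chart y <-> germ x = germ y.
Proof.
rewrite /chart quotient_map_eq; split; last by move=> E; apply: rst_step; apply/glued_germ.
have : forall p q : charts_union Sigma, clos_refl_sym_trans _ (@glued R n.+1 Sigma) p q ->
    germ (projT2 p) = germ (projT2 q).
  by move=> p q; elim=> [? ? /glued_germ|//|//|? ? ? _ -> _ ->].
by move=> /[apply].
Qed.

Lemma chart_inj (s : Sigma) : injective (@chart R n.+1 Sigma s).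
Proof.
move=> x y /chart_eq E; apply: affine_toric_eq => m Sm.
by apply: (@germ_fun _ x m); [|rewrite E]; exact: germ_character.
Qed.

Lemma chart_surj (y : X) : exists (s : Sigma) (x : affine_toric (val s)), y = chart x.
Proof. by have [[s x] <-] := quotient_mapP y; exists s, x. Qed.

Lemma morphism_chart (s : Sigma) : morphism (@chart R n.+1 Sigma s).
Proof.
split; last by move=> U g oU rg; exact: rg.
apply/continuousP => U oU; move: (oU) => /sigT_openP /(_ s); exact.
Qed.

Definition Alg s := subalgebra
  [set f | exists2 m, semigroup s m & f = fun x : affine_toric s => val x m].

Lemma Alg_character s m : semigroup s m -> Alg (fun x : affine_toric s => character_value x m).
Proof. by move=> Sm; apply: subalgebra_gen; exists m. Qed.

Lemma Alg_basic_open s h : Alg h -> open ([set x | h x != 0] : set (affine_toric s)).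
Proof. by move=> Ah; exact: (affine_basic_open Ah). Qed.

Lemma regular_toric (W : set X) (f : X -> C) :
  (forall s : Sigma, regular (@chart R n.+1 Sigma s @^-1` W) (fun x => f (chart x))) ->
  regular W f.
Proof. by move=> H; exact H. Qed.

Lemma sheaf_toric : sheaf X.
Proof.
by apply: sheaf_quotient; apply: sheaf_disjoint_union => s; exact: sheaf_affine.
Qed.

Lemma cross_unit s t u (x : affine_toric s) (y : affine_toric t) :
  semigroup s u -> semigroup t (- u) -> germ x = germ y ->
  character_value x u * character_value y (- u) = 1.
Proof.
move=> Su Tu E; have g1 := germ_character x Su; have g2 := germ_character y Tu.
rewrite -E in g2; apply: germ_fun (germM g1 g2) _; rewrite subrr -(character_value0 x).
exact/germ_character/semigroup0.
Qed.

(** The form of the gluing that moves open sets and functions from one chart to the others: the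
    overlap is the principal open subset [u != 0] of the second chart, and functions of the first
    become fractions with powers of [u] as denominators. *)
Lemma transition (s t : Sigma) : exists u, [/\
  semigroup (val t) u,
  (forall x y, @chart _ _ _ s x = @chart _ _ _ t y -> character_value y u != 0),
  (forall y : affine_toric (val t), character_value y u != 0 ->
     exists x, @chart _ _ _ s x = @chart _ _ _ t y) &
  forall h, @Alg (val s) h -> exists h' K, @Alg (val t) h' /\
    forall x y, @chart _ _ _ s x = @chart _ _ _ t y ->
      h x * character_value y u ^+ K = h' y].
Proof.
have [u [Su Tu Hs Ht]] := separate_cones (set_mem (valP s)) (set_mem (valP t)).
exists (- u); split=> //.
- move=> x y /chart_eq E; have := cross_unit Su Tu E.
  by apply: contraPneq => ->; rewrite mulr0 => /eqP; rewrite eq_sym oner_eq0.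
- move=> y y0.
  have sub m : semigroup (val s) m -> semigroup (val s `&` val t) m.
    by apply: semigroup_sub; exact: subIsetl.
  have subt m : semigroup (val t) m -> semigroup (val s `&` val t) m.
    by apply: semigroup_sub; exact: subIsetr.
  have [m Sm|x Hx] := @extend_by_zero (val s) (val t) y.
    have [K SK] := Ht m (sub _ Sm).
    exists (character_value y (m + (- u) *+ K) / character_value y ((- u) *+ K)).
    exists (m + (- u) *+ K), ((- u) *+ K); split=> //; first exact: semigroupMn.
      by rewrite character_valueMn// expf_neq0.
    by rewrite addrK.
  exists x; apply/chart_eq; apply: (germ_agree Hx Su) => [|m /subt/Hs//].
  have g := Hx u Su; have g' := germ_character y Tu.
  have : character_value x u * character_value y (- u) = 1.
    apply: germ_fun (germM g g') _; rewrite subrr -(character_value0 y).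
    exact/germ_character/semigroup0.
  by apply: contraPneq => ->; rewrite mul0r => /eqP; rewrite eq_sym oner_eq0.
move=> h; elim=> [_ [m Sm ->]|c|f g _ [f' [K [Af Ef]]] _ [g' [L [Ag Eg]]]
                 |f g _ [f' [K [Af Ef]]] _ [g' [L [Ag Eg]]]].
- have [K SK] := Ht m (semigroup_sub (@subIsetl _ _ _) Sm).
  exists (fun y => character_value y (m + (- u) *+ K)), K; split.
    exact: Alg_character.
  move=> x y /chart_eq E; symmetry.
  apply: (@germ_fun _ y (m + (- u) *+ K)); first exact: germ_character.
  apply: germM; first by rewrite -E; exact: germ_character.
  by apply: germMn; exact: germ_character.
- exists (fun=> c), 0%N; split; first exact: subalgebra_cst.
  by move=> *; rewrite mulr1.
- exists (fun y => f' y * character_value y (- u) ^+ L + g' y * character_value y (- u) ^+ K).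
  exists (K + L)%N; split.
    apply: subalgebra_add; apply: subalgebra_mul => //; apply: subalgebra_exp;
      exact: Alg_character.
  by move=> x y E; rewrite -(Ef x y E) -(Eg x y E) exprD; ring.
- exists (fun y => f' y * g' y), (K + L)%N; split; first exact: subalgebra_mul.
  by move=> x y E; rewrite -(Ef x y E) -(Eg x y E) exprD; ring.
Qed.

Lemma open_toric (W : set X) :
  (forall s : Sigma, open (@chart R n.+1 Sigma s @^-1` W)) -> open W.
Proof. by move=> H; apply/sigT_openP => s; exact: H. Qed.

Lemma open_chart (s : Sigma) (W : set (affine_toric (val s))) : open W ->
  open (@chart R n.+1 Sigma s @` W).
Proof.
move=> oW; apply: open_toric => t; apply: open_locally => y [x Wx xy].
have [h [Ah hx HW]] := affine_base oW Wx.
have [u [Su H1 H2 /(_ h Ah)[h' [K [Ah' E]]]]] := transition s t.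
exists [set y | h' y * character_value y u != 0]; split.
- by apply: Alg_basic_open; apply: subalgebra_mul => //; exact: Alg_character.
- have yu := H1 x y xy.
  by rewrite /= mulf_neq0// -(E x y xy) mulf_neq0// expf_neq0.
- move=> y' /=; rewrite mulf_eq0 negb_or => /andP[h'y uy].
  have [x' xy'] := H2 y' uy; exists x' => //; apply: HW.
  by move: h'y; rewrite -(E x' y' xy') mulf_eq0 negb_or => /andP[].
Qed.

Lemma open_range_chart (s : Sigma) : open (range (@chart R n.+1 Sigma s)).
Proof. by apply: open_chart; exact: openT. Qed.

(** Functions on [X] being total, a function of a chart is extended by 0; only its values on the
    chart matter for regularity there. *)
Definition push (s : Sigma) (h : affine_toric (val s) -> C) (y : X) : C :=
  if pselect (exists x, @chart R n.+1 Sigma s x = y) is left e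
  then h (projT1 (cid e)) else 0.

Lemma push_chart (s : Sigma) h x : push h (@chart R n.+1 Sigma s x) = h x.
Proof.
rewrite /push; case: pselect => [e|[]]; last by exists x.
by case: cid => x' /= /chart_inj->.
Qed.

Lemma regular_push (s : Sigma) h : @Alg (val s) h ->
  regular (range (@chart R n.+1 Sigma s)) (push h).
Proof.
move=> Ah; apply: regular_toric => t y [x _ xy].
have [u [Su H1 H2 /(_ h Ah)[h' [K [Ah' E]]]]] := transition s t.
exists (setT, [set f | exists2 m, semigroup (val t) m &
   f = fun x : affine_toric (val t) => val x m]).
exists h', (fun y => character_value y u ^+ K); split; split=> //.
- by rewrite expf_neq0//; exact: H1 xy.
- by apply: subalgebra_exp; exact: Alg_character.
move=> y' [x' _ xy'] _ uy.
rewrite -(E x' y' xy').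
have -> : push h (chart y') = h x' by rewrite -xy' push_chart.
by rewrite mulfK.
Qed.

Lemma toric_open_locally (W : set X) :
  (forall p, W p -> exists (s : Sigma) (x : affine_toric (val s)) h,
    [/\ p = chart x, Alg h, h x != 0 & forall x', h x' != 0 -> W (chart x')]) ->
  open W.
Proof.
move=> H; apply: open_locally => p /H[s [x [h [-> Ah hx HW]]]].
exists (@chart R n.+1 Sigma s @` [set x | h x != 0]); split.
- exact: (open_chart (Alg_basic_open Ah)).
- by exists x.
- by move=> _ [x' hx' <-]; exact: HW.
Qed.

Lemma toric_regular_locally (W : set X) f : open W ->
  (forall p, W p -> exists (s : Sigma) (x : affine_toric (val s)) g h,
    [/\ p = chart x, Alg g, Alg h, h x != 0 &
      forall x', W (chart x') -> h x' != 0 -> f (chart x') * h x' = g x']) ->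
  regular W f.
Proof.
move=> oW H; have sX := sheaf_toric.
apply: (sheaf_loc sX) => p Wp; have [s [x [g [h [px Ag Ah hx E]]]]] := H p Wp.
pose U := @chart R n.+1 Sigma s @` [set x | h x != 0].
have oU : open U := open_chart (Alg_basic_open Ah).
exists U; split=> //; first by rewrite px; exists x.
have US : U `<=` range (@chart R n.+1 Sigma s) by move=> _ [x' _ <-]; exists x'.
have rg := sheaf_sub sX US (regular_push Ag).
have rh := sheaf_sub sX US (regular_push Ah).
have rV : regular U (fun y => (push h y)^-1).
  by apply: sheaf_inv_on => // _ [x' hx' <-]; rewrite push_chart.
apply: (sheaf_eq sX _ (sheaf_sub sX _ (sheaf_mul sX rg rV))); last by move=> y [].
move=> y [Wy [x' hx' yE]]; rewrite -yE !push_chart -E ?yE//.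
by rewrite mulfK.
Qed.

Lemma morphism_on_chart (Z : kspace C) (sZ : sheaf Z) (D : set Z)
    (s : Sigma) (phi : Z -> affine_toric (val s)) (f : Z -> X) : open D ->
  (forall z, D z -> f z = chart (phi z)) ->
  (forall m, semigroup (val s) m ->
     regular D (fun z => character_value (phi z) m)) ->
  morphism_on D f.
Proof.
move=> oD fE rm; apply: (@eq_morphism_on _ _ _ _ (@chart R n.+1 Sigma s \o phi)) => //.
  by move=> z Dz; rewrite fE.
apply: morphism_on_comp (morphism_chart s).
by apply: morphism_on_affine => // _ [m Sm ->]; exact: rm.
Qed.

End Gluing.

(** * Cox coordinates *)

Section Bezout.
Variables (n : nat) (v : 'rV[int]_n.+1).

(** Realises the gcd of the v_j with j in [J], up to sign, as the pairing of [v] with an integral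
    vector supported on [J]. Indices are added one at a time with a two-term Bezout relation. *)
Lemma bezout_on (J : pred 'I_n.+1) : exists w : 'rV[int]_n.+1,
  (forall j, ~~ J j -> w 0 j = 0) /\
  forall j, J j -> (int_pairing w v %| v 0%R j)%Z.
Proof.
suff H (s : seq 'I_n.+1) : exists w : 'rV[int]_n.+1,
    (forall j, ~~ J j -> w 0 j = 0) /\
    forall j, j \in s -> J j -> (int_pairing w v %| v 0%R j)%Z.
  have [w [w0 Hw]] := H (enum 'I_n.+1); exists w; split=> // j.
  by apply: Hw; rewrite mem_enum.
elim: s => [|i s [w [w0 Hw]]].
  by exists 0; split=> // j _; rewrite mxE.
case Ji: (J i); last first.
  exists w; split=> // j; rewrite inE => /orP[/eqP->|]; first by rewrite Ji.
  exact: Hw.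
have [a [c E]] := Bezoutz (int_pairing w v) (v 0 i).
exists (a *: w + c *: std_basis i); split=> [j Jj|j].
  rewrite !mxE w0// mulr0 add0r eqxx /=; case: eqP Jj => [->|_ _]; first by rewrite Ji.
  by rewrite mulr0.
rewrite int_pairingD !int_pairingZ int_pairing_basis E inE => /orP[/eqP-> _|js Jj].
  exact: dvdz_gcdr.
exact: dvdz_trans (dvdz_gcdl _ _) (Hw j js Jj).
Qed.

(* If B contains v or -v, then f_j = e_j - (v_j / g) w, where g = <w, v> is the
   gcd of the v_j with e_j outside B; otherwise f_j = e_j. *)
Lemma orthogonal_basis (B : {set ray n}) : exists f : 'I_n.+1 -> 'rV[int]_n.+1,
  (forall j r, inl j \notin B -> r \in B -> ev v (f j) r = 0) /\
  forall m, (forall r, r \in B -> ev v m r = 0) ->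
    m = \sum_(j | inl j \notin B) m 0 j *: f j.
Proof.
have base m : (forall r, r \in B -> ev v m r = 0) ->
    m = \sum_(j | inl j \notin B) m 0 j *: std_basis j.
  move=> m0; apply/rowP => i; rewrite summxE; case iB: (inl i \in B).
    rewrite -(ev_inl v) m0// big1// => j jB.
    rewrite !mxE; case: (i =P j) => [ij|]; rewrite ?andbF ?mulr0//.
    by rewrite -ij iB in jB.
  rewrite (bigD1 i) ?iB//= !mxE !eqxx mulr1 big1 ?addr0// => j /andP[_ ji].
  by rewrite !mxE eq_sym (negbTE ji) andbF mulr0.
have [[b bB]|nB] := pselect (exists b, inr b \in B); last first.
  exists (@std_basis n); split=> // j [i|b] jB iB; last by case: nB; exists b.
  rewrite ev_inl mxE; case: (i =P j) => [ij|]; rewrite ?andbF//.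
  by rewrite -ij iB in jB.
have [w [w0 Hw]] := bezout_on (fun j => inl j \notin B).
set g := int_pairing w v in Hw.
have vE j : inl j \notin B -> v 0 j = (divz (v 0 j) g) * g by move=> /Hw /divzK.
exists (fun j => std_basis j - (divz (v 0 j) g) *: w); split.
  move=> j [i|c] jB iB; rewrite evB evZ.
    rewrite !ev_inl (w0 i) ?negbK// mulr0 subr0 mxE; case: (i =P j) => [ij|]; rewrite ?andbF//.
    by rewrite -ij iB in jB.
  by rewrite !ev_inr int_pairing_basis -/g {1}vE//; ring.
move=> m m0.
have -> : \sum_(j | inl j \notin B) m 0 j *: (std_basis j - (divz (v 0 j) g) *: w) =
    m - (\sum_(j | inl j \notin B) m 0 j * (divz (v 0 j) g)) *: w.
  rewrite {2}(base m m0) scaler_suml -sumrB; apply: eq_bigr => j _.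
  by rewrite scalerBr scalerA.
have [g0|g0] := eqVneq g 0.
  by rewrite big1 ?scale0r ?subr0// => j _; rewrite g0 divz0 mulr0.
suff -> : \sum_(j | inl j \notin B) m 0 j * (divz (v 0 j) g) = 0.
  by rewrite scale0r subr0.
apply: (mulIf g0); rewrite mul0r mulr_suml.
have := m0 _ bB; rewrite ev_inr /int_pairing => /eqP; rewrite mulf_eq0.
have -> /= : (sg b == 0) = false by case: (b).
move=> /eqP E; rewrite -[RHS]E [RHS](bigID (fun j => inl j \notin B)) /=.
rewrite [X in _ = _ + X]big1 ?addr0; last first.
  by move=> j; rewrite negbK => jB; rewrite -(ev_inl v) m0// mul0r.
by apply: eq_bigr => j jB; rewrite -mulrA -vE.
Qed.

End Bezout.

Section Cox.
Variables (R : realType) (n : nat) (v : 'rV[int]_n.+1).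
Local Notation C := R[i].
Implicit Types (z : ray n -> C) (m : 'rV[int]_n.+1) (A B : {set ray n}).

(* The value at m of the point with Cox coordinates z; since 0 ^ 0 = 1, it is
   the expected one whenever <m, r> >= 0 for all r with z_r = 0. *)
Definition cox z m : C := \prod_r z r ^ ev v m r.

Definition zeros z : {set ray n} := [set r | z r == 0].

Lemma cox0 z : cox z 0 = 1.
Proof. by rewrite /cox big1// => r _; rewrite ev0 expr0z. Qed.

Lemma coxD z m m' : (forall r, r \in zeros z -> 0 <= ev v m r /\ 0 <= ev v m' r) ->
  cox z (m + m') = cox z m * cox z m'.
Proof.
move=> H; rewrite /cox -big_split; apply: eq_bigr => r _ /=.
rewrite evD; have [z0|z0] := eqVneq (z r) 0; last by rewrite expfzDr.
have [|m0 m'0] := H r; first by rewrite inE z0.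
by rewrite exprzD_ss// m0 m'0.
Qed.

Lemma cox_eq0 z m r : r \in zeros z -> 0 < ev v m r -> cox z m = 0.
Proof.
rewrite inE => /eqP z0 m0; rewrite /cox (bigD1 r)//= z0 exp0rz.
by rewrite (gt_eqF m0) mul0r.
Qed.

Lemma cox_neq0 z m : (forall r, r \in zeros z -> ev v m r = 0) -> cox z m != 0.
Proof.
move=> H; rewrite /cox prodf_seq_neq0; apply/allP => r _ /=.
have [z0|z0] := eqVneq (z r) 0; last by rewrite expfz_neq0.
by rewrite H ?inE ?z0// expr0z oner_neq0.
Qed.

Lemma cox_basis z j : (forall c, z (inr c) = 1) -> cox z (std_basis j) = z (inl j).
Proof.
move=> z1; rewrite /cox big_sumType /= (bigD1 j)//= !big1 ?mulr1 => [|c _|i ij].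
- by rewrite ev_inl mxE !eqxx expr1z.
- by rewrite z1 exp1rz.
- by rewrite ev_inl mxE eqxx (negbTE ij) expr0z.
Qed.

Definition cox_fun (s : set 'rV[R]_n.+1) z m : C :=
  if pselect (semigroup s m) is left _ then cox z m else 0.

Lemma cox_fun_monoid A z : zeros z \subset A ->
  monoid_morphisms (cone_of v R A) (cox_fun (cone_of v R A) z).
Proof.
move=> /fintype.subsetP zA; rewrite /cox_fun; split.
- by case: pselect => [_|[]]; [exact: cox0|exact: semigroup0].
- move=> m m' Sm Sm'; case: pselect => [_|[]]; last exact: semigroupD.
  case: pselect => // _; case: pselect => // _.
  apply: coxD => r /zA rA.
  by move/semigroup_cone_of: Sm => ->//; move/semigroup_cone_of: Sm' => ->.
- by move=> m Sm; case: pselect.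
Qed.

Lemma one_monoid (s : set 'rV[R]_n.+1) : monoid_morphisms s (cox_fun s (fun=> 1)).
Proof.
have c1 m : cox (fun=> 1) m = 1 by rewrite /cox big1// => r _; rewrite exp1rz.
rewrite /cox_fun; split.
- by case: pselect => [_|[]]; [exact: cox0|exact: semigroup0].
- move=> m m' Sm Sm'; case: pselect => [_|[]]; last exact: semigroupD.
  by case: pselect => // _; case: pselect => // _; rewrite !c1 mulr1.
- by move=> m Sm; case: pselect.
Qed.

(** Total in [z]: if the products do not define a monoid morphism on the semigroup of [s], the value
    defaults to the point with all coordinates 1. *)
Definition cox_point (s : set 'rV[R]_n.+1) z : affine_toric s :=
  if pselect (monoid_morphisms s (cox_fun s z)) is left e
  then exist (fun y => y \in monoid_morphisms s) _ (mem_set e)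
  else exist (fun y => y \in monoid_morphisms s) _ (mem_set (one_monoid s)).

Lemma cox_pointE s A z m : s = cone_of v R A -> zeros z \subset A ->
  semigroup s m -> character_value (cox_point s z) m = cox z m.
Proof.
move=> -> zA Sm; rewrite /cox_point; case: pselect; last by case; exact: cox_fun_monoid.
by move=> e; rewrite /character_value /= /cox_fun; case: pselect.
Qed.

Variable Sigma : set (set 'rV[R]_n.+1).
Hypothesis SigmaE : Sigma = Sigma_all R v.
Local Notation X := (toric_variety Sigma).

Lemma Sigma_cone A : allowed v A -> Sigma (cone_of v R A).
Proof. by move=> aA; rewrite SigmaE; exists A. Qed.

Lemma Sigma_origin : Sigma (cone_of v R finset.set0).
Proof. by apply: Sigma_cone => b; rewrite inE. Qed.

Definition index_cone A : Sigma :=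
  if pselect (allowed v A) is left e
  then exist (fun s => s \in Sigma) _ (mem_set (Sigma_cone e))
  else exist (fun s => s \in Sigma) _ (mem_set Sigma_origin).

Lemma index_coneE A : allowed v A -> val (index_cone A) = cone_of v R A.
Proof. by move=> aA; rewrite /index_cone; case: pselect. Qed.

Definition Cox z : X :=
  @chart R n.+1 Sigma (index_cone (zeros z)) (cox_point _ z).

(** The cone of [zeros z] is the intersection of the two cones, and on it the same products define
    the point that witnesses the gluing. *)
Lemma Cox_chart A z (s : Sigma) : allowed v A -> zeros z \subset A ->
  val s = cone_of v R A -> Cox z = chart (cox_point (val s) z).
Proof.
move=> aA zA sE; have aB := allowed_sub zA aA; have tE := index_coneE aB.
apply/quotient_map_eq; apply: rst_step; rewrite /glued /=.
have stE : val (index_cone (zeros z)) `&` val s = cone_of v R (zeros z).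
  by rewrite sE tE cone_ofI// (finset.setIidPl zA).
exists (cox_point _ z); split=> m Sm.
  rewrite (cox_pointE stE)// ?(cox_pointE tE)//.
  by rewrite stE -tE.
rewrite (cox_pointE stE)// ?(cox_pointE sE)//.
by apply: (semigroup_sub _ Sm); exact: subIsetr.
Qed.

Lemma Cox_ext z z' : allowed v (zeros z) -> zeros z = zeros z' ->
  (forall m, (forall r, r \in zeros z -> 0 <= ev v m r) -> cox z m = cox z' m) ->
  Cox z = Cox z'.
Proof.
move=> aA zz H; have sE := index_coneE aA.
transitivity (@chart R n.+1 Sigma (index_cone (zeros z)) (cox_point _ z')).
  rewrite /Cox; congr chart; apply: affine_toric_eq => m Sm.
  rewrite (cox_pointE sE)// (cox_pointE sE) -?zz//; apply: H.
  by move: Sm; rewrite sE => /semigroup_cone_of.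
by symmetry; apply: Cox_chart aA _ sE; rewrite zz.
Qed.

Lemma Cox_germ z m : allowed v (zeros z) ->
  (forall r, r \in zeros z -> 0 <= ev v m r) ->
  germ (cox_point (val (index_cone (zeros z))) z) m (cox z m).
Proof.
move=> aA Hm; have E := index_coneE aA.
have Sm : semigroup (val (index_cone (zeros z))) m.
  by rewrite E; apply/semigroup_cone_of.
by rewrite -(cox_pointE E (fintype.subxx _) Sm); exact: germ_character.
Qed.

(** A ray in one zero set but not in the other would give a separating [u] whose value is 0 at the
    first point, although its product with the value of [- u] at the second must be 1. *)
Lemma Cox_inj z z' : allowed v (zeros z) -> allowed v (zeros z') -> Cox z = Cox z' ->
  zeros z = zeros z' /\
  forall m, (forall r, r \in zeros z -> 0 <= ev v m r) -> cox z m = cox z' m.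
Proof.
move=> aA aB zz'; have /(chart_eq SigmaE) E := zz'.
have sub y y' : allowed v (zeros y) -> allowed v (zeros y') ->
    germ (cox_point (val (index_cone (zeros y))) y) =
    germ (cox_point (val (index_cone (zeros y'))) y') ->
    zeros y \subset zeros y'.
  move=> a a' {}E; apply/fintype.subsetP => r rA; apply/negPn/negP => rB.
  have [u Hu] := separation a a'.
  have [H1 _ _] := Hu r; have ur := H1 rA rB.
  have Su : semigroup (val (index_cone (zeros y))) u.
    rewrite index_coneE//; apply/semigroup_cone_of => s sA.
    have [K1 _ K3] := Hu s; case sB: (s \in zeros y'); first by rewrite K3.
    by apply: ltW; apply: K1; rewrite ?sB.
  have Tu : semigroup (val (index_cone (zeros y'))) (- u).
    rewrite index_coneE//; apply/semigroup_cone_of => s sB.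
    rewrite evN oppr_ge0.
    have [_ K2 K3] := Hu s; case sA: (s \in zeros y); first by rewrite K3.
    by apply: ltW; apply: K2; rewrite ?sA.
  have := cross_unit Su Tu E.
  rewrite (cox_pointE (index_coneE a) (fintype.subxx _) Su) (cox_eq0 rA ur) mul0r.
  by move=> /eqP; rewrite eq_sym oner_eq0.
have AB : zeros z = zeros z'.
  by apply/eqP; rewrite finset.eqEsubset !sub.
split=> // m Hm; have g := Cox_germ aA Hm; rewrite E in g.
by apply: germ_fun g _; apply: Cox_germ => // r; rewrite -AB; exact: Hm.
Qed.

(** The vanishing rays [B] are read off from [x]. Characters orthogonal to [B] are then invertible
    at [x], and since the f_j of [orthogonal_basis] span them, the germ values c_j at the f_j serve
    as the coordinates at e_j. *)
Lemma cox_point_surj A s (x : affine_toric s) : s = cone_of v R A ->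
  exists z, [/\ zeros z \subset A, x = cox_point s z &
    forall b, z (inr b) = (inr b \notin zeros z)%:R].
Proof.
move=> sE; have SP m : semigroup s m <-> forall r, r \in A -> 0 <= ev v m r.
  by rewrite sE; exact: semigroup_cone_of.
(* The rays whose toric divisor contains [x]: every character that vanishes along that divisor
   vanishes at [x]. *)
pose B := [set r in A | `[< forall m, semigroup s m -> 0 < ev v m r -> character_value x m = 0 >]].
have BA : B \subset A by apply/fintype.subsetP => r; rewrite inE => /andP[].
have xB m r : r \in B -> semigroup s m -> 0 < ev v m r -> character_value x m = 0.
  by rewrite inE => /andP[_ /asboolP H]; exact: H.
have /choice[d Hd] : forall r, exists m, [/\ semigroup s m, character_value x m != 0 &
       r \in A -> r \notin B -> 0 < ev v m r].
  move=> r.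
  have [rA|rA] := boolP (r \in A); last first.
    exists 0; rewrite character_value0; split=> //; exact: semigroup0.
  have [rB|] := boolP (r \in B).
    exists 0; rewrite character_value0; split=> //; exact: semigroup0.
  rewrite inE rA /= => /asboolPn H; apply/not_existsP => nH; apply: H => m Sm mr.
  by apply/eqP/negPn/negP => x0; apply: (nH m); split.
(* One character that is nonzero at [x], positive on [A] outside [B] and 0 on [B]. Its multiples
   bring any character orthogonal to [B] into the semigroup. *)
pose b := \sum_r d r.
have [Sb xb] : semigroup s b /\ character_value x b != 0.
  rewrite /b; elim/big_ind: _ => [|m m' [Sm m0] [Sm' m'0]|r _].
  - by rewrite character_value0; split; [exact: semigroup0|exact: oner_neq0].
  - by split; [exact: semigroupD|rewrite character_valueD// mulf_neq0].
  - by have [] := Hd r.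
have bA r : r \in A -> r \notin B -> 0 < ev v b r.
  move=> rA rB; rewrite /b (bigD1 r)//= evD.
  have [_ _ /(_ rA rB) d0] := Hd r; apply: ltr_wpDr => //.
  elim/big_ind: _ => [|m m' h h'|t _]; [by rewrite ev0|by rewrite evD addr_ge0|].
  by have [/SP Sd _ _] := Hd t; exact: Sd.
have bB r : r \in B -> ev v b r = 0.
  move=> rB; have rA := fintype.subsetP BA r rB.
  apply/eqP; rewrite eq_le (proj1 (SP b) Sb)// andbT leNgt; apply/negP => b0.
  by rewrite (xB b r) ?eqxx in xb.
have ext m : (forall r, r \in B -> ev v m r = 0) -> exists K, semigroup s (m + b *+ K).
  move=> Hm; exists (\sum_r `|ev v m r|)%N; apply/SP => r rA; rewrite evD evMn.
  case rB: (r \in B); first by rewrite Hm// bB// mul0rn.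
  have b0 : 0 < ev v b r by apply: bA; rewrite ?rB.
  have : (`|ev v m r| <= \sum_r `|ev v m r|)%N by rewrite (bigD1 r)//= leq_addr.
  move: (\sum_r `|ev v m r|)%N (ev v m r) (ev v b r) b0 => K a c c0 aK.
  by rewrite pmulrn mulrzz; nia.
have gm m : (forall r, r \in B -> ev v m r = 0) -> exists2 c, germ x m c & c != 0.
  move=> Hm; have [K SK] := ext m Hm.
  have [|K' SK'] := ext (- m); first by move=> r rB; rewrite evN Hm ?oppr0.
  exists (character_value x (m + b *+ K) / character_value x (b *+ K)).
    exists (m + b *+ K), (b *+ K); split=> //; first exact: semigroupMn.
      by rewrite character_valueMn// expf_neq0.
    by rewrite addrK.
  rewrite character_valueMn// mulf_neq0 ?invr_neq0 ?expf_neq0//.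
  apply/negP => /eqP x0.
  have : character_value x (m + b *+ K) * character_value x (- m + b *+ K') = 0.
    by rewrite x0 mul0r.
  rewrite -character_valueD// addrACA subrr add0r -mulrnDr character_valueMn//.
  by apply/eqP; rewrite expf_neq0.
have [f [f0 fE]] := orthogonal_basis v B.
have /choice[c Hc] : forall j, exists c, inl j \notin B -> germ x (f j) c /\ c != 0.
  move=> j.
  have [jB|jB] := boolP (inl j \notin B); last by exists 0.
  by have [c g c0] := gm (f j) (fun r => f0 j r jB); exists c.
(* The torus of the Cox construction leaves one parameter free; setting the nonvanishing coordinates
   at [v] and [-v] to 1 is the normalisation matching the f_j. *)
pose z (r : ray n) : C := if r \in B then 0 else if r is inl j then c j else 1.
have zB : zeros z = B.
  apply/setP => r; rewrite inE /z; case rB: (r \in B); first by rewrite eqxx.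
  case: r rB => [j jB|k _]; last by rewrite oner_eq0.
  by have [|_ /negbTE->//] := Hc j; rewrite jB.
exists z; rewrite zB; split=> //; last by move=> k; rewrite /z; case: ifP.
apply: affine_toric_eq => m Sm; rewrite (cox_pointE sE) ?zB//.
have [[r [rB mr]]|nr] := pselect (exists r, r \in B /\ 0 < ev v m r).
  by rewrite (xB m r)// (@cox_eq0 _ _ r) ?zB.
have mB r : r \in B -> ev v m r = 0.
  move=> rB; have rA := fintype.subsetP BA r rB.
  apply/eqP; rewrite eq_le (proj1 (SP m) Sm)// andbT leNgt; apply/negP => m0.
  by apply: nr; exists r.
have germZ m' c' (k : int) : germ x m' c' -> c' != 0 -> germ x (k *: m') (c' ^ k).
  have nat_scale (k' : nat) : (k' : int) *: m' = m' *+ k' by rewrite -scaler_nat natz.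
  move=> g c0; case: k => k; first by rewrite nat_scale; exact: germMn.
  rewrite NegzE scaleNr nat_scale -exprnN; apply: germV; first exact: germMn.
  by rewrite expf_neq0.
have germ_sum : germ x (\sum_(j | inl j \notin B) m 0 j *: f j)
    (\prod_(j | inl j \notin B) c j ^ m 0 j).
  elim/big_rec2: _ => [|j c' m' jB g].
    by rewrite -(character_value0 x); exact/germ_character/semigroup0.
  by apply: germM => //; have [g' c0] := Hc j jB; exact: germZ.
rewrite -fE// in germ_sum; rewrite (germ_fun (germ_character x Sm) germ_sum).
rewrite /cox big_sumType /= [X in _ = _ * X]big1 ?mulr1 => [|k _]; last first.
  by rewrite /z; case: ifP => [kB|_]; [rewrite mB// expr0z|rewrite exp1rz].
rewrite [RHS](bigID (fun j => inl j \notin B)) /= [X in _ = _ * X]big1 ?mulr1 => [|j].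
  by apply: eq_bigr => j jB; rewrite ev_inl /z (negbTE jB).
by rewrite negbK => jB; rewrite mB// expr0z.
Qed.

Lemma Cox_surj (y : X) : exists z, [/\ allowed v (zeros z), y = Cox z &
    forall b, z (inr b) = (inr b \notin zeros z)%:R].
Proof.
have [s [x ->]] := chart_surj y.
have [A aA sE] := cone_of_index SigmaE (set_mem (valP s)).
have [z [zA xE zb]] := cox_point_surj x sE; exists z; split=> //.
  exact: allowed_sub zA aA.
by rewrite (Cox_chart aA zA sE) xE.
Qed.

(** On the chart of [A] a character has nonnegative exponents at the rays of [A], and the
    coordinates at all other rays are units on [D]; so every factor of the product is regular. *)
Lemma morphism_on_Cox (Z : kspace C) (sZ : sheaf Z) (D : set Z) A
    (zz : Z -> ray n -> C) (f : Z -> X) : open D -> allowed v A ->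
  (forall y, D y -> f y = Cox (zz y)) ->
  (forall y, D y -> zeros (zz y) \subset A) ->
  (forall r, regular D (fun y => zz y r)) ->
  morphism_on D f.
Proof.
move=> oD aA fE zA rz; pose s := index_cone A; have sE := index_coneE aA.
apply: (morphism_on_chart sZ (phi := fun y => cox_point (val s) (zz y))) => //.
  by move=> y Dy; rewrite fE// (Cox_chart aA (zA _ Dy) sE).
move=> m Sm.
suff H : regular D (fun y => \prod_r zz y r ^ ev v m r).
  by apply: (sheaf_eq sZ _ H) => y Dy; rewrite (cox_pointE sE) ?zA.
apply: sheaf_prod => // r; apply: sheaf_exprz => //.
have [rA|rA] := boolP (r \in A).
  by left; move: Sm; rewrite sE => /semigroup_cone_of; exact.
right=> y Dy; apply: contra rA => y0; apply: (fintype.subsetP (zA _ Dy)).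
by rewrite inE.
Qed.

End Cox.

(** * Maps from quotients, embeddings and Laurent polynomials *)

Section QuotientLift.
Variables (k : fieldType) (X : kspace k) (r : X -> X -> Prop).

Definition quotient_lift (T : Type) (f : X -> T) (y : quotient r) : T := f (repr y).

Lemma quotient_liftE (T : Type) (f : X -> T) x :
  (forall x y, r x y -> f x = f y) -> quotient_lift f (quotient_map r x) = f x.
Proof.
move=> fr; have H a b : clos_refl_sym_trans X r a b -> f a = f b.
  by elim=> [? ? /fr|//|//|? ? ? _ -> _ ->].
by apply: H; apply/quotient_map_eq; exact: reprK.
Qed.

Lemma morphism_quotient_lift (Y : kspace k) (f : X -> Y) : sheaf X ->
  (forall x y, r x y -> f x = f y) -> morphism f ->
  morphism (quotient_lift f : quotient r -> Y).
Proof.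
move=> sX fr /morphismT mf; apply: morphism_from_quotient; apply/morphismT.
by apply: (eq_morphism_on sX _ mf) => x _; rewrite /= quotient_liftE.
Qed.

End QuotientLift.

Lemma regular_comp (k : fieldType) (X Y : kspace k) (f : X -> Y) g :
  morphism f -> regular setT g -> regular setT (g \o f).
Proof.
by move=> [_ rf] rg; have := rf setT g openT rg; rewrite preimage_setT.
Qed.

(** The inverse map need not be exhibited as a morphism: it is enough that [f] is open and that
    regularity descends along it. *)
Lemma isomorphism_onto_intro (k : fieldType) (X Y : kspace k) (S : set Y)
    (f : X -> Y) : sheaf X -> sheaf Y -> morphism f -> injective f ->
  range f = S ->
  (forall W : set X, open W -> open (f @` W)) ->
  (forall (W : set X) h, open W -> regular W (h \o f) -> regular (f @` W) h) ->
  isomorphism_onto f S.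
Proof.
move=> sX sY mf fI fS H1 H2.
have fin x : f x \in S by rewrite -fS; apply/mem_set; exists x.
pose g x : subvariety S := exist _ (f x) (fin x).
have inv (y : subvariety S) : exists x, f x = val y.
  have : range f (val y) by rewrite fS; exact: set_mem (valP y).
  by move=> [x _ <-]; exists x.
have /choice[g' Hg'] := inv.
have gK : cancel g g' by move=> x; apply: fI; rewrite Hg'.
have g'K : cancel g' g by move=> y; apply: val_inj; rewrite /= Hg'.
exists g => //; split; first by apply: morphism_corestrict.
exists g'; split=> //; split.
  apply/continuousP => W oW; apply/open_subvariety; exists (f @` W); first exact: H1.
  apply/seteqP; split=> y /=; first by move=> Wy; exists (g' y).
  by move=> [x Wx fx]; rewrite (_ : g' y = x)//; apply: fI; rewrite Hg'.
move=> W h oW rh y Wy.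
pose h' (p : Y) : k := if pselect (exists x, f x = p) is left e then h (projT1 (cid e)) else 0.
have h'f x : h' (f x) = h x.
  rewrite /h'; case: pselect => [e|[]]; last by exists x.
  by case: cid => x' /= /fI->.
exists (f @` W), h'; split; first exact: H1.
- by apply: H2 => //; apply: (sheaf_eq sX _ rh) => x _; rewrite /= h'f.
- by exists (g' y).
- by move=> y' Wy' _; rewrite /= -Hg' h'f.
Qed.

(** On the range of [s] the inverse is [p] after the inverse of [j]. Nothing is asked of [z] as a
    map between spaces, so it may be built from a choice of representatives. *)
Lemma isomorphism_onto_retract (k : fieldType) (X Y Z : kspace k) (L : set Y)
    (j : Z -> Y) (s : X -> Y) (z : X -> Z) (p : Z -> X) :
  sheaf X -> sheaf Y -> isomorphism_onto j L -> morphism s -> morphism p ->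
  (forall x, s x = j (z x)) -> cancel z p -> isomorphism_onto s (range s).
Proof.
move=> sX sY [g [_ [gi [mgi gK giK]]] gE] ms mp sE zK.
have inL (y : subvariety (range s)) : val y \in L.
  have [x _ <-] : range s (val y) by exact: set_mem (valP y).
  by rewrite sE gE; exact: valP.
pose incl (y : subvariety (range s)) : subvariety L := exist _ (val y) (inL y).
have mincl : morphism incl.
  by apply: morphism_corestrict => //; [exact: sheaf_subvariety|exact: morphism_inclusion].
have inS x : s x \in range s by apply/mem_set; exists x.
pose f x : subvariety (range s) := exist _ (s x) (inS x).
pose f' := p \o (gi \o incl).
have fK : cancel f f'.
  move=> x; rewrite /f' /=.
  have -> : incl (f x) = g (z x) by apply: val_inj; rewrite /= sE gE.
  by rewrite gK zK.
exists f => //; split; first exact: morphism_corestrict.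
exists f'; split=> //; first by apply: morphism_comp => //; exact: morphism_comp.
move=> y; have [x _ yx] : range s (val y) by exact: set_mem (valP y).
have -> : y = f x by apply: val_inj.
by rewrite fK.
Qed.

Section PolynomialFunctions.
Variable F : numFieldType.

Lemma poly_eq0_fun (P : {poly F}) : (forall t, P.[t] = 0) -> P = 0.
Proof.
move=> H; apply: (@roots_geq_poly_eq0 _ _ [seq k%:R | k <- iota 0 (size P)]).
- by apply/allP => x _; apply/rootP.
- rewrite map_inj_uniq ?iota_uniq// => a b /eqP; rewrite eqr_nat; exact: eqP.
- by rewrite size_map size_iota.
Qed.

Lemma poly_eq0_generic (P Q : {poly F}) : Q != 0 ->
  (forall t, Q.[t] != 0 -> P.[t] = 0) -> P = 0.
Proof.
move=> Q0 H; apply/eqP; have : P * Q == 0.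
  apply/eqP/poly_eq0_fun => t; rewrite hornerM.
  by have [->|/H->] := eqVneq Q.[t] 0; rewrite ?mulr0 ?mul0r.
by rewrite mulf_eq0 (negbTE Q0) orbF.
Qed.

Lemma laurent_eq0 (I : finType) (c : I -> F) (w : I -> int) :
  (forall t, t != 0 -> \sum_i t ^ w i * c i = 0) ->
  forall a, \sum_(i | w i == a) c i = 0.
Proof.
(* Bounds all the exponents, so multiplying by t^N leaves a polynomial that vanishes at every
   nonzero t. *)
move=> H a; pose N : nat := (\sum_i `|w i|)%N.
have wN i : 0 <= w i + N%:Z.
  have : (`|w i| <= N)%N by rewrite /N (bigD1 i)//= leq_addr.
  by lia.
pose e i := absz (w i + N%:Z).
have eE i : w i + N%:Z = e i by rewrite /e gez0_abs.
pose P : {poly F} := \sum_i c i *: 'X^(e i).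
have P0 : P = 0.
  apply: (@poly_eq0_generic P 'X) => [|t]; first by rewrite -size_poly_eq0 size_polyX.
  rewrite hornerX => t0; rewrite horner_sum.
  transitivity (t ^+ N * \sum_i t ^ w i * c i); last by rewrite H ?mulr0.
  rewrite big_distrr; apply: eq_bigr => i _ /=.
  by rewrite hornerZ hornerXn mulrA [LHS]mulrC -[t ^+ e i]/(t ^ (e i)) -eE addrC expfzDr.
have [aN|aN] := boolP (0 <= a + N%:Z); last first.
  by rewrite big1// => i /eqP wa; rewrite -wa wN in aN.
have := congr1 (fun p : {poly F} => p`_(absz (a + N%:Z))) P0.
rewrite coef0 coef_sum => E0; rewrite -[RHS]E0 [RHS](bigID (fun i => w i == a)) /=.
rewrite [X in _ = _ + X]big1 ?addr0 => [|i wa].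
  by apply: eq_bigr => i /eqP wa; rewrite coefZ coefXn /e wa eqxx mulr1.
rewrite coefZ coefXn; case: eqP => [E|]; last by rewrite mulr0.
by case/eqP: wa; apply: (addIr N%:Z); rewrite eE -E gez0_abs.
Qed.

End PolynomialFunctions.

Lemma sum_by_weight (F : zmodType) (I : finType) (c : I -> F) (w : I -> int) :
  (forall a, \sum_(i | w i == a) c i = 0) -> \sum_i c i = 0.
Proof.
move=> H; pose u := undup [seq w i | i <- enum I].
transitivity (\sum_(a <- u) \sum_(i | w i == a) c i); last first.
  by rewrite big1// => a _; exact: H.
rewrite (eq_bigr (fun a => \sum_i if w i == a then c i else 0)); last first.
  by move=> a _; rewrite -big_mkcond.
rewrite exchange_big /=; apply: eq_bigr => i _; rewrite -big_mkcond.
under eq_bigl do rewrite eq_sym.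
have wu : w i \in u by rewrite mem_undup map_f// mem_enum.
rewrite -big_filter (_ : [seq a <- u | a == w i] = [:: w i]) ?big_seq1//.
by rewrite -(filter_pred1_uniq (undup_uniq _) wu); apply: eq_filter.
Qed.

Lemma prod_expz (F : fieldType) (I : Type) (r : seq I) (P : pred I) (t : F) (e : I -> int) :
  t != 0 -> \prod_(i <- r | P i) t ^ e i = t ^ (\sum_(i <- r | P i) e i).
Proof.
move=> t0; apply: (big_rec2 (fun x y => x = t ^ y)) => [|i x y _ ->].
  by rewrite expr0z.
by rewrite expfzDr.
Qed.

Lemma complex_root (R : realType) (c : R[i]) (g : int) : g != 0 -> c != 0 ->
  exists2 t, t != 0 & t ^ g = c.
Proof.
move=> g0 c0; have g1 : (0 < `|g|)%N by lia.
have rK : (`|g|.-root c) ^+ `|g| = c by exact: rootCK.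
have r0 : `|g|.-root c != 0.
  by apply: contraNneq c0 => r0; rewrite -rK r0 expr0n; move: g1; case: `|g|%N.
case: g g0 g1 rK r0 => k k0 k1 rK r0; first by exists (k.-root c).
by exists (k.+1.-root c)^-1; rewrite ?invr_eq0// NegzE -exprnN exprVn invrK.
Qed.

Lemma open_quotient_map (k : fieldType) (X : kspace k) (r : X -> X -> Prop)
  (W : set (quotient r)) : open W -> open (quotient_map r @^-1` W).
Proof. by move=> oW; exact oW. Qed.

Lemma regular_quotient_map (k : fieldType) (X : kspace k) (r : X -> X -> Prop)
    (W : set (quotient r)) f : regular W f ->
  regular (quotient_map r @^-1` W) (f \o quotient_map r).
Proof. by move=> rf; exact rf. Qed.

(** * The line bundles over the orbit spaces *)

Section Bundle.
Variables (R : realType) (n d1 d2 : nat) (q : 'I_n.+1 -> nat).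
Local Notation C := R[i].
Local Notation v := (weight_vector d1 d2 q).
Variable Sigma : set (set 'rV[R]_n.+1).
Hypothesis SigmaE : Sigma = Sigma_all R v.
Local Notation X := (toric_variety Sigma).
Variables (b : bool) (B : set (affine_space C n.+1)) (w : int).
Hypothesis BE : forall p : 'rV[C]_n.+1,
  B p <-> exists2 i, sg b * v 0 i < 0 & p 0 i != 0.
Hypothesis wE : w = - sg b.
Local Notation BC := (product (subvariety B) (affine_line C)).
Local Notation E := (line_bundle d1 d2 q B w).

Definition base_point (y : BC) : 'rV[C]_n.+1 := val y.1.
Definition fiber_coord (y : BC) : C := y.2.

(* The class [p, l] of the line bundle has coordinates p_j at e_j, l at the ray
   of Lambda and 1 at the opposite ray. *)
Definition bundle_cox (y : BC) (r : ray n) : C :=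
  match r with
  | inl j => base_point y 0 j
  | inr c => if c == b then fiber_coord y else 1
  end.

Definition scaled (t : C) (y y' : BC) : Prop :=
  base_point y' = weighted_act d1 d2 q t (base_point y) /\
  fiber_coord y' = t ^ w * fiber_coord y.

Lemma sheaf_affine_space : sheaf (affine_space C n.+1).
Proof. exact: sheaf_affine. Qed.

Lemma sheaf_base : sheaf (subvariety B).
Proof. exact: sheaf_subvariety sheaf_affine_space. Qed.

Lemma sheaf_BC : sheaf BC.
Proof. by apply: sheaf_product; [exact: sheaf_base|exact: sheaf_affine]. Qed.

Lemma regular_coordinate j :
  regular setT (fun p : affine_space C n.+1 => (p : 'rV[C]_n.+1) 0 j).
Proof. by apply: regular_affine; apply: subalgebra_gen; exists j. Qed.

Lemma regular_line : regular setT (fun l : affine_line C => (l : C)).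
Proof. by apply: regular_affine; apply: subalgebra_gen. Qed.

Lemma regular_bundle_cox r : regular setT (fun y : BC => bundle_cox y r).
Proof.
case: r => [j|c].
  have r1 := regular_comp (@morphism_inclusion _ _ B) (regular_coordinate j).
  exact: (regular_comp (@morphism_fst _ (subvariety B) (affine_line C)) r1).
rewrite /bundle_cox; case: (c == b); last exact: (sheaf_cst sheaf_BC).
exact: (regular_comp (@morphism_snd _ (subvariety B) (affine_line C)) regular_line).
Qed.

Definition unit_locus (i : 'I_n.+1) : set BC := [set y | base_point y 0 i != 0].

Lemma open_unit_locus i : open (unit_locus i).
Proof.
have := sheaf_open sheaf_BC openT (regular_bundle_cox (inl i)).
by rewrite setTI.
Qed.

Lemma BC_cover (y : BC) : exists2 i, sg b * v 0 i < 0 & unit_locus i y.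
Proof.
have : B (val y.1) by exact: set_mem (valP y.1).
by move=> /BE[i vi yi]; exists i.
Qed.

Lemma bundle_cox_zeros i y : unit_locus i y -> zeros (bundle_cox y) \subset maximal b i.
Proof.
move=> yi; apply/fintype.subsetP => -[j|c]; rewrite inE /=.
  by rewrite inl_maximal => yj; apply: contraTneq yj => ->.
by rewrite inr_maximal; case: (c == b); rewrite ?oner_eq0.
Qed.

Lemma bundle_cox_allowed y : allowed v (zeros (bundle_cox y)).
Proof.
have [i vi yi] := BC_cover y.
exact: allowed_sub (bundle_cox_zeros yi) (allowed_maximal vi).
Qed.

Lemma scaled_zeros t y y' : t != 0 -> scaled t y y' ->
  zeros (bundle_cox y') = zeros (bundle_cox y).
Proof.
move=> t0 [yy ll]; apply/setP => -[j|c]; rewrite !inE /=.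
  by rewrite yy mxE mulf_eq0 expfz_eq0 (negbTE t0) andbF.
by case: (c == b) => //; rewrite ll mulf_eq0 expfz_eq0 (negbTE t0) andbF.
Qed.

(** The scaling exponents, v_j at e_j and [w] at [inr b], are the coefficients of the linear
    relation between [v] and the basis. The total power of t in any character is therefore 0. *)
Lemma scaled_cox t y y' m : t != 0 -> scaled t y y' ->
  cox v (bundle_cox y') m = cox v (bundle_cox y) m.
Proof.
move=> t0 [yy ll]; pose a (r : ray n) : int :=
  match r with inl j => v 0 j | inr c => if c == b then w else 0 end.
have E r : bundle_cox y' r = t ^ a r * bundle_cox y r.
  case: r => [j|c] /=; first by rewrite yy mxE.
  by case: (c == b); rewrite ?ll// expr0z mul1r.
rewrite /cox (eq_bigr (fun r => t ^ (a r * ev v m r) * bundle_cox y r ^ ev v m r)).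
  rewrite big_split /= -[RHS]mul1r; congr (_ * _).
  rewrite prod_expz//; suff -> : \sum_r a r * ev v m r = 0 by rewrite expr0z.
  rewrite big_sumType /= big_bool /=.
  have -> : \sum_j v 0 j * ev v m (inl j) = int_pairing m v.
    by apply: eq_bigr => j _; rewrite ev_inl mulrC.
  by rewrite !ev_inr wE; case: (b); rewrite /sg /=; ring.
by move=> r _; rewrite E expfzMl exprz_exp.
Qed.

Definition bundle_map (y : BC) : X := Cox SigmaE (bundle_cox y).

Lemma bundle_map_rel y y' : twisted_rel d1 d2 q w y y' -> bundle_map y = bundle_map y'.
Proof.
move=> [t t0 yy']; apply: Cox_ext => [||m _]; first exact: bundle_cox_allowed.
  by rewrite (scaled_zeros t0 yy').
by rewrite (scaled_cox _ t0 yy').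
Qed.

Definition jmap : E -> X := quotient_lift bundle_map.

Lemma jmapE y : jmap (quotient_map _ y) = bundle_map y.
Proof. by apply: quotient_liftE => ? ?; exact: bundle_map_rel. Qed.

Lemma morphism_bundle_map : morphism (bundle_map : BC -> X).
Proof.
apply: morphism_local sheaf_BC _ => y; have [i vi yi] := BC_cover y.
exists (unit_locus i); split; [exact: open_unit_locus|exact: yi|].
apply: (@morphism_on_Cox _ _ _ _ SigmaE BC sheaf_BC (unit_locus i) (maximal b i)
         bundle_cox bundle_map (open_unit_locus i) (allowed_maximal vi)).
- by [].
- by move=> y' yi'; exact: bundle_cox_zeros.
- by move=> r; exact: (sheaf_sub sheaf_BC (@subsetT _ _) (regular_bundle_cox r)).
Qed.

Lemma morphism_jmap : morphism jmap.
Proof.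
apply: morphism_quotient_lift sheaf_BC _ morphism_bundle_map.
by move=> ? ?; exact: bundle_map_rel.
Qed.

Lemma scaled_exists t (y : BC) : t != 0 -> exists y' : BC, scaled t y y'.
Proof.
move=> t0; have [i vi yi] := BC_cover y.
have Bt : B (weighted_act d1 d2 q t (base_point y)).
  by apply/BE; exists i => //; rewrite mxE mulf_neq0// expfz_neq0.
by exists (exist (fun p => p \in B) _ (mem_set Bt), t ^ w * fiber_coord y).
Qed.

(** Off the zero section the ratio of the fiber coordinates determines t. On it, t has to be
    recovered from the base coordinates, up to the stabiliser, by extracting a root. *)
Lemma bundle_map_inj y y' : bundle_map y = bundle_map y' -> twisted_rel d1 d2 q w y y'.
Proof.
move=> /Cox_inj[||zz H]; try exact: bundle_cox_allowed.
set A := zeros (bundle_cox y) in zz H.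
have yA j : (inl j \in A) = (base_point y 0 j == 0) by rewrite inE.
have y'A j : (inl j \in A) = (base_point y' 0 j == 0) by rewrite zz inE.
have [l0|l0] := eqVneq (fiber_coord y) 0; last first.
  have nA c : inr c \notin A.
    by rewrite inE /=; case: (c == b); rewrite ?oner_neq0.
  have l'0 : fiber_coord y' != 0 by have := nA b; rewrite zz inE /= eqxx.
  (* The equation t^w = s is solved by t = s^w because [w] is 1 or -1. *)
  pose s := fiber_coord y' / fiber_coord y.
  have s0 : s != 0 by rewrite mulf_neq0 ?invr_eq0.
  exists (s ^ w); first by rewrite expfz_neq0.
  split; last first.
    rewrite exprz_exp wE mulrNN.
    have -> : sg b * sg b = 1 by case: (b).
    by rewrite expr1z divfK.
  apply/rowP => j; rewrite mxE.
  have [jA|jA] := boolP (inl j \in A).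
    by move: (jA) (jA); rewrite {1}yA y'A => /eqP-> /eqP->; rewrite mulr0.
  have coxj z : (forall c, c != b -> z (inr c) = 1) ->
      cox v z (std_basis j) = z (inl j) * z (inr b) ^ (sg b * v 0 j) :> C.
    move=> z1; rewrite /cox big_sumType /= (bigD1 j)//= [X in _ * X * _]big1 => [|i ij].
      rewrite mulr1 ev_inl mxE !eqxx expr1z (bigD1 b)//= [X in _ * (_ * X)]big1 => [|c /z1->].
        by rewrite mulr1 ev_inr int_pairing_basis.
      by rewrite exp1rz.
    by rewrite ev_inl mxE eqxx (negbTE ij) expr0z.
  have := H (std_basis j); rewrite !coxj /=; last 2 first.
  - by move=> c /negbTE->.
  - by move=> c /negbTE->.
  rewrite eqxx => E; rewrite -[LHS](mulfK (expfz_neq0 (sg b * v 0 j) l'0)) -E; last first.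
    move=> [i iA|c cA]; last by rewrite (negbTE (nA c)) in cA.
    rewrite ev_inl mxE eqxx /=; case: eqP => [ij|//].
    by rewrite -ij iA in jA.
  rewrite exprz_exp wE mulNr -invr_expz /s expfzMl exprz_inv -invr_expz invfM invrK.
  by rewrite -mulrA mulrC [X in X * _]mulrC.
have bA : inr b \in A by rewrite inE /= eqxx l0.
have l'0 : fiber_coord y' = 0 by move: bA; rewrite zz inE /= eqxx => /eqP.
have nbA c : c != b -> inr c \notin A.
  by move=> cb; rewrite inE /= (negbTE cb) oner_neq0.
(* The ratio of the two points on the rays where neither vanishes. The value 1 on [A] keeps [z]
   invertible and does not affect characters orthogonal to [A], on which [z] takes the value 1. *)
pose z (r : ray n) : C := if r \in A then 1 else bundle_cox y' r / bundle_cox y r.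
have z0 : zeros z = finset.set0.
  apply/setP => r; rewrite !inE /z; case rA: (r \in A); first by rewrite oner_eq0.
  have y0 : (bundle_cox y r == 0) = false by move: rA; rewrite inE.
  have y'0 : (bundle_cox y' r == 0) = false by move: rA; rewrite zz inE.
  by rewrite mulf_eq0 invr_eq0 y0 y'0.
have zD m m' : cox v z (m + m') = cox v z m * cox v z m'.
  by apply: coxD => r; rewrite z0 inE.
have zZ k m : cox v z (k *: m) = cox v z m ^ k.
  rewrite /cox (big_morph (fun x : C => x ^ k) (fun x y => expfzMl x y k) (exp1rz _ _)).
  by apply: eq_bigr => r _; rewrite evZ mulrC exprz_exp.
have z1 m : (forall r, r \in A -> ev v m r = 0) -> cox v z m = 1.
  move=> m0; have yy : cox v (bundle_cox y) m = cox v (bundle_cox y') m.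
    by apply: H => r rA; rewrite m0.
  have y0 : cox v (bundle_cox y) m != 0 by exact: cox_neq0.
  apply: (mulIf y0); rewrite mul1r [RHS]yy /cox -big_split; apply: eq_bigr => r _ /=.
  case rA: (r \in A); first by rewrite m0// !expr0z mulr1.
  by rewrite /z rA -expfzMl divfK//; move: rA; rewrite inE => /negbT.
(* For e_j outside [A] the character e_j - (v_j / g) u is orthogonal to [A], so the ratio at j is
   z(u)^(v_j / g). Any t with t^g = z(u) turns this into t^(v_j). *)
have [u [u0 Hu]] := bezout_on v (fun j => inl j \notin A).
set g := int_pairing u v in Hu.
have [i vi yi] := BC_cover y.
have iA : inl i \notin A by rewrite yA.
have g0 : g != 0.
  apply/eqP => g0; have := Hu i iA; rewrite g0 dvd0z => /eqP v0.
  by rewrite v0 mulr0 ltxx in vi.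
have zu0 : cox v z u != 0 by apply: cox_neq0 => r; rewrite z0 inE.
have [t t0 tg] := complex_root g0 zu0.
exists t => //; split.
  2: by rewrite -[LHS]/(fiber_coord y') -[y.2]/(fiber_coord y) l0 l'0 mulr0.
apply/rowP => j; rewrite mxE.
have [jA|jA] := boolP (inl j \in A).
  by move: (jA) (jA); rewrite {1}yA y'A => /eqP-> /eqP->; rewrite mulr0.
have zj : cox v z (std_basis j) = base_point y' 0 j / base_point y 0 j.
  rewrite /cox big_sumType /= (bigD1 j)//= [X in _ * X * _]big1 => [|i' ij].
    rewrite mulr1 ev_inl mxE !eqxx expr1z big1 => [|c _].
      by rewrite /z (negbTE jA) mulr1.
    rewrite /z; case: ifP => cA; first by rewrite exp1rz.
    rewrite /bundle_cox; have -> /= : c == b = false by apply/negbTE; apply: contraFneq cA => ->.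
    by rewrite divff ?exp1rz ?oner_neq0.
  by rewrite ev_inl mxE eqxx (negbTE ij) expr0z.
have vE : v 0 j = divz (v 0 j) g * g by have /divzK := Hu j jA.
have m0 r : r \in A -> ev v (std_basis j + (- divz (v 0 j) g) *: u) r = 0.
  case: r => [i' iA'|c cA]; rewrite evD evZ.
    rewrite !ev_inl u0 ?negbK// mulr0 addr0 mxE eqxx /=; case: eqP => [ij|//].
    by rewrite -ij iA' in jA.
  by rewrite !ev_inr int_pairing_basis -/g {1}vE; ring.
have := z1 _ m0; rewrite zD zZ zj -tg exprz_exp mulrN [g * _]mulrC -vE => E.
have yj : base_point y 0 j != 0 by rewrite -yA.
rewrite -[LHS](divfK yj); congr (_ * _).
by rewrite [LHS](canRL (mulfK (expfz_neq0 _ t0)) E) div1r invr_expz opprK.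
Qed.

Lemma jmap_inj : injective jmap.
Proof.
move=> p p'; have [y <-] := quotient_mapP p; have [y' <-] := quotient_mapP p'.
by rewrite !jmapE => /bundle_map_inj yy'; apply/quotient_map_eq; exact: rst_step.
Qed.

Lemma bundle_map_chart i y (s : Sigma) : sg b * v 0 i < 0 -> unit_locus i y ->
  val s = cone_of v R (maximal b i) ->
  bundle_map y = chart (cox_point v (val s) (bundle_cox y)).
Proof.
move=> vi yi; apply: Cox_chart; first exact: allowed_maximal.
exact: bundle_cox_zeros.
Qed.

Lemma cox_point_bundle i (s : set 'rV[R]_n.+1) (x : affine_toric s) :
  sg b * v 0 i < 0 -> s = cone_of v R (maximal b i) ->
  exists2 y, unit_locus i y & x = cox_point v s (bundle_cox y).
Proof.
move=> vi sE; have [z [zA xE zb]] := cox_point_surj x sE.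
have zi : z (inl i) != 0.
  apply/negP => z0; have : inl i \in maximal b i.
    by apply: (fintype.subsetP zA); rewrite inE.
  by rewrite inl_maximal eqxx.
have Bp : B (\row_j z (inl j)) by apply: (proj2 (BE _)); exists i => //; rewrite mxE.
pose y : BC := (exist (fun p => p \in B) _ (mem_set Bp), z (inr b)).
exists y; first by rewrite /unit_locus /= mxE.
rewrite xE; congr cox_point; apply/funext => -[j|c] /=; first by rewrite mxE.
case: eqP => [->//|cb]; rewrite zb; suff -> : inr c \notin zeros z by [].
by apply/negP => /(fintype.subsetP zA); rewrite inr_maximal => /eqP.
Qed.

Lemma range_jmap : range jmap = @open_subvariety_of_subfan R n.+1 Sigma (Lambda R v b).
Proof.
apply/seteqP; split=> [_ [p _ <-]|_ [s [x [Ls ->]]]].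
  have [y <-] := quotient_mapP p; rewrite jmapE.
  have [i vi yi] := BC_cover y.
  have sE := index_coneE SigmaE (allowed_maximal vi).
  rewrite (bundle_map_chart vi yi sE).
  exists (index_cone SigmaE (maximal b i)), (cox_point v _ (bundle_cox y)); split=> //.
  by rewrite sE LambdaE; exists (maximal b i) => //; exists i.
move: Ls; rewrite LambdaE => -[A [i vi Ai] sE].
have [z [zA xE _]] := cox_point_surj x (esym sE).
have tE := index_coneE SigmaE (allowed_maximal vi).
have : Cox SigmaE z = chart x.
  by rewrite (Cox_chart SigmaE (allowed_sub Ai (allowed_maximal vi)) zA (esym sE)) xE.
rewrite (Cox_chart SigmaE (allowed_maximal vi) (fintype.subset_trans zA Ai) tE).
have [y yi ->] := cox_point_bundle (cox_point v _ z) vi tE.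
rewrite -(bundle_map_chart vi yi tE) => <-.
by exists (quotient_map _ y) => //; rewrite jmapE.
Qed.

(** * Homogeneous functions and descent to the toric charts *)

Definition monomial (a : 'I_n.+1 -> nat) (k : nat) (y : BC) : C :=
  (\prod_j base_point y 0 j ^+ a j) * fiber_coord y ^+ k.

Definition weight (a : 'I_n.+1 -> nat) (k : nat) : int :=
  \sum_j v 0 j * (a j)%:Z + w * k%:Z.

(** Generated by monomials rather than defined by the scaling law, because the exponents are needed
    to write an invariant function in terms of characters. *)
Inductive homogeneous (o : int) : (BC -> C) -> Prop :=
| homogeneous_monomial c a k : weight a k = o ->
    homogeneous o (fun y => c * monomial a k y)
| homogeneous0 : homogeneous o (fun=> 0)
| homogeneousD f g : homogeneous o f -> homogeneous o g ->
    homogeneous o (fun y => f y + g y).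

Lemma homogeneousM o o' f g : homogeneous o f -> homogeneous o' g ->
  homogeneous (o + o') (fun y => f y * g y).
Proof.
move=> hf hg; elim: hf => [c a k ak| |f1 f2 _ IH1 _ IH2].
- elim: hg => [c' a' k' ak'| |g1 g2 _ IH1 _ IH2].
  + have -> : (fun y => c * monomial a k y * (c' * monomial a' k' y)) =
        (fun y => (c * c') * monomial (fun j => a j + a' j)%N (k + k') y).
      apply/funext => y; rewrite /monomial exprD.
      rewrite [in RHS](eq_bigr (fun j => base_point y 0 j ^+ a j * base_point y 0 j ^+ a' j)).
        by rewrite big_split /=; ring.
      by move=> j _; rewrite exprD.
    apply: homogeneous_monomial; rewrite -ak -ak' /weight.
    under eq_bigr => j _ do rewrite PoszD mulrDr.
    by rewrite big_split /= PoszD; ring.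
  + have -> : (fun y => c * monomial a k y * 0) = (fun=> 0).
      by apply/funext => y; rewrite mulr0.
    exact: homogeneous0.
  + have -> : (fun y => c * monomial a k y * (g1 y + g2 y)) =
      (fun y => c * monomial a k y * g1 y + c * monomial a k y * g2 y).
      by apply/funext => y; rewrite mulrDr.
    exact: homogeneousD.
- have -> : (fun y => 0 * g y) = (fun=> 0) by apply/funext => y; rewrite mul0r.
  exact: homogeneous0.
- have -> : (fun y => (f1 y + f2 y) * g y) = (fun y => f1 y * g y + f2 y * g y).
    by apply/funext => y; rewrite mulrDl.
  exact: homogeneousD.
Qed.

Lemma homogeneous_cst c : homogeneous 0 (fun=> c).
Proof.
have -> : (fun=> c) = (fun y => c * monomial (fun=> 0%N) 0 y).
  by apply/funext => y; rewrite /monomial big1 ?mulr1.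
by apply: homogeneous_monomial; rewrite /weight big1 ?mulr0// => j _; rewrite mulr0.
Qed.

Lemma homogeneousX o f k : homogeneous o f -> homogeneous (o *+ k) (fun y => f y ^+ k).
Proof.
move=> hf; elim: k => [|k IH]; first exact: homogeneous_cst.
have -> : (fun y => f y ^+ k.+1) = (fun y => f y * f y ^+ k).
  by apply/funext => y; rewrite exprS.
by rewrite mulrS; exact: homogeneousM.
Qed.

Lemma homogeneous_scaled o f t y y' : t != 0 -> scaled t y y' ->
  homogeneous o f -> f y' = t ^ o * f y.
Proof.
move=> t0 [yy ll]; elim=> [c a k <-| |f1 f2 _ E1 _ E2]; last 2 first.
- by rewrite mulr0.
- by rewrite E1 E2 mulrDr.
rewrite [RHS]mulrCA; congr (_ * _); rewrite /monomial ll exprMn /weight expfzDr//.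
have -> : \prod_j base_point y' 0 j ^+ a j =
    t ^ (\sum_j v 0 j * (a j)%:Z) * \prod_j base_point y 0 j ^+ a j.
  rewrite (eq_bigr (fun j => t ^ (v 0 j * (a j)%:Z) * base_point y 0 j ^+ a j)).
    by rewrite big_split /= prod_expz.
  by move=> j _; rewrite yy mxE exprMn; congr (_ * _); rewrite -exprz_exp.
have -> : (t ^ w) ^+ k = t ^ (w * k%:Z) by rewrite -exprz_exp.
ring.
Qed.

Definition bundle_gen : set (BC -> C) :=
  [set f | exists2 g,
     [set f | exists2 g, [set f | exists j, f = fun x : 'rV[C]_n.+1 => x 0 j] g &
        f = g \o val] g & f = g \o fst] `|`
  [set f | exists2 g, [set id] g & f = g \o snd].

Lemma quasi_affine_BC : quasi_affine bundle_gen.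
Proof.
apply: quasi_affine_product; [exact: sheaf_base|exact: sheaf_affine| |].
  exact: quasi_affine_subvariety (quasi_affine_model _).
exact: quasi_affine_model.
Qed.

Lemma weight_decomposition h : subalgebra bundle_gen h ->
  exists (I : finType) (o : I -> int) (H : I -> BC -> C),
    (forall i, homogeneous (o i) (H i)) /\ forall y, h y = \sum_i H i y.
Proof.
have one o f : homogeneous o f -> exists (I : finType) (o : I -> int) (H : I -> BC -> C),
    (forall i, homogeneous (o i) (H i)) /\ forall y, f y = \sum_i H i y.
  move=> hf; exists (unit : finType), (fun=> o), (fun=> f); split=> // y.
  by rewrite big_const card_unit /= addr0.
elim=> [f|c|f g _ [K [wt [H [hH E]]]] _ [K' [wt' [H' [hH' E']]]]
        |f g _ [K [wt [H [hH E]]]] _ [K' [wt' [H' [hH' E']]]]].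
- case=> [[_ [_ [j ->] ->] ->]|[_ -> ->]].
    apply: (one (weight (fun i => (i == j)%N) 0)).
    have -> : ((fun x : 'rV[C]_n.+1 => x 0 j) \o val) \o fst =
        (fun y : BC => 1 * monomial (fun i => (i == j)%N) 0 y).
      apply/funext => y; rewrite mul1r /monomial mulr1 (bigD1 j)//= eqxx expr1 big1 ?mulr1//.
      by move=> i /negbTE->; rewrite expr0.
    exact: homogeneous_monomial.
  apply: (one (weight (fun=> 0%N) 1)).
  have -> : id \o snd = (fun y : BC => 1 * monomial (fun=> 0%N) 1 y).
    by apply/funext => y; rewrite mul1r /monomial big1 ?mul1r ?expr1.
  exact: homogeneous_monomial.
- exact: one (homogeneous_cst c).
- exists (K + K')%type, (fun i => match i with inl i => wt i | inr i => wt' i end),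
    (fun i => match i with inl i => H i | inr i => H' i end); split; first by case.
  by move=> y; rewrite E E' big_sumType.
- exists (K * K')%type, (fun i => wt i.1 + wt' i.2), (fun i y => H i.1 y * H' i.2 y); split.
    by move=> i; exact: homogeneousM.
  by move=> y; rewrite E E' big_distrlr pair_big.
Qed.

Lemma homogeneous_sum (I : finType) (P : pred I) o (H : I -> BC -> C) :
  (forall i, P i -> homogeneous o (H i)) -> homogeneous o (fun y => \sum_(i | P i) H i y).
Proof.
move=> hH; elim: (index_enum I) => [|i r IH].
  have -> : (fun y => \sum_(i <- [::] | P i) H i y) = (fun=> 0).
    by apply/funext => y; rewrite big_nil.
  exact: homogeneous0.
case Pi: (P i).
  have -> : (fun y => \sum_(j <- i :: r | P j) H j y) =
    (fun y => H i y + \sum_(j <- r | P j) H j y).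
    by apply/funext => y; rewrite big_cons Pi.
  by apply: homogeneousD => //; exact: hH.
have -> : (fun y => \sum_(j <- i :: r | P j) H j y) = (fun y => \sum_(j <- r | P j) H j y).
  by apply/funext => y; rewrite big_cons Pi.
exact: IH.
Qed.

(* Multiplying by a power of the coordinate that is a unit on the chart turns
   a homogeneous function into an invariant one. *)
Lemma homogeneous_invariant i (s : set 'rV[R]_n.+1) o f e : sg b * v 0 i < 0 ->
  s = cone_of v R (maximal b i) -> homogeneous o f -> o + e * v 0 i = 0 ->
  exists2 g, Alg (s := s) g & forall y, unit_locus i y ->
    f y * base_point y 0 i ^ e = g (cox_point v s (bundle_cox y)).
Proof.
move=> vi sE hf; elim: hf => [c a k <-| |f1 f2 _ IH1 _ IH2] oe; last 2 first.
- exists (fun=> 0); first exact: subalgebra_cst.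
  by move=> y _; rewrite mul0r.
- have [g1 A1 E1] := IH1 oe; have [g2 A2 E2] := IH2 oe.
  exists (fun x => g1 x + g2 x); first exact: subalgebra_add.
  by move=> y yi; rewrite mulrDl E1// E2.
(* Total weight 0 forces the pairing of [m] with [v] to be - w k, so its value on [inr b] is exactly
   the exponent k of the fiber coordinate. Only entry i may be negative, and e_i is not a ray of the
   chart. *)
pose m : 'rV[int]_n.+1 := \row_j ((a j)%:Z + (j == i)%:Z * e).
have mv : int_pairing m v = - (w * k%:Z).
  apply/eqP; rewrite -addr_eq0 -oe /weight; apply/eqP.
  rewrite /int_pairing addrAC; congr (_ + _).
  rewrite (eq_bigr (fun j => v 0 j * (a j)%:Z + (j == i)%:Z * e * v 0 j)); last first.
    by move=> j _; rewrite mxE; ring.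
  rewrite big_split /=; congr (_ + _); rewrite (bigD1 i)//= eqxx mul1r big1 ?addr0//.
  by move=> j /negbTE->; rewrite !mul0r.
have mb : ev v m (inr b) = k by rewrite ev_inr mv wE; case: (b); rewrite /sg; ring.
have Sm : semigroup s m.
  rewrite sE; apply/semigroup_cone_of => -[j|c']; last first.
    by rewrite inr_maximal => /eqP->; rewrite mb.
  by rewrite inl_maximal ev_inl mxE => /negbTE->; rewrite mul0r addr0.
exists (fun x => c * character_value x m).
  by apply: subalgebra_mul; [exact: subalgebra_cst|exact: Alg_character].
move=> y yi; rewrite (cox_pointE sE (bundle_cox_zeros yi) Sm) -mulrA; congr (_ * _).
rewrite /cox big_sumType /= (bigD1 b)//= eqxx mb [X in _ = _ * (_ * X)]big1; last first.
  by move=> c' /negbTE->; rewrite exp1rz.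
rewrite mulr1 /monomial mulrAC; congr (_ * _).
rewrite [in LHS](bigD1 i)//= [RHS](bigD1 i)//= mulrAC; congr (_ * _).
  by rewrite ev_inl mxE eqxx mul1r expfzDr.
by apply: eq_bigr => j /negbTE ji; rewrite ev_inl mxE ji mul0r addr0.
Qed.

(* For f invariant, f h = g holds along whole orbits, so comparing the
   coefficients of the powers of t gives f h_a = g_a for each weight a. *)
Lemma descent i (s : set 'rV[R]_n.+1) (W : set BC) f g h y0 :
  sg b * v 0 i < 0 -> s = cone_of v R (maximal b i) ->
  (forall t y y', t != 0 -> scaled t y y' -> W y -> W y' /\ f y' = f y) ->
  subalgebra bundle_gen g -> subalgebra bundle_gen h ->
  (forall y, W y -> f y * h y = g y) -> unit_locus i y0 -> h y0 != 0 ->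
  exists g' h', [/\ Alg (s := s) g', Alg (s := s) h',
    h' (cox_point v s (bundle_cox y0)) != 0 &
    forall y, W y -> unit_locus i y ->
      f y * h' (cox_point v s (bundle_cox y)) = g' (cox_point v s (bundle_cox y))].
Proof.
move=> vi sE satW Gg Gh fhg yi hy0.
have [K [wt [H [hH hE]]]] := weight_decomposition Gh.
have [K' [wt' [G [hG gE]]]] := weight_decomposition Gg.
pose Ho a y := \sum_(i | wt i == a) H i y.
pose Go a y := \sum_(i | wt' i == a) G i y.
have hHo a : homogeneous a (Ho a) by apply: homogeneous_sum => ? /eqP <-.
have hGo a : homogeneous a (Go a) by apply: homogeneous_sum => ? /eqP <-.
have fHG a y : W y -> f y * Ho a y = Go a y.
  move=> Wy; apply/eqP; rewrite -subr_eq0; apply/eqP.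
  (* By invariance of [f], the equation at the scaled points reads f(y) h(t y) - g(t y) = 0: a
     Laurent polynomial in t with terms indexed by both decompositions. *)
  have := @laurent_eq0 _ (K + K')%type
    (fun x => match x with inl x => f y * H x y | inr x => - G x y end)
    (fun x => match x with inl x => wt x | inr x => wt' x end) _ a.
  rewrite big_sumType /= -mulr_sumr sumrN; apply => t t0.
  have [y' yy'] := scaled_exists y t0; have [Wy' fy'] := satW _ _ _ t0 yy' Wy.
  have := fhg y' Wy'; rewrite fy' hE gE => /eqP; rewrite -subr_eq0 => /eqP E0.
  rewrite -[RHS]E0 big_sumType /= mulr_sumr -sumrN; congr (_ + _); apply: eq_bigr => x _.
    by rewrite (homogeneous_scaled t0 yy' (hH x)) mulrCA.
  by rewrite (homogeneous_scaled t0 yy' (hG x)) mulrN.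
have [a Ha] : exists a, Ho a y0 != 0.
  apply/not_existsP => nH; case/eqP: hy0; rewrite hE; apply: (@sum_by_weight _ _ _ wt).
  by move=> a; apply/eqP/negPn/negP => /nH.
(* A power of the unit coordinate changes the weight only by multiples of v_i. Hence h_a is raised
   to the power N, whose weight is such a multiple, and f h_a^N = g_a h_a^(N-1) gives a numerator of
   equal weight. *)
pose N := absz (v 0 i).
have NE : N%:Z = - (sg b * v 0 i) by rewrite /N; move: vi; case: (b) => /=; lia.
have N0 : (0 < N)%N by lia.
have wN : a *+ N + (a * sg b) * v 0 i = 0.
  by rewrite pmulrn mulrzz NE; ring.
have wN' : a + a *+ N.-1 + (a * sg b) * v 0 i = 0 by rewrite -mulrS prednK.
have hGa := homogeneousM (hGo a) (homogeneousX N.-1 (hHo a)).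
have [h' Ah' Eh] := homogeneous_invariant vi sE (homogeneousX N (hHo a)) wN.
have [g' Ag' Eg] := homogeneous_invariant vi sE hGa wN'.
exists g', h'; split=> //.
  by rewrite -Eh// mulf_neq0 ?expf_neq0 ?expfz_neq0.
move=> y Wy yi'; rewrite -Eh// -Eg// -fHG// -[in LHS](prednK N0) exprS.
by rewrite !mulrA.
Qed.

Lemma quotient_map_scaled t y y' : t != 0 -> scaled t y y' ->
  quotient_map (@twisted_rel R n d1 d2 q B w) y =
  quotient_map (@twisted_rel R n d1 d2 q B w) y'.
Proof. by move=> t0 yy'; apply/quotient_map_eq; apply: rst_step; exists t. Qed.

Lemma open_jmap (W : set E) : open W -> open (jmap @` W).
Proof.
move=> oW; apply: (toric_open_locally SigmaE) => _ [p Wp <-].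
have [y yE] := quotient_mapP p; subst p; rewrite jmapE.
have [i vi yi] := BC_cover y.
have sE := index_coneE SigmaE (allowed_maximal vi).
pose W' : set BC := quotient_map (@twisted_rel R n d1 d2 q B w) @^-1` W.
have oW' : open W' := open_quotient_map oW.
have [h [Gh hy hW]] := quasi_affine_base quasi_affine_BC oW' Wp.
(* Descent is applied to the indicator of [W'], which is invariant and satisfies f h = h because [h]
   vanishes off [W']. The descended numerator f h' is then nonzero only inside [W]. *)
pose f y : C := if pselect (W' y) is left _ then 1 else 0.
have [|y' _|g' [h' [Ag Ah h'y E']]] := @descent i _ setT f h h y vi sE _ Gh Gh _ yi hy.
- move=> t y1 y2 t0 yy _; split=> //; rewrite /f /W' /=.
  by rewrite (quotient_map_scaled t0 yy).
- rewrite /f; case: pselect => [_|nW]; first by rewrite mul1r.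
  rewrite mul0r; apply/eqP; rewrite eq_sym; apply/negPn/negP => /hW.
  exact: nW.
exists (index_cone SigmaE (maximal b i)), (cox_point v _ (bundle_cox y)), g'; split=> //.
- exact: bundle_map_chart vi yi sE.
- rewrite -E'// mulf_neq0// /f; case: pselect => [_|//]; exact: oner_neq0.
move=> x' gx'; have [y' yi' xE] := cox_point_bundle x' vi sE.
rewrite xE -(bundle_map_chart vi yi' sE) -jmapE; exists (quotient_map _ y') => //.
move: gx'; rewrite xE -E'// /f; case: pselect => // _; rewrite mul0r eqxx//.
Qed.

Lemma regular_jmap (W : set E) (h : X -> C) : open W -> regular W (h \o jmap) ->
  regular (jmap @` W) h.
Proof.
move=> oW rh; apply: (toric_regular_locally SigmaE (open_jmap oW)) => _ [p Wp <-].
have [y yE] := quotient_mapP p; subst p; rewrite jmapE.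
have [i vi yi] := BC_cover y.
have sE := index_coneE SigmaE (allowed_maximal vi).
pose W' : set BC := quotient_map (@twisted_rel R n d1 d2 q B w) @^-1` W.
have oW' : open W' := open_quotient_map oW.
have [g [k [Gg Gk ky E']]] := quasi_affine_regular quasi_affine_BC oW' (regular_quotient_map rh) Wp.
have [|g' [k' [Ag Ak k'y E'']]] := @descent i _ W' _ g k y vi sE _ Gg Gk E' yi ky.
  move=> t y1 y2 t0 yy Wy1; rewrite /W' /= -(quotient_map_scaled t0 yy); split=> //.
exists (index_cone SigmaE (maximal b i)), (cox_point v _ (bundle_cox y)), g', k'; split=> //.
  exact: bundle_map_chart vi yi sE.
move=> x' Wx' _; have [y' yi' xE] := cox_point_bundle x' vi sE.
rewrite xE -E''//.
  by rewrite -(bundle_map_chart vi yi' sE) /= jmapE.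
case: Wx' => p Wp'; rewrite xE -(bundle_map_chart vi yi' sE) -jmapE => /jmap_inj pE.
by rewrite /W' /= -pE.
Qed.

Lemma isomorphism_jmap :
  isomorphism_onto jmap (@open_subvariety_of_subfan R n.+1 Sigma (Lambda R v b)).
Proof.
apply: isomorphism_onto_intro.
- exact: sheaf_quotient sheaf_BC.
- exact: sheaf_toric.
- exact: morphism_jmap.
- exact: jmap_inj.
- exact: range_jmap.
- exact: open_jmap.
- exact: regular_jmap.
Qed.

Lemma delta_coordinates (s : Sigma) (x : affine_toric (val s)) (e : subvariety B) :
  val s = @delta R n -> val e = coordinates x :> 'rV[C]_n.+1 ->
  jmap (bundle_point d1 d2 q w e 1) = chart x.
Proof.
rewrite (deltaE R v) => sE ex; rewrite [LHS]jmapE.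
have [z [zA xE zb]] := cox_point_surj x sE.
have zr c : z (inr c) = 1.
  rewrite zb; suff -> : inr c \notin zeros z by [].
  by apply/negP => /(fintype.subsetP zA)/imsetP[].
have aA : allowed v [set inl j | j : 'I_n.+1].
  by apply: allowed_inl => c; apply/imsetP => -[].
have ze : bundle_cox (e, 1) = z.
  apply/funext => -[j|c] /=; last by rewrite /fiber_coord /= zr; case: ifP.
  rewrite /base_point /= ex mxE.
  have Sj : semigroup (val s) (std_basis j).
    rewrite sE; apply/semigroup_cone_of => _ /imsetP[j' _ ->].
    by rewrite ev_inl mxE; case: (_ && _).
  by rewrite {1}xE (cox_pointE sE zA Sj) cox_basis.
by rewrite /bundle_map ze (Cox_chart SigmaE aA zA sE) -xE.
Qed.

(** * The zero section *)

Local Notation XB := (orbit_space d1 d2 q B).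

Definition zero_point (e : subvariety B) : BC := (e, (0 : C)).

Lemma zero_point_rel e e' : orbit_rel d1 d2 q e e' ->
  bundle_map (zero_point e) = bundle_map (zero_point e').
Proof.
by move=> [t t0 ee']; apply: bundle_map_rel; exists t => //; split; rewrite ?mulr0.
Qed.

Definition smap : XB -> X := quotient_lift (bundle_map \o zero_point).

Lemma smapE e : smap (quotient_map _ e) = bundle_map (zero_point e).
Proof. by apply: quotient_liftE => ? ?; exact: zero_point_rel. Qed.

Lemma morphism_smap : morphism smap.
Proof.
apply: (morphism_quotient_lift sheaf_base); first by move=> ? ?; exact: zero_point_rel.
apply: (morphism_local sheaf_base) => e; have [i vi ei] := BC_cover (zero_point e).
have rc j : regular setT (fun e : subvariety B => base_point (zero_point e) 0 j).
  exact: (regular_comp (@morphism_inclusion _ _ B) (regular_coordinate j)).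
pose D := [set e : subvariety B | base_point (zero_point e) 0 i != 0].
have oD : open D.
  by have := sheaf_open sheaf_base openT (rc i); rewrite setTI.
exists D; split; [exact: oD|exact: ei|].
apply: (@morphism_on_Cox _ _ _ _ SigmaE (subvariety B) sheaf_base D (maximal b i)
         (bundle_cox \o zero_point) _ oD (allowed_maximal vi)).
- by [].
- by move=> e' ei'; exact: bundle_cox_zeros.
- move=> [j|c]; first exact: (sheaf_sub sheaf_base (@subsetT _ _) (rc j)).
  by rewrite /= /fiber_coord /=; case: (c == b); exact: (sheaf_cst sheaf_base).
Qed.

Definition bundle_proj : E -> XB :=
  quotient_lift (fun y : BC => quotient_map (@orbit_rel R n d1 d2 q B) y.1).

Lemma bundle_proj_rel y y' : twisted_rel d1 d2 q w y y' ->
  quotient_map (@orbit_rel R n d1 d2 q B) y.1 = quotient_map (@orbit_rel R n d1 d2 q B) y'.1.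
Proof.
by move=> [t t0 [yy _]]; apply/quotient_map_eq; apply: rst_step; exists t.
Qed.

Lemma bundle_projE y : bundle_proj (quotient_map _ y) = quotient_map _ y.1.
Proof. by apply: quotient_liftE => ? ?; exact: bundle_proj_rel. Qed.

Lemma morphism_bundle_proj : morphism bundle_proj.
Proof.
apply: (morphism_quotient_lift sheaf_BC); first by move=> ? ?; exact: bundle_proj_rel.
by apply: morphism_comp; [exact: morphism_fst|exact: morphism_quotient_map].
Qed.

Lemma isomorphism_smap : isomorphism_onto smap (range smap).
Proof.
pose zc (x : XB) : E := quotient_map (@twisted_rel R n d1 d2 q B w) (zero_point (repr x)).
have H1 x : smap x = jmap (zc x) by rewrite jmapE.
have H2 : cancel zc bundle_proj by move=> x; rewrite bundle_projE; exact: reprK.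
exact (isomorphism_onto_retract (sheaf_quotient _ sheaf_base) (sheaf_toric Sigma)
  isomorphism_jmap morphism_smap morphism_bundle_proj H1 H2).
Qed.

Lemma range_smap : range smap = [set y | exists z, [/\ y = Cox SigmaE z,
  z (inr b) = 0, z (inr (~~ b)) = 1 & exists2 i, sg b * v 0 i < 0 & z (inl i) != 0]].
Proof.
apply/seteqP; split=> [_ [p _ <-]|_ [z [-> z0 z1 [i vi zi]]]].
  have [e <-] := quotient_mapP p; rewrite smapE.
  have [i vi ei] := BC_cover (zero_point e).
  exists (bundle_cox (zero_point e)); split=> //=; last by exists i.
    by rewrite eqxx.
  by case: (b).
have Bp : B (\row_j z (inl j)) by apply: (proj2 (BE _)); exists i => //; rewrite mxE.
pose e : subvariety B := exist (fun p => p \in B) _ (mem_set Bp).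
exists (quotient_map _ e) => //; rewrite smapE /bundle_map; congr Cox.
apply/funext => -[j|c] /=; first by rewrite /base_point /= mxE.
case: eqP => [->|cb]; first by rewrite z0.
by rewrite -z1; congr (z (inr _)); move: cb; case: (b); case: (c).
Qed.

End Bundle.

(** * The action and its fixed locus *)

Section Action.
Variables (R : realType) (n : nat) (v : 'rV[int]_n.+1).
Local Notation C := R[i].
Variable Sigma : set (set 'rV[R]_n.+1).
Hypothesis SigmaE : Sigma = Sigma_all R v.
Local Notation X := (toric_variety Sigma).
Local Notation Cx := (Cox SigmaE).
Implicit Type z : ray n -> C.

Lemma germ_act (t : Gm C) (s : set 'rV[R]_n.+1) (x : affine_toric s) m c :
  germ (one_parameter_act v t x) m c <->
  exists2 c', germ x m c' & c = gm_val t ^ int_pairing m v * c'.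
Proof.
have t0 := gm_neq0 t; split.
  move=> [a [b [Sa Sb b0 mE ->]]].
  exists (character_value x a / character_value x b).
    exists a, b; split=> //; apply: contraNneq b0 => b0.
    by rewrite /character_value /= -/(character_value x b) b0 mulr0.
  rewrite mE -[- b]scaleN1r int_pairingD int_pairingZ mulN1r expfzDr// -invr_expz.
  by rewrite invfM mulrACA.
move=> [_ [a [b [Sa Sb b0 mE ->]]] ->]; exists a, b; split=> //.
  by rewrite mulf_neq0// expfz_neq0.
rewrite mE -[- b]scaleN1r int_pairingD int_pairingZ mulN1r expfzDr// -invr_expz.
by rewrite invfM mulrACA.
Qed.

Definition act (t : Gm C) : X -> X :=
  quotient_lift (fun p : charts_union Sigma =>
    @chart R n.+1 Sigma _ (one_parameter_act v t (projT2 p))).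

Lemma act_chart t (s : Sigma) (x : affine_toric (val s)) :
  act t (chart x) = chart (one_parameter_act v t x).
Proof.
rewrite /act quotient_liftE// => p p' /(glued_germ SigmaE) E.
apply/(chart_eq SigmaE); apply/funext => m; apply/funext => c; apply/propext.
by split=> /germ_act[c' g ->]; apply/germ_act; exists c' => //; move: g; rewrite E.
Qed.

Lemma regular_Gm_exp (k : int) : regular setT (fun t : Gm C => gm_val t ^ k).
Proof.
have sG : sheaf (Gm C) by apply: sheaf_subvariety; exact: sheaf_affine.
apply: (sheaf_exprz sG openT); last by right=> t _; exact: gm_neq0.
have r := regular_comp (@morphism_inclusion _ (affine_line C) [set t : C | t != 0])
  (@regular_line R).
exact: (sheaf_eq sG _ r).
Qed.

Lemma algebraic_act : algebraic_action act.
Proof.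
split; last 2 first.
- move=> y; have [s [x ->]] := chart_surj y; rewrite act_chart; congr chart.
  apply: affine_toric_eq => m _.
  by rewrite -[LHS]/(1 ^ int_pairing m v * character_value x m) exp1rz mul1r.
- move=> t t' y; have [s [x ->]] := chart_surj y; rewrite !act_chart; congr chart.
  apply: affine_toric_eq => m _.
  rewrite -[LHS]/((gm_val t * gm_val t') ^ int_pairing m v * character_value x m).
  by rewrite expfzMl -mulrA.
have sG : sheaf (Gm C) by apply: sheaf_subvariety; exact: sheaf_affine.
have sX := sheaf_toric Sigma; have sZ := sheaf_product sG sX.
apply: (morphism_local sZ) => -[t0 y0]; have [s [x0 ->]] := chart_surj y0.
pose V : set X := range (@chart R n.+1 Sigma s).
have oV : open V := open_range_chart SigmaE (s := s).
pose D : set (product (Gm C) X) := setT `*` V.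
have oD : open D by exact: open_setX openT oV.
(* The inverse of the chart on its range [V]; the value elsewhere is a placeholder. *)
pose xi (y : X) : affine_toric (val s) :=
  if pselect (exists x, @chart R n.+1 Sigma s x = y) is left e then projT1 (cid e)
  else cox_point v _ (fun=> 1).
have xiK y : V y -> chart (xi y) = y.
  move=> [x _ <-]; rewrite /xi; case: pselect => [e|[]]; last by exists x.
  by case: cid.
exists D; split; [exact: oD|by split=> //; exists x0|].
refine (@morphism_on_chart R n Sigma (product (Gm C) X) sZ D s
  (fun u => one_parameter_act v u.1 (xi u.2)) (fun u => act u.1 u.2) oD _ _).
  by move=> [t y] [_ Vy] /=; rewrite -act_chart xiK.
move=> m Sm.
have r1 := sheaf_sub sZ (@subsetT _ D) (regular_comp (@morphism_fst _ (Gm C) X)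
  (regular_Gm_exp (int_pairing m v))).
have r2 := @regular_snd _ (Gm C) X V _ oV (regular_push SigmaE (Alg_character Sm)).
apply: (sheaf_eq sZ _ (sheaf_mul sZ r1 r2)) => -[t y] [_ Vy] /=.
by rewrite -{1}(xiK y Vy) (push_chart SigmaE).
Qed.

Definition scale (t : C) (z : ray n -> C) (r : ray n) : C :=
  if r is inl j then t ^ v 0 j * z r else z r.

Lemma zeros_scale t z : t != 0 -> zeros (scale t z) = zeros z.
Proof.
move=> t0; apply/setP => -[j|c]; rewrite !inE //=.
by rewrite mulf_eq0 expfz_eq0 (negbTE t0) andbF.
Qed.

Lemma cox_scale t z m : t != 0 -> cox v (scale t z) m = t ^ int_pairing m v * cox v z m.
Proof.
move=> t0; rewrite /cox !big_sumType /= mulrA; congr (_ * _).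
rewrite (eq_bigr (fun j => t ^ (v 0 j * m 0 j) * z (inl j) ^ ev v m (inl j))).
  rewrite big_split /=; congr (_ * _).
  rewrite (eq_bigr (fun j => t ^ (m 0 j * v 0 j))); last by move=> j _; rewrite mulrC.
  by rewrite prod_expz.
by move=> j _; rewrite expfzMl exprz_exp ev_inl.
Qed.

Lemma Cox_zeros_chart z (s : Sigma) (x : affine_toric (val s)) A :
  allowed v (zeros z) -> allowed v A -> val s = cone_of v R A -> Cx z = chart x ->
  zeros z \subset A.
Proof.
move=> az aA sE zx; have [z' [z'A xE _]] := cox_point_surj x sE.
have E : Cx z = Cx z' by rewrite zx xE (Cox_chart SigmaE aA z'A sE).
by have [-> _] := Cox_inj az (allowed_sub z'A aA) E.
Qed.

Lemma act_Cox (t : Gm C) z : allowed v (zeros z) -> act t (Cx z) = Cx (scale (gm_val t) z).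
Proof.
move=> az; have t0 := gm_neq0 t; have sE := index_coneE SigmaE az.
have zs := zeros_scale z t0.
rewrite {1}/Cox act_chart (Cox_chart SigmaE az _ sE) ?zs//; congr chart.
apply: affine_toric_eq => m Sm; rewrite (cox_pointE sE) ?zs// cox_scale//.
rewrite -[LHS]/(gm_val t ^ int_pairing m v * character_value (cox_point v _ z) m).
by rewrite (cox_pointE sE).
Qed.

Definition end_cox (b : bool) (z : ray n -> C) : Prop :=
  [/\ z (inr b) = 0, z (inr (~~ b)) = 1 & exists2 i, sg b * v 0 i < 0 & z (inl i) != 0].

Definition inner_cox (z : ray n -> C) : Prop :=
  (forall c, z (inr c) = 1) /\ forall j, v 0 j != 0 -> z (inl j) = 0.

Definition end_component b : set X := [set y | exists2 z, end_cox b z & y = Cx z].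
Definition inner_component : set X := [set y | exists2 z, inner_cox z & y = Cx z].

Lemma zeros_end b z i : z (inr (~~ b)) != 0 -> z (inl i) != 0 -> zeros z \subset maximal b i.
Proof.
move=> z1 zi; apply/fintype.subsetP => -[j|c]; rewrite inE.
  by rewrite inl_maximal => zj; apply: contraTneq zj => ->.
by rewrite inr_maximal; move: z1; case: (b); case: (c) => //= /negbTE->.
Qed.

Lemma allowed_end b z : end_cox b z -> allowed v (zeros z).
Proof.
move=> [_ z1 [i vi zi]]; apply: allowed_sub (allowed_maximal vi).
by apply: zeros_end; rewrite ?z1 ?oner_neq0.
Qed.

Lemma allowed_inner z : (forall c, z (inr c) = 1) -> allowed v (zeros z).
Proof. by move=> z1; apply: allowed_inl => c; rewrite inE z1 oner_neq0. Qed.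

Lemma two_expz (k : int) : (2 : C) ^ k = 1 -> k = 0.
Proof.
have two_expn e : (2 : C) ^+ e = 1 -> e = 0%N.
  rewrite -natrX => /eqP; rewrite -[1]/(1%:R) eqr_nat => /eqP.
  by case: e => // e; rewrite expnS; lia.
case: k => k; first by move/two_expn->.
rewrite NegzE -exprnN => /(congr1 GRing.inv); rewrite invrK invr1.
by move/two_expn.
Qed.

(** A vanishing coordinate at [inr b] puts a point at the end [b], the required nonzero base
    coordinate coming from [allowed]. If neither such coordinate vanishes, both are 1, and fixedness
    must annihilate every p_j of nonzero weight. *)
Lemma fixed_locus_act :
  fixed_locus act = end_component false `|` end_component true `|` inner_component.
Proof.
apply/seteqP; split.
  move=> y Hy; have [z [az yE zc]] := Cox_surj SigmaE y.
  have endc b : inr b \in zeros z -> end_component b y.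
    move=> bz; have [nb [i [iz vi]]] := az b bz; exists z => //; split.
    - by move: bz; rewrite inE => /eqP.
    - by rewrite zc nb.
    - by exists i => //; move: iz; rewrite inE.
  have [fz|fz] := boolP (inr false \in zeros z); first by left; left; exact: endc.
  have [tz|tz] := boolP (inr true \in zeros z); first by left; right; exact: endc.
  right; exists z => //; have z1 c : z (inr c) = 1.
    by rewrite zc; case: c; rewrite ?tz ?fz.
  split=> // j vj; apply/eqP/negPn/negP => zj.
  (* One element of infinite order detects all weights: 2^(v_j) = 1 only for v_j = 0. *)
  have t0 : (2 : C) != 0 by rewrite pnatr_eq0.
  have := Hy (gm t0); rewrite yE act_Cox// => E.
  have [|zz H] := Cox_inj _ az E; first by rewrite zeros_scale.
  have := H (std_basis j); rewrite cox_scale// int_pairing_basis.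
  have c0 : cox v z (std_basis j) != 0.
    apply: cox_neq0 => -[i iz|c]; last by rewrite inE z1 oner_eq0.
    rewrite ev_inl mxE eqxx /=; case: eqP => [ij|//].
    by move: iz; rewrite inE ij (negbTE zj).
  move=> /(_ _)/(canRL (mulfK c0)); rewrite divff// => H2.
  move/eqP: vj; apply; apply: two_expz; apply: H2 => r.
  rewrite zeros_scale// => -rz; rewrite -[X in _ <= X]addr0.
  case: r rz => [i _|c]; last by rewrite inE z1 oner_eq0.
  by rewrite addr0 ev_inl mxE; case: (_ && _).
have endF b y : end_component b y -> fixed_locus act y.
  move=> [z ez ->] t; have az := allowed_end ez; have t0 := gm_neq0 t.
  rewrite act_Cox//; symmetry; apply: Cox_ext => //; first by rewrite zeros_scale.
  move=> m Hm; rewrite cox_scale//; have [zb _ _] := ez.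
  have bz : inr b \in zeros z by rewrite inE zb.
  (* A character positive on [inr b] vanishes at the point; one that is zero on [inr b] pairs to 0
     with [v], so t acts trivially on its value. *)
  have := Hm _ bz; rewrite le_eqVlt => /orP[/eqP m0|m0]; last by rewrite (cox_eq0 bz m0) mulr0.
  suff -> : int_pairing m v = 0 by rewrite expr0z mul1r.
  by move: m0; rewrite ev_inr; case: (b); rewrite /sg ?mul1r ?mulN1r; lia.
move=> y [[/endF//|/endF//]|[z [z1 z0] ->] t].
rewrite act_Cox; last exact: allowed_inner.
congr (Cox SigmaE _); apply/funext => -[j|c] //=.
by have [->|/z0->] := eqVneq (v 0 j) 0; rewrite ?expr0z ?mul1r ?mulr0.
Qed.

(** * Polynomial curves and the connected components of the fixed locus *)

Lemma line_subalgebra h : subalgebra [set (id : C -> C)] h ->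
  exists P : {poly C}, forall t, h t = P.[t].
Proof.
elim=> [_ ->|c|f g _ [P E] _ [Q F]|f g _ [P E] _ [Q F]].
- by exists 'X => t; rewrite hornerX.
- by exists c%:P => t; rewrite hornerC.
- by exists (P + Q) => t; rewrite hornerD E F.
- by exists (P * Q) => t; rewrite hornerM E F.
Qed.

Lemma line_base (U : set (affine_line C)) (a : C) : open U -> U a ->
  exists P : {poly C}, P.[a] != 0 /\ forall t, P.[t] != 0 -> U t.
Proof.
move=> oU Ua; have [h [Gh ha HU]] := affine_base oU Ua.
have [P E] := line_subalgebra Gh; exists P; rewrite -E; split=> // t.
by rewrite -E; exact: HU.
Qed.

Lemma poly_common (P Q : {poly C}) a a' : P.[a] != 0 -> Q.[a'] != 0 ->
  exists t, P.[t] != 0 /\ Q.[t] != 0.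
Proof.
move=> Pa Qa; have P0 : P != 0 by apply: contraNneq Pa => ->; rewrite horner0.
apply/not_existsP => H; case/eqP: Qa.
suff -> : Q = 0 by rewrite horner0.
apply: (poly_eq0_generic P0) => t Pt; apply/eqP/negPn/negP => Qt.
by apply: (H t).
Qed.

Lemma regular_poly (P : {poly C}) : regular setT (fun s : affine_line C => P.[s]).
Proof.
apply: regular_affine.
have -> : (fun s : C => P.[s]) = (fun s => \sum_(i <- index_enum 'I_(size P) | true) P`_i * s ^+ i).
  by apply/funext => s; rewrite horner_coef.
apply: subalgebra_sum => i _; apply: subalgebra_mul; first exact: subalgebra_cst.
by apply: subalgebra_exp; exact: subalgebra_gen.
Qed.

Definition curve (p : ray n -> {poly C}) (s : C) (r : ray n) : C := (p r).[s].

(** Membership of a polynomial curve in a chart becomes the nonvanishing of one polynomial, so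
    several such conditions can be met at a common parameter. *)
Lemma curve_locus (p : ray n -> {poly C}) (A : {set ray n}) : let Q := \prod_(r | r \notin A) p r in
  forall s, (Q.[s] != 0) = (zeros (curve p s) \subset A).
Proof.
move=> Q s; rewrite /Q horner_prod; apply/prodf_neq0/fintype.subsetP => H r.
  by rewrite inE => rs; apply/negPn/negP => rA; have := H r rA; rewrite rs.
by move=> rA; apply: contra rA => rs; apply: H; rewrite inE.
Qed.

Lemma morphism_curve (p : ray n -> {poly C}) A : allowed v A ->
  open ([set s | zeros (curve p s) \subset A] : set (affine_line C)) /\
  @morphism_on C (affine_line C) X [set s | zeros (curve p s) \subset A]
    (fun s => Cx (curve p s)).
Proof.
move=> aA; have sL : sheaf (affine_line C) by exact: sheaf_affine.
have oD : open ([set s | zeros (curve p s) \subset A] : set (affine_line C)).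
  have := sheaf_open sL openT (regular_poly (\prod_(r | r \notin A) p r)).
  rewrite setTI; congr open; apply/seteqP; split=> s /=.
    by rewrite curve_locus.
  by rewrite curve_locus.
split=> //; apply: (@morphism_on_Cox _ _ _ _ SigmaE _ sL _ A (curve p)) => //.
by move=> r; exact: (sheaf_sub sL (@subsetT _ _) (regular_poly (p r))).
Qed.

Lemma curve_open (p : ray n -> {poly C}) A (U : set X) a : allowed v A -> open U ->
  zeros (curve p a) \subset A -> U (Cx (curve p a)) ->
  exists Q : {poly C}, Q.[a] != 0 /\
    forall s, Q.[s] != 0 -> zeros (curve p s) \subset A /\ U (Cx (curve p s)).
Proof.
move=> aA oU za Ua; have [oD [H _]] := morphism_curve p aA.
by have [Q [Qa HQ]] := line_base (H U oU) (conj za Ua); exists Q.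
Qed.

Lemma irreducible_connected (T : topologicalType) (F : set T) :
  (forall U V, open U -> open V -> F `&` U !=set0 -> F `&` V !=set0 ->
     F `&` (U `&` V) !=set0) -> connected F.
Proof.
move=> H B B0 [U oU BU] [V cV BV]; apply/seteqP; split; first by rewrite BU; exact: subIsetl.
move=> x Fx; apply: contrapT => Bx.
have [|||y [Fy [Uy]]] := H U (~` V) oU; last first.
  by apply; move: (conj Fy Uy : (F `&` U) y); rewrite -BU BV => -[].
- by exists x; split=> // Vx; apply: Bx; rewrite BV.
- by rewrite -BU.
- by rewrite openC.
Qed.

(** [U] shows that [F] is open in [A] and [V] that it is closed in [A], so a connected subset of [A]
    through [y] cannot leave [F]. *)
Lemma component_of (T : topologicalType) (A F U V : set T) y : connected F -> F y ->
  F `<=` A -> open U -> open V -> F `<=` U -> A `<=` F `|` V -> F `&` V = set0 ->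
  (forall x, A x -> U x -> F x) -> connected_component A y = F.
Proof.
move=> cF Fy FA oU oV FU AFV FV UF; apply/seteqP; split; last first.
  by move=> x Fx; exists F.
move=> x [K [Ky KA cK] Kx].
suff E : K `&` U = K by move: Kx; rewrite -E => -[/KA Ax Ux]; exact: UF.
apply: cK.
- by exists y; split=> //; exact: FU.
- by exists U.
- exists (~` V); first by rewrite closedC.
  apply/seteqP; split=> z [Kz].
    by move=> /(UF z (KA z Kz)) Fz; split=> // Vz; have : (F `&` V) z by []; rewrite FV.
  by move=> nVz; split=> //; apply: FU; case: (AFV z (KA z Kz)).
Qed.

Definition segment z z' (r : ray n) : {poly C} := (z r)%:P + (z' r - z r) *: 'X.

Lemma segmentE z z' s : curve (segment z z') s = fun r => z r + (z' r - z r) * s.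
Proof. by apply/funext => r; rewrite /curve /segment !hornerE. Qed.

Lemma segment0 z z' : curve (segment z z') 0 = z.
Proof. by rewrite segmentE; apply/funext => r; rewrite mulr0 addr0. Qed.

Lemma segment1 z z' : curve (segment z z') 1 = z'.
Proof. by rewrite segmentE; apply/funext => r; rewrite mulr1 addrC subrK. Qed.

(* The segment joining the Cox coordinates of two points is a curve in X that
   meets any neighbourhoods of its ends at a common generic parameter, so such
   a set is irreducible. *)
Lemma segment_connected (P : (ray n -> C) -> Prop) :
  (forall z, P z -> exists A, [/\ allowed v A, zeros z \subset A &
     forall z' z'' s, P z' -> P z'' -> zeros (curve (segment z' z'') s) \subset A ->
       P (curve (segment z' z'') s)]) ->
  connected [set y : X | exists2 z, P z & y = Cx z].
Proof.
move=> H; apply: irreducible_connected => U V oU oV.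
move=> [_ [[z Pz ->] Uz]] [_ [[z' Pz' ->] Vz']].
have [A [aA zA HA]] := H z Pz; have [A' [aA' zA' _]] := H z' Pz'.
have [||Q [Q0 HQ]] := @curve_open (segment z z') A U 0 aA oU; rewrite ?segment0//.
have [||Q' [Q1 HQ']] := @curve_open (segment z z') A' V 1 aA' oV; rewrite ?segment1//.
have [s [Qs Q's]] := poly_common Q0 Q1.
have [zs Us] := HQ s Qs; have [_ Vs] := HQ' s Q's.
exists (Cx (curve (segment z z') s)); split; last by [].
by exists (curve (segment z z') s); first exact: HA.
Qed.

Lemma connected_end b : connected (end_component b).
Proof.
apply: segment_connected => z [zb z1 [i vi zi]].
exists (maximal b i); split; first exact: allowed_maximal.
  by apply: zeros_end; rewrite ?z1 ?oner_neq0.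
move=> z' z'' s [z'b z'1 _] [z''b z''1 _] zs; split.
- by rewrite segmentE z'b z''b; ring.
- by rewrite segmentE z'1 z''1; ring.
exists i => //; apply/negP => si.
have : inl i \in maximal b i by apply: (fintype.subsetP zs); rewrite inE.
by rewrite inl_maximal eqxx.
Qed.

Definition basis_rays : {set ray n} := [set inl j | j : 'I_n.+1].

Lemma allowed_basis_rays : allowed v basis_rays.
Proof. by apply: allowed_inl => c; apply/imsetP => -[]. Qed.

Lemma zeros_basis z : (forall c, z (inr c) = 1) -> zeros z \subset basis_rays.
Proof.
move=> z1; apply/fintype.subsetP => -[j _|c]; first by apply/imsetP; exists j.
by rewrite inE z1 oner_eq0.
Qed.

Lemma connected_inner : connected inner_component.
Proof.
apply: segment_connected => z [z1 z0].
exists basis_rays; split; [exact: allowed_basis_rays|exact: zeros_basis|].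
move=> z' z'' s [z'1 z'0] [z''1 z''0] _; split=> [c|j vj].
  by rewrite segmentE z'1 z''1; ring.
by rewrite segmentE z'0// z''0//; ring.
Qed.

Definition cone_chart A : set X := range (@chart R n.+1 Sigma (index_cone SigmaE A)).

Lemma open_cone_chart A : open (cone_chart A).
Proof. exact: (open_range_chart SigmaE). Qed.

Lemma cone_chartP A z : allowed v A -> allowed v (zeros z) ->
  cone_chart A (Cx z) <-> zeros z \subset A.
Proof.
move=> aA az; have sE := index_coneE SigmaE aA; split=> [[x _ zx]|zA].
  exact: (Cox_zeros_chart az aA sE (esym zx)).
by rewrite (Cox_chart SigmaE aA zA sE); exists (cox_point v _ z).
Qed.

(** The union of the charts of the maximal cones of [Lambda R v b]. It isolates the end [b] from the
    other fixed points, and it is also the open set on which the limit towards that end exists. *)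
Definition end_nbhd b : set X := \bigcup_(i in [set i | sg b * v 0 i < 0]) cone_chart (maximal b i).

Lemma open_end_nbhd b : open (end_nbhd b).
Proof. by apply: bigcup_open => i _; exact: open_cone_chart. Qed.

Lemma end_nbhdP b z : allowed v (zeros z) -> end_nbhd b (Cx z) <->
  exists2 i, sg b * v 0 i < 0 & zeros z \subset maximal b i.
Proof.
move=> az; split=> [[i vi /(cone_chartP (allowed_maximal vi) az)]|[i vi zi]].
  by exists i.
by exists i => //; apply/(cone_chartP (allowed_maximal vi) az).
Qed.

Lemma end_in_nbhd b : end_component b `<=` end_nbhd b.
Proof.
move=> _ [z ez ->]; have az := allowed_end ez; case: ez => [_ z1 [i vi zi]].
by apply/(end_nbhdP _ az); exists i => //; apply: zeros_end; rewrite ?z1 ?oner_neq0.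
Qed.

Lemma end_nbhd_other b y : end_component (~~ b) y -> ~ end_nbhd b y.
Proof.
move=> [z ez ->] /(end_nbhdP _ (allowed_end ez))[i vi /fintype.subsetP zi].
have [zb _ _] := ez; have := zi (inr (~~ b)); rewrite inE zb eqxx inr_maximal.
by move=> /(_ isT); case: (b).
Qed.

Lemma end_nbhd_inner b y : inner_component y -> ~ end_nbhd b y.
Proof.
move=> [z [z1 z0] ->] /(end_nbhdP _ (allowed_inner z1))[i vi /fintype.subsetP zi].
have vi0 : v 0 i != 0 by apply: contraTneq vi => ->; rewrite mulr0 ltxx.
by have := zi (inl i); rewrite inE z0// eqxx inl_maximal eqxx => /(_ isT).
Qed.

Lemma inner_in_nbhd : inner_component `<=` cone_chart basis_rays.
Proof.
move=> _ [z [z1 z0] ->].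
by apply/(cone_chartP allowed_basis_rays (allowed_inner z1)); exact: zeros_basis.
Qed.

Lemma inner_nbhd_end b y : end_component b y -> ~ cone_chart basis_rays y.
Proof.
move=> [z ez ->] /(cone_chartP allowed_basis_rays (allowed_end ez)) /fintype.subsetP zi.
by have [zb _ _] := ez; have := zi (inr b); rewrite inE zb eqxx => /(_ isT)/imsetP[].
Qed.

Lemma fixed_cases b y : fixed_locus act y <->
  [\/ end_component b y, end_component (~~ b) y | inner_component y].
Proof.
rewrite fixed_locus_act; split; case: b => /=.
- by move=> [[]|] ?; [constructor 2|constructor 1|constructor 3].
- by move=> [[]|] ?; [constructor 1|constructor 2|constructor 3].
- by move=> [] ?; [left; right|left; left|right].
- by move=> [] ?; [left; left|left; right|right].
Qed.

Lemma end_disjoint : end_component false `&` end_component true = set0.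
Proof.
apply/seteqP; split=> // y [y1 y2]; apply: (@end_nbhd_other false y) => //.
exact: end_in_nbhd.
Qed.

Lemma fixed_component_end b : end_component b !=set0 ->
  fixed_component act (end_component b).
Proof.
move=> [y yb]; exists y; first by apply/(fixed_cases b); constructor 1.
symmetry; apply: (@component_of _ _ _ (end_nbhd b)
   (end_nbhd (~~ b) `|` cone_chart basis_rays)).
- exact: connected_end.
- exact: yb.
- by move=> x xb; apply/(fixed_cases b); constructor 1.
- exact: open_end_nbhd.
- by apply: openU; [exact: open_end_nbhd|exact: open_cone_chart].
- exact: end_in_nbhd.
- move=> x /(fixed_cases b)[xb|xb|xi]; first by left.
    by right; left; exact: end_in_nbhd.
  by right; right; exact: inner_in_nbhd.
- apply/seteqP; split=> // x [xb [xn|xn]]; last exact: (inner_nbhd_end xb xn).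
  by apply: (@end_nbhd_other (~~ b) x) => //; rewrite negbK.
- move=> x /(fixed_cases b)[xb|xb|xi] xU //; first by case: (end_nbhd_other xb xU).
  by case: (end_nbhd_inner xi xU).
Qed.

Lemma fixed_component_inner : fixed_component act inner_component.
Proof.
have y0 : inner_component (Cx (fun r => if r is inl _ then 0 else 1)).
  by exists (fun r => if r is inl _ then 0 else 1).
exists (Cx (fun r => if r is inl _ then 0 else 1)).
  by apply/(fixed_cases true); constructor 3.
symmetry; apply: (@component_of _ _ _ (cone_chart basis_rays)
   (end_nbhd true `|` end_nbhd false)).
- exact: connected_inner.
- exact: y0.
- by move=> x xb; apply/(fixed_cases true); constructor 3.
- exact: open_cone_chart.
- by apply: openU; exact: open_end_nbhd.
- exact: inner_in_nbhd.
- move=> x /(fixed_cases true)[xb|xb|xi]; last by left.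
    by right; left; exact: end_in_nbhd.
  by right; right; exact: end_in_nbhd.
- by apply/seteqP; split=> // x [xb [xn|xn]]; exact: (end_nbhd_inner xb xn).
- by move=> x /(fixed_cases true)[xb|xb|xi] xU //; case: (inner_nbhd_end xb xU).
Qed.

(** * Density of the charts and limits of orbits *)

Lemma dense_cone_chart A : allowed v A -> dense (cone_chart A).
Proof.
move=> aA W [y Wy] oW; have [z [az yE _]] := Cox_surj SigmaE y; subst y.
(* A curve from the given point into the torus: each vanishing coordinate becomes the parameter. The
   torus is contained in every chart. *)
pose p (r : ray n) : {poly C} := if z r == 0 then 'X else (z r)%:P.
have p0 : curve p 0 = z.
  apply/funext => r; rewrite /curve /p; have [->|_] := eqVneq (z r) 0.
    by rewrite hornerX.
  by rewrite hornerC.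
have [||Q [Q0 HQ]] := @curve_open p (zeros z) W 0 az oW; rewrite ?p0//.
have X1 : ('X : {poly C}).[1] != 0 by rewrite hornerX oner_neq0.
have [s [Qs]] := poly_common Q0 X1; rewrite hornerX => s0.
have [_ Ws] := HQ s Qs.
have zs : zeros (curve p s) = finset.set0.
  apply/setP => r; rewrite !inE /curve /p; have [_|zr] := eqVneq (z r) 0.
    by rewrite hornerX; exact/negbTE.
  by rewrite hornerC; exact/negbTE.
have as' : allowed v (zeros (curve p s)) by move=> c; rewrite zs inE.
exists (Cx (curve p s)); split=> //.
by apply/(cone_chartP aA as'); rewrite zs finset.sub0set.
Qed.

(* The parameter going to 0 at the end [b]: t at the source, t^-1 at the sink. *)
Definition end_exp (b : bool) (t : C) : C := t ^ sg b.

Lemma limit_end b x : end_nbhd b x -> exists2 y, end_component b y &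
  exists phi : affine_line C -> X, [/\ morphism phi,
    forall t : Gm C, phi (end_exp b (gm_val t)) = act t x & phi (0 : C) = y].
Proof.
have [z [az -> zc]] := Cox_surj SigmaE x; move=> /(end_nbhdP _ az)[i vi zi].
have z1 : z (inr (~~ b)) = 1.
  rewrite zc; suff -> : inr (~~ b) \notin zeros z by [].
  by apply/negP => /(fintype.subsetP zi); rewrite inr_maximal; case: (b).
have zi0 : z (inl i) != 0.
  by apply/negP => /eqP z0; have := fintype.subsetP zi (inl i);
    rewrite inE z0 eqxx inl_maximal eqxx => /(_ isT).
(* Moving along the orbit amounts to scaling the fiber coordinate alone, which extends to the
   parameter 0. *)
pose p (r : ray n) : {poly C} := if r == inr b then z r *: 'X else (z r)%:P.
have pE s r : curve p s r = if r == inr b then z r * s else z r.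
  by rewrite /curve /p; case: ifP; rewrite !hornerE.
have ib : (inl i == inr b :> ray n) = false by [].
have nb : (inr (~~ b) == inr b :> ray n) = false by apply/eqP => -[]; case: (b).
have zp s : zeros (curve p s) \subset maximal b i.
  apply: zeros_end; rewrite pE.
    by rewrite nb z1 oner_neq0.
  by rewrite ib.
exists (Cx (curve p 0)).
  exists (curve p 0) => //; split.
  - by rewrite pE eqxx mulr0.
  - by rewrite pE nb z1.
  - by exists i => //; rewrite pE ib.
exists (fun s => Cx (curve p s)); split=> //.
  have [_ m] := morphism_curve p (allowed_maximal vi).
  apply/morphismT; move: m; congr morphism_on.
  by apply/seteqP; split=> // s _; exact: zp.
move=> t; have t0 := gm_neq0 t; rewrite act_Cox//.
have e0 : end_exp b (gm_val t) != 0 by rewrite expfz_neq0.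
have zz : zeros (curve p (end_exp b (gm_val t))) = zeros (scale (gm_val t) z).
  rewrite zeros_scale//; apply/setP => r; rewrite !inE pE.
  by case: ifP => // _; rewrite mulf_eq0 (negbTE e0) orbF.
apply: Cox_ext => //; first by rewrite zz zeros_scale.
move=> m _; rewrite cox_scale//.
transitivity (end_exp b (gm_val t) ^ ev v m (inr b) * cox v z m).
  rewrite /cox (bigD1 (inr b))//= [in RHS](bigD1 (inr b))//= mulrA pE eqxx expfzMl.
  rewrite [X in X * _ = _]mulrC; congr (_ * _); apply: eq_bigr => r /negbTE rb.
  by rewrite pE rb.
congr (_ * _); rewrite /end_exp exprz_exp ev_inr; congr (_ ^ _).
by case: (b); rewrite /sg; ring.
Qed.

(* Near a limit point in C^{n+1} every coordinate of the orbit would be regular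
   in the parameter, but some nonzero coordinate has a pole. *)
Lemma limit_not_inner b (U : set X) : (exists i, sg b * v 0 i < 0) ->
  open U -> dense U ->
  ~ (forall x, U x -> exists2 y, inner_component y &
    exists phi : affine_line C -> X, [/\ morphism phi,
      forall t : Gm C, phi (end_exp b (gm_val t)) = act t x & phi (0 : C) = y]).
Proof.
move=> [i vi] oU dU H.
have a0 : allowed v finset.set0 by move=> c; rewrite inE.
(* A point of the torus, so that all its coordinates are nonzero. *)
have [x [tx Ux]] : (cone_chart finset.set0 `&` U) !=set0.
  apply: dU; last exact: open_cone_chart.
  exists (Cx (fun=> 1)); apply/(cone_chartP a0); first exact: allowed_inner.
  by rewrite finset.subset0; apply/eqP/setP => r; rewrite !inE oner_eq0.
have [z [az xE zc]] := Cox_surj SigmaE x; subst x.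
have /(cone_chartP a0 az) := tx; rewrite finset.subset0 => /eqP z0.
have {H}[y Yy [phi [mphi phit phi0]]] := H _ Ux.
have aB := allowed_basis_rays; have sE := index_coneE SigmaE aB.
set s := index_cone SigmaE basis_rays in sE.
have Si : semigroup (val s) (std_basis i).
  rewrite sE; apply/semigroup_cone_of => _ /imsetP[j _ ->].
  by rewrite ev_inl mxE; case: (_ && _).
pose g : X -> C := push (fun x : affine_toric (val s) => character_value x (std_basis i)).
have rg : regular (cone_chart basis_rays) g := regular_push SigmaE (Alg_character Si).
have [/continuousP cphi rphi] := mphi.
have oD := cphi _ (@open_cone_chart basis_rays).
have D0 : (phi @^-1` cone_chart basis_rays) (0 : C) by rewrite /= phi0; exact: inner_in_nbhd.
have [G [H [GG GH H0 E]]] := affine_regular (rphi _ _ (@open_cone_chart basis_rays) rg) D0.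
have [P [P0 HP]] := line_base oD D0.
have [PG EG] := line_subalgebra GG; have [PH EH] := line_subalgebra GH.
pose k := absz (v 0 i).
have k0 : (0 < k)%N by rewrite /k; move: vi; case: (b) => /=; lia.
have vk : sg b * v 0 i = - k%:Z by rewrite /k; move: vi; case: (b) => /=; lia.
have zi : z (inl i) != 0.
  by apply/negP => zi; have : inl i \in zeros z; [rewrite inE|rewrite z0 inE].
(* Along the orbit the i-th coordinate is z_i u^(-k), a pole of order k. Clearing it in the fraction
   PG / PH gives this polynomial identity, and at 0 it would force z_i PH(0) = 0. *)
suff K : z (inl i) *: PH - 'X^k * PG = 0.
  have := congr1 (fun p : {poly C} => p.[0]) K.
  rewrite !(hornerD, hornerN, hornerM, hornerZ, hornerXn, horner0) expr0n (gtn_eqF k0).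
  rewrite mul0r subr0 -EH => /eqP; rewrite mulf_eq0 (negbTE zi) (negbTE H0)//.
(* Off the zeros of [P] the curve stays in the chart, and off 0 it follows the orbit. *)
apply: (@poly_eq0_generic _ _ (P * 'X)).
  apply: mulf_neq0; last by rewrite -size_poly_eq0 size_polyX.
  by apply: contraNneq P0 => ->; rewrite horner0.
move=> u; rewrite !hornerE mulf_eq0 negb_or => /andP[Pu u0].
have t0 : end_exp b u != 0 by rewrite expfz_neq0.
have sgK : end_exp b (end_exp b u) = u.
  by rewrite /end_exp exprz_exp; case: (b); rewrite /sg ?mulr1 ?mulrNN ?mulr1 expr1z.
have phiu : phi u = Cx (scale (end_exp b u) z).
  by rewrite -[in LHS]sgK -[end_exp b u in LHS]/(gm_val (gm t0)) phit act_Cox.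
have zs : zeros (scale (end_exp b u) z) = finset.set0 by rewrite zeros_scale.
have zsB : zeros (scale (end_exp b u) z) \subset basis_rays by rewrite zs finset.sub0set.
have gu : g (phi u) = u ^ (- k%:Z) * cox v z (std_basis i).
  rewrite phiu (Cox_chart SigmaE aB zsB sE) /g (push_chart SigmaE) (cox_pointE sE)//.
  by rewrite cox_scale// /end_exp exprz_exp -vk int_pairing_basis.
have := E u (HP u Pu); rewrite /= gu EG EH => E'.
have -> : z (inl i) = cox v z (std_basis i).
  by rewrite cox_basis// => c; rewrite zc z0 inE.
rewrite -E' !mulrA -[u ^+ k]/(u ^ k%:Z) -expfzDr// subrr expr0z mul1r subrr//.
Qed.

End Action.

(** * The given weights and the inner component *)

Section WeightSigns.
Variables (n d1 d2 : nat) (q : 'I_n.+1 -> nat).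
Hypothesis hd12 : (d1 <= d2)%N.
Hypothesis hq : forall i : 'I_n.+1, weighted d1 d2 i -> (0 < q i)%N.
Local Notation v := (weight_vector d1 d2 q).

Lemma weight_negative i : (sg true * v 0 i < 0) = (i < d1)%N.
Proof.
rewrite /sg mul1r mxE; case: ltnP => i1.
  by have := hq (i := i); rewrite /weighted i1 => /(_ isT); lia.
by case: ltnP.
Qed.

Lemma weight_positive i : (sg false * v 0 i < 0) = (d2 <= i)%N.
Proof.
rewrite /sg mulN1r mxE; case: (ltnP i d1) => i1; first by lia.
case: (ltnP i d2) => i2; first by rewrite oppr0 ltxx.
by have := hq (i := i); rewrite /weighted i2 orbT => /(_ isT); lia.
Qed.

Lemma weight_eq0 i : (v 0 i == 0) = (d1 <= i < d2)%N.
Proof.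
rewrite mxE; case: (ltnP i d1) => i1.
  by have := hq (i := i); rewrite /weighted i1 => /(_ isT); lia.
case: (ltnP i d2) => i2; first by rewrite eqxx.
by have := hq (i := i); rewrite /weighted i2 orbT => /(_ isT); lia.
Qed.

Variable R : realType.

Lemma Lambda_plusE : Lambda_plus R d1 d2 q = Lambda R v false.
Proof.
rewrite /Lambda_plus /Lambda; congr (faces _); congr image.
by apply/seteqP; split=> i /=; rewrite weight_positive.
Qed.

Lemma Lambda_minusE : Lambda_minus R d1 d2 q = Lambda R v true.
Proof.
rewrite /Lambda_minus /Lambda; congr (faces _); congr image.
by apply/seteqP; split=> i /=; rewrite weight_negative.
Qed.

Lemma Sigma_tildeE : Sigma_tilde R d1 d2 q = Sigma_all R v.
Proof. by rewrite Sigma_allE -Lambda_plusE -Lambda_minusE. Qed.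

Hypothesis hd2 : (d2 < n.+1)%N.
Variable Sigma : set (set 'rV[R]_n.+1).
Hypothesis SigmaE : Sigma = Sigma_all R v.
Local Notation C := R[i].
Local Notation X := (toric_variety Sigma).
Local Notation inner := (inner_component SigmaE).

(** The test [d1 <= j] cannot be left to [insub]: truncated subtraction would send every j < d1 to
    index 0. For j >= d2 it is [insub] that fails and gives 0. *)
Definition inner_point (p : 'rV[C]_(d2 - d1)) (r : ray n) : C :=
  match r with
  | inl j => if (d1 <= j)%N then if insub (j - d1)%N is Some k then p 0 k else 0 else 0
  | inr _ => 1
  end.

Lemma inner_point_cox p : inner_cox v (inner_point p).
Proof.
split=> // j; rewrite weight_eq0 /= => vj; case: ifP => // j1.
by case: insubP => // k kj _; move: vj; rewrite j1 /= -leqNgt; lia.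
Qed.

Lemma inner_index_subproof (k : 'I_(d2 - d1)) : (d1 + k < n.+1)%N.
Proof. by have := ltn_ord k; lia. Qed.

Definition inner_index (k : 'I_(d2 - d1)) : 'I_n.+1 := Ordinal (inner_index_subproof k).

Lemma inner_point_index p k : inner_point p (inl (inner_index k)) = p 0 k.
Proof. by rewrite /= leq_addr addKn valK. Qed.

(** The component lies in the chart of [delta], where the basis characters are the ordinary
    coordinates; those of weight 0 give the isomorphism and the others vanish. *)
Lemma isomorphic_inner : isomorphic (subvariety inner) (affine_space C (d2 - d1)).
Proof.
have sX := sheaf_toric Sigma; have sY : sheaf (subvariety inner) := sheaf_subvariety _ sX.
have sA : sheaf (affine_space C (d2 - d1)) by exact: sheaf_affine.
have aB := allowed_basis_rays v; have sE := index_coneE SigmaE aB.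
set s := index_cone SigmaE (basis_rays n) in sE.
have Sj j : semigroup (val s) (std_basis j).
  rewrite sE; apply/semigroup_cone_of => _ /imsetP[j' _ ->].
  by rewrite ev_inl mxE; case: (_ && _).
pose c j : X -> C := push (fun x : affine_toric (val s) => character_value x (std_basis j)).
have cE z j : inner_cox v z -> c j (Cox SigmaE z) = z (inl j).
  move=> [z1 z0]; have zB := zeros_basis z1.
  rewrite (Cox_chart SigmaE aB zB sE) /c (push_chart SigmaE) (cox_pointE sE)//.
  exact: cox_basis.
pose f (y : subvariety inner) : affine_space C (d2 - d1) :=
  \row_k c (inner_index k) (val y) : 'rV[C]_(d2 - d1).
have inI p : Cox SigmaE (inner_point p) \in inner.
  by apply/mem_set; exists (inner_point p) => //; exact: inner_point_cox.
pose g (p : affine_space C (d2 - d1)) : subvariety inner :=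
  exist (fun y => y \in inner) _ (inI p).
exists f; split; last exists g; last split.
- apply/morphismT; apply: (morphism_on_affine sY openT) => _ [k ->].
  have rc := regular_push SigmaE (Alg_character (Sj (inner_index k))).
  have [_ rv] := @morphism_inclusion _ X inner.
  have r1 := rv _ _ (@open_cone_chart _ _ _ _ SigmaE (basis_rays n)) rc.
  have r2 := sheaf_sub sY (W := setT) _ r1.
  apply: (sheaf_eq sY _ (r2 _)) => [y _|y _]; first by rewrite /= mxE.
  exact: (inner_in_nbhd (set_mem (valP y))).
- apply: (morphism_corestrict sA sX); apply/morphismT.
  apply: (@morphism_on_Cox _ _ _ _ SigmaE _ sA setT (basis_rays n) inner_point _ openT aB).
  + by [].
  + by move=> p _; apply: zeros_basis.
  + move=> [j|b]; last exact: (sheaf_cst sA).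
    rewrite /inner_point; case: (d1 <= j)%N; last exact: (sheaf_cst sA).
    case: (insub (j - d1)%N) => [k|]; last exact: (sheaf_cst sA).
    by apply: regular_affine; apply: subalgebra_gen; exists k.
- move=> y; apply: val_inj; rewrite /=.
  have [z iz yE] : inner (val y) by exact: set_mem (valP y).
  rewrite yE; congr (Cox SigmaE _); apply/funext => -[j|b] /=; last by case: iz => ->.
  case: (boolP (v 0 j == 0)) => [|vj]; last first.
    have [_ ->//] := iz; case: ifP => // j1; case: insubP => // k kj _.
    by move: vj; rewrite weight_eq0 j1 /= -leqNgt; lia.
  rewrite weight_eq0 => /andP[j1 j2]; rewrite j1; case: insubP => [k kj kE|]; last by lia.
  rewrite mxE yE cE//; congr (z (inl _)); apply: val_inj => /=.
  by rewrite kE; lia.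
- move=> p; apply/rowP => k; rewrite mxE /= cE; last exact: inner_point_cox.
  exact: inner_point_index.
Qed.

End WeightSigns.

Theorem proposition3p11 (R : realType) (n d1 d2 : nat) (q : 'I_n.+1 -> nat)
    (hd1 : (1 < d1)%N) (hd12 : (d1 <= d2)%N) (hd2 : (d2 < n.+1)%N)
    (hq : forall i : 'I_n.+1, weighted d1 d2 i -> (0 < q i)%N)
    (hcoprime : (\big[gcdn/0]_(i < n.+1 | weighted d1 d2 i) q i)%N = 1%N) :
  [/\ is_fan (Lambda_plus R d1 d2 q), is_fan (Lambda_minus R d1 d2 q)
    & is_fan (Sigma_tilde R d1 d2 q)] /\
  exists a : Gm R[i] -> X_tilde R d1 d2 q -> X_tilde R d1 d2 q,
    [/\ algebraic_action a,
        associated_to (weight_vector d1 d2 q) a &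
    exists (jp : E_plus R d1 d2 q -> X_tilde R d1 d2 q)
           (jm : E_minus R d1 d2 q -> X_tilde R d1 d2 q)
           (sm : X_minus R d1 d2 q -> X_tilde R d1 d2 q)
           (sp : X_plus R d1 d2 q -> X_tilde R d1 d2 q)
           (Y : set (X_tilde R d1 d2 q)),
      [/\ bundle_identification (Lambda_plus R d1 d2 q) jp /\
          bundle_identification (Lambda_minus R d1 d2 q) jm,
          zero_section_of jp sm /\ zero_section_of jm sp,
          isomorphism_onto sm (range sm) /\ isomorphism_onto sp (range sp),
          fixed_locus a = range sm `|` range sp `|` Y &
          [/\ is_sink a (range sm), is_source a (range sp),
              range sm `&` range sp = set0, is_inner a Y &
              isomorphic (subvariety Y) (affine_space R[i] (d2 - d1))]]].
Proof.
pose v := weight_vector d1 d2 q.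
have LpE := Lambda_plusE hd12 hq R; have LmE := Lambda_minusE hd12 hq R.
have SigmaE := Sigma_tildeE hd12 hq R.
split.
  by rewrite LpE LmE SigmaE; split; [| |exact: fan_Sigma_all]; exact: fan_Lambda.
have BpE (p : 'rV[R[i]]_n.+1) : B_plus d2 p <->
    exists2 i, sg false * v 0 i < 0 & p 0 i != 0.
  by split=> -[i vi pi]; exists i; rewrite // ?weight_positive// -(weight_positive hd12 hq).
have BmE (p : 'rV[R[i]]_n.+1) : B_minus d1 p <->
    exists2 i, sg true * v 0 i < 0 & p 0 i != 0.
  by split=> -[i vi pi]; exists i; rewrite // ?weight_negative// -(weight_negative hd12 hq).
have wp : (1 : int) = - sg false by [].
have wm : (-1 : int) = - sg true by [].
pose jp : E_plus R d1 d2 q -> X_tilde R d1 d2 q :=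
  @jmap R n d1 d2 q _ SigmaE false (B_plus d2) 1.
pose jm : E_minus R d1 d2 q -> X_tilde R d1 d2 q :=
  @jmap R n d1 d2 q _ SigmaE true (B_minus d1) (-1).
pose sm : X_minus R d1 d2 q -> X_tilde R d1 d2 q :=
  @smap R n d1 d2 q _ SigmaE false (B_plus d2).
pose sp : X_plus R d1 d2 q -> X_tilde R d1 d2 q :=
  @smap R n d1 d2 q _ SigmaE true (B_minus d1).
have smE : range sm = end_component SigmaE false.
  rewrite (range_smap SigmaE BpE wp); apply/seteqP; split=> y.
    by move=> [z [-> z0 z1 zi]]; exists z.
  by move=> [z [z0 z1 zi] ->]; exists z.
have spE : range sp = end_component SigmaE true.
  rewrite (range_smap SigmaE BmE wm); apply/seteqP; split=> y.
    by move=> [z [-> z0 z1 zi]]; exists z.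
  by move=> [z [z0 z1 zi] ->]; exists z.
(* The first index has negative weight since d1 is positive, the last one positive weight since d2 <
   n+1. This makes both ends nonempty and gives every generic orbit a pole in each direction. *)
have side b : exists i, sg b * v 0 i < 0.
  case: b; first by exists ord0; rewrite (weight_negative hd12 hq)//; exact: ltnW.
  by exists ord_max; rewrite (weight_positive hd12 hq)//= -ltnS.
have end_neq0 b : end_component SigmaE b !=set0.
  have [i vi] := side b; pose z (r : ray n) : R[i] := if r is inr c then (c != b)%:R else 1.
  exists (Cox SigmaE z); exists z => //; split; rewrite /z.
  - by rewrite eqxx.
  - by case: (b).
  - by exists i => //; exact: oner_neq0.
(* A single chart of a maximal cone at this end is already dense. *)
have dense_end b : dense (end_nbhd SigmaE b).
  have [i vi] := side b; move=> W W0 oW.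
  have [y [Wy iy]] := dense_cone_chart SigmaE (allowed_maximal vi) W0 oW.
  by exists y; split=> //; exists i.
exists (act v (Sigma := Sigma_tilde R d1 d2 q)); split.
- exact: algebraic_act SigmaE.
- by move=> t s x; exact: (act_chart SigmaE).
exists jp, jm, sm, sp, (inner_component SigmaE); split.
- split; split; rewrite ?LpE ?LmE; first exact: (isomorphism_jmap SigmaE BpE wp).
  + by move=> s x e; exact: (delta_coordinates SigmaE BpE wp).
  + exact: (isomorphism_jmap SigmaE BmE wm).
  + by move=> s x e; exact: (delta_coordinates SigmaE BmE wm).
- split=> e; first by rewrite [LHS](smapE SigmaE BpE wp) [RHS](jmapE SigmaE BpE wp).
  by rewrite [LHS](smapE SigmaE BmE wm) [RHS](jmapE SigmaE BmE wm).
- split; first exact: (isomorphism_smap SigmaE BpE wp).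
  exact: (isomorphism_smap SigmaE BmE wm).
- by rewrite smE spE; exact: fixed_locus_act.
rewrite smE spE; split.
- split; first exact: fixed_component_end.
  exists (end_nbhd SigmaE false); split; [exact: open_end_nbhd|exact: dense_end|].
  move=> x /limit_end[y Yy [phi [mphi phit phi0]]]; exists y => //; exists phi; split=> //.
- split; first exact: fixed_component_end.
  exists (end_nbhd SigmaE true); split; [exact: open_end_nbhd|exact: dense_end|].
  by move=> x /limit_end[y Yy [phi [mphi phit phi0]]]; exists y => //; exists phi; split.
- exact: end_disjoint.
- split; first exact: fixed_component_inner.
  + move=> [_ [U [oU dU H]]]; apply: (limit_not_inner (side false) oU dU) => x Ux.
    by have [y Yy [phi [mphi phit phi0]]] := H x Ux; exists y => //; exists phi; split.
  + move=> [_ [U [oU dU H]]]; apply: (limit_not_inner (side true) oU dU) => x Ux.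
    by have [y Yy [phi [mphi phit phi0]]] := H x Ux; exists y => //; exists phi; split.
- exact: isomorphic_inner.
Qed.
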